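(* If $s \in (0,1)$ and $b \in \mathrm{BMO}^s$, then the commutator $[b,S]$ of multiplication by $b$ with the Haar shift $S$ is bounded on $H^s$ with $$\|[b,S]\|_{H^s\rightarrow H^s} \le C\, \|b\|_{\mathrm{BMO}^s},$$ where $C>0$ is independent of $b$ (it may depend on $s$). Moreover, if $b \in \mathrm{CMO}^s$, then $[b,S]$ is compact on $H^s$.
   Context: All functions are real-valued and defined on $I_0=[0,1]$; $L^p=L^p([0,1])$; $(f,g)=\int_{I_0} f(x)g(x)\,dx$. Dyadic system: $\mathcal D=\{2^{-j}([0,1)+k): j=0,1,2,\dots,\ k=0,\dots,2^j-1\}$; the top interval $[0,1)$ is identified with $I_0$. For $I\in\mathcal D$, $I_-,I_+$ are its left and right halves (dyadic children), $h_I=|I|^{-1/2}(\mathbb 1_{I_-}-\mathbb 1_{I_+})$ is the Haar function, and $\mathcal D(I)=\{J\in\mathcal D: J\subseteq I\}$. For $N\in\mathbb N$, $\mathcal D_N=\{I\in\mathcal D: |I|\ge 2^{-N}\}$ and $\mathcal D_N^c=\mathcal D\setminus\mathcal D_N$. Local dyadic fractional Sobolev space: $D^sf=\sum_{I\in\mathcal D}|I|^{-s}(f,h_I)h_I$, and $H^s$ is the set of $f\in L^2$ with $\|f\|_{H^s}^2:=\|D^sf\|_{L^2}^2+\|f\|_{L^2}^2<\infty$, where $\|D^sf\|_{L^2}^2=\sum_{I\in\mathcal D}|I|^{-2s}|(f,h_I)|^2$. Dyadic Sobolev $s$-capacity: for $E\subseteq I_0$, $\mathrm{Cap}_s(E)=\inf\{\|f\|_{H^s}^2: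 f\in H^s,\ f\ge 1 \text{ a.e. on } E\}$ (equal to $\infty$ if no such $f$ exists). $b\in\mathrm{BMO}^s$ means $b\in L^1$ and $$\|b\|_{\mathrm{BMO}^s}:=\sup_{\{I_k\}_{k=1}^n}\Big(\frac{1}{\mathrm{Cap}_s(\bigcup_{k=1}^n I_k)}\sum_{k=1}^n\sum_{J\in\mathcal D(I_k)}|J|^{-2s}|(b,h_J)|^2\Big)^{1/2}<\infty,$$ and $b\in\mathrm{CMO}^s$ means $b\in\mathrm{BMO}^s$ and $$\lim_{N\to\infty}\sup_{\{I_k\}_{k=1}^n}\frac{1}{\mathrm{Cap}_s(\bigcup_{k=1}^n I_k)}\sum_{k=1}^n\sum_{J\in\mathcal D(I_k)\cap\mathcal D_N^c}|J|^{-2s}|(b,h_J)|^2=0,$$ the suprema being over all nonempty finite collections of pairwise disjoint intervals $\{I_k\}_{k=1}^n\subseteq\mathcal D$. Functions differing by a constant are identified in these spaces. Haar shift: $Sf=\sum_{I\in\mathcal D}(f,h_I)(h_{I_-}-h_{I_+})$. Commutator: $[b,S]f=b\,Sf-S(bf)$. (For $b\in\mathrm{BMO}^s$ and $f\in H^s$, the function $bf$ lies in $L^q$ for $1<q<2$, and $S(bf)$ is the sum of the corresponding Haar series in $L^q$.) *)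

(* Defs.v *)
From HB Require Import structures.
From mathcomp Require Import all_boot all_order all_algebra finmap.
From mathcomp Require Import all_classical all_reals all_analysis.
From mathcomp.analysis.showcase Require Import summability.

Set Implicit Arguments.
Unset Strict Implicit.
Unset Printing Implicit Defensive.

Import Order.TTheory GRing.Theory Num.Theory.
Import numFieldNormedType.Exports.

Local Open Scope classical_set_scope.
Local Open Scope ring_scope.

(* (j, k) with k < 2 ^ j encodes the dyadic interval 2^-j ([0, 1) + k). *)
Definition dyad := {p : nat * nat | (p.2 < 2 ^ p.1)%N}.

Definition dgen (I : dyad) : nat := (val I).1.
Definition dpos (I : dyad) : nat := (val I).2.

Lemma lhalf_subproof (I : dyad) : ((dpos I).*2 < 2 ^ (dgen I).+1)%N.
Proof. by rewrite expnS mul2n ltn_double; exact: (valP I). Qed.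

Lemma rhalf_subproof (I : dyad) : ((dpos I).*2.+1 < 2 ^ (dgen I).+1)%N.
Proof. by rewrite expnS mul2n ltn_Sdouble; exact: (valP I). Qed.

Definition lhalf (I : dyad) : dyad :=
  Sub ((dgen I).+1, (dpos I).*2) (lhalf_subproof I).
Definition rhalf (I : dyad) : dyad :=
  Sub ((dgen I).+1, (dpos I).*2.+1) (rhalf_subproof I).

Section Dyadic.
Variable R : realType.
Implicit Types (I J : dyad) (f g b : R -> R) (s : R) (E : set R).

Definition dlen I : R := 2 ^- dgen I.

Definition dint I : set R := `[(dpos I)%:R * dlen I, (dpos I).+1%:R * dlen I[.

Definition subdyads I : set dyad := [set J | dint J `<=` dint I].

Definition coarse (N : nat) : set dyad := [set J | 2 ^- N <= dlen J].

Definition haar I (x : R) : R :=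
  dlen I `^ (- 2^-1) * (\1_(dint (lhalf I)) x - \1_(dint (rhalf I)) x).

(* Lebesgue measure on [0, 1]: a function on [0, 1] is represented by a
   function on R, whose values off [0, 1] are irrelevant. *)
Definition leb01 : {measure set (measurableTypeR R) -> \bar R} :=
  mrestr (@lebesgue_measure R) (measurable_itv `[0, 1]).

Definition inner f g : R := \int[leb01]_x (f x * g x).

Definition Lq_norm (q : R) f : \bar R := 'N[leb01]_q%:E[EFin \o f]%E.

(* squared L^2 norm of D^s f, by orthonormality of the Haar system *)
Definition Ds_sqnorm s f : \bar R :=
  \esum_(I in [set: dyad]) (dlen I `^ (- 2 * s) * `|inner f (haar I)| ^+ 2)%:E.

Definition Hs_sqnorm s f : \bar R :=
  (Ds_sqnorm s f + Lq_norm 2 f ^+ 2)%E.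

Definition Hs_norm s f : \bar R := sqrte (Hs_sqnorm s f).

Definition Hs s : set (R -> R) :=
  [set f | f \in Lfun leb01 2%:E /\ (Hs_sqnorm s f < +oo)%E].

(* ereal_inf set0 = +oo *)
Definition Cap s E : \bar R :=
  ereal_inf [set Hs_sqnorm s f | f in
    [set f | Hs s f /\ {ae leb01, forall x, E x -> 1 <= f x}]].

(* Dyadic intervals are nonempty, so a disjoint family has no repetitions and
   is a finite set of indices. *)
Definition disjoint_families : set {fset dyad} :=
  [set F | F != fset0 /\ trivIset [set` F] dint].

Definition Cap_ratio s b (K : set dyad) (F : {fset dyad}) : \bar R :=
  ((\sum_(I <- F) \esum_(J in subdyads I `&` K)
      (dlen J `^ (- 2 * s) * `|inner b (haar J)| ^+ 2)%:E)
   / Cap s (\bigcup_(I in [set` F]) dint I))%E.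

(* A seminorm, vanishing on constants: functions are not identified modulo
   constants, on which commutator b does not depend up to a.e. equality. *)
Definition BMOs_norm s b : \bar R :=
  ereal_sup [set sqrte (Cap_ratio s b setT F) | F in disjoint_families].

Definition BMOs s : set (R -> R) :=
  [set b | b \in Lfun leb01 1%E /\ (BMOs_norm s b < +oo)%E].

Definition CMOs s : set (R -> R) :=
  [set b | BMOs s b /\
    (fun N => ereal_sup [set Cap_ratio s b (~` coarse N) F
                        | F in disjoint_families]) @ \oo --> 0%E].

Definition shift_psum f (F : {fset dyad}) (x : R) : R :=
  \sum_(I <- F) inner f (haar I) * (haar (lhalf I) x - haar (rhalf I) x).

(* g is a version of Sf: the series over the (unordered) index set dyad
   converges to g in L^q for some q > 1. Any two such g, even for different
   exponents q, agree almost everywhere on [0, 1]. *)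
Definition is_haar_shift f g : Prop :=
  exists2 q : R, 1 < q &
    [/\ f \in Lfun leb01 q%:E, g \in Lfun leb01 q%:E &
        Lq_norm q (g \- shift_psum f F) @[F --> totally] --> 0%E].

Definition haar_shiftable f : Prop := exists g, is_haar_shift f g.

(* meaningful for haar_shiftable f; 0 otherwise *)
Definition haar_shift f : R -> R := xget (fun=> 0) [set g | is_haar_shift f g].

Definition commutator b f : R -> R :=
  fun x => b x * haar_shift f x - haar_shift (b \* f) x.

(* haar_shift is total by choice; this says that [b, S] f never involves its
   default value. *)
Definition commutator_defined s b : Prop :=
  forall f, Hs s f -> haar_shiftable f /\ haar_shiftable (b \* f).

Definition Hs_opnorm s (T : (R -> R) -> (R -> R)) : \bar R :=
  ereal_sup [set Hs_norm s (T f) | f in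
    [set f | Hs s f /\ (Hs_norm s f <= 1)%E]].

Definition Hs_bounded s (T : (R -> R) -> (R -> R)) : Prop :=
  (forall f, Hs s f -> Hs s (T f)) /\ (Hs_opnorm s T < +oo)%E.

Definition Hs_compact s (T : (R -> R) -> (R -> R)) : Prop :=
  (forall f, Hs s f -> Hs s (T f)) /\
  forall (M : R) (u : nat -> R -> R),
    (forall n, Hs s (u n) /\ (Hs_norm s (u n) <= M%:E)%E) ->
    exists (phi : nat -> nat) (g : R -> R),
      [/\ {homo phi : m n / (m < n)%N}, Hs s g &
          Hs_norm s (T (u (phi n)) \- g) @[n --> \oo] --> 0%E].

End Dyadic.

(* Main.v *)
Require Import Defs.
From HB Require Import structures.
From mathcomp Require Import all_boot all_order all_algebra finmap.
From mathcomp Require Import all_classical all_reals all_analysis.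
From mathcomp Require Import measurable_realfun.
From mathcomp.analysis.showcase Require summability.
From mathcomp Require Import ring lra.

Set Implicit Arguments.
Unset Strict Implicit.
Unset Printing Implicit Defensive.

Import Order.TTheory GRing.Theory Num.Theory.
Import numFieldNormedType.Exports.

Local Open Scope classical_set_scope.
Local Open Scope ring_scope.


(** The proof describes every function by its averages over dyadic intervals.
    The averages of [f] form an array [X] in which [X n k] is the mean of its two
    children [X n.+1 k.*2] and [X n.+1 k.*2.+1]. The half difference of the
    children, [hdif X n k], is [|I| `^ (- 1 / 2)] times the Haar coefficient of
    [f] on the [k]-th interval [I] of generation [n], so that [energy X n] is the
    sum of the squared coefficients in generation [n] and the squared norm of
    [D^s f] is the sum of [w ^+ n * energy X n], with [w = 4 `^ s = t ^+ 4].

    Coefficients of the commutator. By the product rule [hdif_mul], the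
    coefficient of [b f] on [I] is the sum of the average of [b] times the
    coefficient of [f], of the average of [f] times the coefficient of [b], and of
    the half difference of the covariances of [b] and [f] on the two halves of
    [I]. The shift moves a coefficient from an interval to its halves. In
    [b Sf - S(bf)] the averages of [b] cancel except for the jump of [b] from an
    interval to its half. There remain three kinds of terms
    ([hdif_commutatorS]): jumps of [b] times coefficients of [f]; the paraproducts
    of [b] with [f] and with [Sf]; covariances of [b] with [f] and with [Sf].

    Jumps and covariances. The indicator of an interval of generation [n] shows
    that its capacity is at most [C * 2 ^- n * w ^+ n]. As finer coefficients
    carry larger weights, the capacitary condition on the single interval bounds
    the variance of [b] on it by a constant, which also bounds the jumps
    ([Var_le]). By Cauchy-Schwarz a squared covariance is at most a constant times
    the variance of [f], and the mean variances [mvar f n], being tails of the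
    sum of energies, have a weighted sum that is at most a constant times the
    weighted sum of the energies ([sum_mvar_le]).

    Paraproducts. These need the full capacitary condition, through the
    embedding [carleson_embedding]. The averages of [f] are dominated by the
    potential [pot] of its half differences, which increases along branches.
    Hence the sets where the potential exceeds [2 ^+ j] are unions of subtrees,
    the maximal intervals of such a set form a disjoint family
    ([carleson_of_ratio]), and the truncation of the potential between two
    consecutive powers of two is, after normalisation, a test function for the
    capacity of the union. All these truncations together have at most the
    energy of the potential ([sum_sob_tau]), which is the capacitary strong type
    inequality.

    Existence of the shifts. The averages of [b] grow at most linearly in the
    generation, so the energies of [b f] still decay like [t ^- (2 * n)]
    ([mul_energy]). An array with geometrically decaying energies is the array of
    averages of a function ([synthesis]); applied to the shifted array, this
    gives versions of [Sf] and [S(bf)] in [L^2]. Conversely every version has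
    these averages ([shift_averages]), and the estimates use nothing else.

    Compactness. The estimate of the generations after [m] of the commutator
    sees only the coefficients of [b] from generation [m] on
    ([commutator_tail]). For a symbol in CMO these have a small Carleson constant,
    so the images of a bounded sequence have uniformly small tails, and such a
    sequence has a convergent subsequence ([equitail_compact]). *)

(** * Arrays of averages on the dyadic tree *)

Section Arrays.
Variable R : realType.
Implicit Types (X Y : nat -> nat -> R) (f g : nat -> R).

Definition lavg n f : R := 2 ^- n * \sum_(k < 2 ^ n) f k.
(** The condition that [X] is the array of averages of some function: a dyadic
    martingale. *)
Definition mart X := forall n k, X n k = (X n.+1 k.*2 + X n.+1 k.*2.+1) / 2.
(** For the averages of [f], the Haar coefficient of [f] divided by the square
    root of the length of the interval. *)
Definition hdif X n k : R := (X n.+1 k.*2 - X n.+1 k.*2.+1) / 2.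
Definition energy X n : R := lavg n (fun k => hdif X n k ^+ 2).

Lemma lavg0 f : lavg 0 f = f 0%N.
Proof. by rewrite /lavg expr0 invr1 mul1r expn0 big_ord1. Qed.

Lemma sum_double n (f : nat -> R) :
  \sum_(k < n.*2) f k = \sum_(k < n) (f k.*2 + f k.*2.+1).
Proof.
elim: n => [|n IH]; first by rewrite !big_ord0.
by rewrite doubleS !big_ord_recr /= IH addrA.
Qed.

Lemma lavgS n f : lavg n.+1 f = lavg n (fun k => (f k.*2 + f k.*2.+1) / 2).
Proof.
rewrite /lavg expnS mul2n sum_double -mulr_suml exprS invfM mulrCA mulrA.
by rewrite mulrAC mulrC mulrA.
Qed.

Lemma eq_lavg n f g : (forall k, (k < 2 ^ n)%N -> f k = g k) -> lavg n f = lavg n g.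
Proof. by move=> fg; congr (_ * _); apply: eq_bigr => i _; exact: fg. Qed.

Lemma le_lavg n f g : (forall k, (k < 2 ^ n)%N -> f k <= g k) ->
  lavg n f <= lavg n g.
Proof.
move=> fg; rewrite ler_wpM2l ?invr_ge0 ?exprn_ge0//.
by apply: ler_sum => i _; exact: fg.
Qed.

Lemma lavgD n f g : lavg n (fun k => f k + g k) = lavg n f + lavg n g.
Proof. by rewrite /lavg big_split mulrDr. Qed.

Lemma lavgZ n c f : lavg n (fun k => c * f k) = c * lavg n f.
Proof. by rewrite /lavg -mulr_sumr mulrCA. Qed.

Lemma lavg_cst n c : lavg n (fun=> c) = c.
Proof.
rewrite /lavg sumr_const card_ord -[c *+ _]mulr_natl natrX mulrA mulVf ?mul1r//.
Qed.

Lemma lavg_ge0 n f : (forall k, (k < 2 ^ n)%N -> 0 <= f k) -> 0 <= lavg n f.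
Proof. by move=> f0; rewrite -(lavg_cst n 0) le_lavg. Qed.

Lemma lavg_sum n m (f : 'I_m -> nat -> R) :
  \sum_(j < m) lavg n (f j) = lavg n (fun k => \sum_(j < m) f j k).
Proof. by rewrite /lavg exchange_big mulr_sumr. Qed.

Lemma lavg_half n f : lavg n.+1 (fun k => f k./2) = lavg n f.
Proof.
rewrite lavgS; apply: eq_lavg => k _.
by rewrite doubleK /= uphalf_double; field.
Qed.

Lemma lavg_mart X n : mart X -> lavg n (X n) = X 0%N 0%N.
Proof.
move=> mX; elim: n => [|n IH]; first by rewrite lavg0.
by rewrite lavgS -IH; apply: eq_lavg => k _; rewrite -mX.
Qed.

Lemma energy_ge0 X n : 0 <= energy X n.
Proof. by apply: lavg_ge0 => k _; rewrite sqr_ge0. Qed.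

Lemma mart_double X n k : mart X -> X n.+1 k.*2 = X n k + hdif X n k.
Proof. by move=> /(_ n k) ->; rewrite /hdif; field. Qed.

Lemma mart_doubleS X n k : mart X -> X n.+1 k.*2.+1 = X n k - hdif X n k.
Proof. by move=> /(_ n k) ->; rewrite /hdif; field. Qed.

(** Pythagoras: passing to the halves adds to the mean square exactly the squared
    half differences. *)
Lemma energyE X n : mart X ->
  energy X n = lavg n.+1 (fun k => X n.+1 k ^+ 2) - lavg n (fun k => X n k ^+ 2).
Proof.
move=> mX; apply/eqP; rewrite eq_sym subr_eq -lavgD lavgS; apply/eqP.
by apply: eq_lavg => k _; rewrite mart_double// mart_doubleS//; field.
Qed.

Lemma sum_energy X n : mart X ->
  \sum_(i < n) energy X i = lavg n (fun k => X n k ^+ 2) - X 0%N 0%N ^+ 2.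
Proof.
move=> mX; elim: n => [|n IH]; first by rewrite big_ord0 lavg0 subrr.
by rewrite big_ord_recr /= IH energyE//; lra.
Qed.

Lemma ler_sum_ord (u : nat -> R) M N : (forall i, 0 <= u i) -> (M <= N)%N ->
  \sum_(i < M) u i <= \sum_(i < N) u i.
Proof.
by move=> u0 /subnKC <-; rewrite big_split_ord /= lerDl sumr_ge0.
Qed.

(** Summing a recursion [a n <= q * a n.+1 + g n] against the whole sum costs
    only the factor [1 / (1 - q)]; this replaces every exchange of sums over
    ancestors and descendants below. *)
Lemma geometric_absorb (q : R) (a g : nat -> R) N : 0 <= q -> q < 1 ->
  (forall n, 0 <= a n) -> (forall n, (n < N)%N -> a n <= q * a n.+1 + g n) ->
  \sum_(n < N) a n <= (q * a N + \sum_(n < N) g n) / (1 - q).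
Proof.
move=> q0 q1 a0 H; rewrite ler_pdivlMr ?subr_gt0//.
have h1 : \sum_(n < N) a n <= q * (\sum_(n < N) a n.+1) + \sum_(n < N) g n.
  by rewrite mulr_sumr -big_split; apply: ler_sum => i _; exact: H.
have h2 : \sum_(n < N) a n.+1 <= \sum_(n < N) a n + a N.
  have <- : \sum_(n < N.+1) a n = \sum_(n < N) a n + a N by rewrite big_ord_recr.
  by rewrite big_ord_recl lerDr.
have := ler_wpM2l q0 h2; lra.
Qed.

Fixpoint subavg d f k : R :=
  if d is d'.+1 then (subavg d' f k.*2 + subavg d' f k.*2.+1) / 2 else f k.

Lemma le_subavg d f g k : (forall l, f l <= g l) -> subavg d f k <= subavg d g k.
Proof.
move=> fg; elim: d k => [|d IH] k /=; first exact: fg.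
by rewrite ler_pM2r// lerD.
Qed.

Lemma subavgD d f g k : subavg d (fun l => f l + g l) k = subavg d f k + subavg d g k.
Proof. by elim: d k => //= d IH k; rewrite !IH; field. Qed.

Lemma subavgZ d c f k : subavg d (fun l => c * f l) k = c * subavg d f k.
Proof. by elim: d k => //= d IH k; rewrite !IH; field. Qed.

Lemma subavg_cst d c k : subavg d (fun=> c) k = c.
Proof. by elim: d k => //= d IH k; rewrite !IH; field. Qed.

Lemma subavg_ge0 d f k : (forall l, 0 <= f l) -> 0 <= subavg d f k.
Proof. by move=> f0; rewrite -(subavg_cst d 0 k) le_subavg. Qed.

Lemma subavg_sum d m (f : 'I_m -> nat -> R) k :
  subavg d (fun l => \sum_(j < m) f j l) k = \sum_(j < m) subavg d (f j) k.
Proof.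
elim: d k => //= d IH k.
by rewrite !IH -big_split /= mulr_suml.
Qed.

Lemma lavg_subavg n d f : lavg n (subavg d f) = lavg (n + d) f.
Proof.
by elim: d n => [|d IH] n /=; rewrite ?addn0// addnS -addSn -IH lavgS.
Qed.

Lemma subavg_sqr_le d f k : subavg d f k ^+ 2 <= subavg d (fun l => f l ^+ 2) k.
Proof.
have := @subavg_ge0 d (fun l => (f l - subavg d f k) ^+ 2) k (fun l => sqr_ge0 _).
have E : subavg d (fun l => (f l - subavg d f k) ^+ 2) k =
   subavg d (fun l => f l ^+ 2 + ((- 2 * subavg d f k) * f l + subavg d f k ^+ 2)) k.
  by apply/eqP; rewrite eq_le; apply/andP; split; apply: le_subavg => l;
    rewrite -subr_ge0 (_ : _ - _ = 0) //; ring.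
rewrite E !subavgD subavgZ subavg_cst; lra.
Qed.

(** The array of averages of the function equal to [f k] on the [k]-th interval
    of generation [N]; meaningful for generations up to [N]. *)
Definition cond N f n k : R := subavg (N - n) f k.

(** A half difference is controlled by the deviation from any constant, in
    particular from a value chosen on the interval itself. *)
Lemma hdif_cond_sqr_le N f n k c : (n < N)%N ->
  hdif (cond N f) n k ^+ 2 <= subavg (N - n) (fun l => (f l - c) ^+ 2) k.
Proof.
move=> nN; rewrite /hdif /cond -(subnSK nN) /=.
set d := (N - n.+1)%N.
have H j : (subavg d f j - c) ^+ 2 <= subavg d (fun l => (f l - c) ^+ 2) j.
  by have := subavg_sqr_le d (fun l => f l - c) j; rewrite subavgD subavg_cst.
apply: le_trans (_ : ((subavg d f k.*2 - c) ^+ 2 + (subavg d f k.*2.+1 - c) ^+ 2) / 2 <= _).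
  rewrite -subr_ge0; set e := (X in 0 <= X).
  rewrite (_ : e = ((subavg d f k.*2 + subavg d f k.*2.+1) / 2 - c) ^+ 2) ?sqr_ge0//.
  by rewrite /e; field.
by rewrite ler_pM2r// lerD.
Qed.
End Arrays.

(** * Potentials on the tree and the Carleson embedding *)

Section Potential.
Variables (R : realType) (t : R).
Hypothesis t_gt1 : 1 < t.
Implicit Types (X g : nat -> nat -> R) (f : nat -> R).

(** The potential of [g]: [c] plus the sum of [g] over the strict ancestors. *)
Fixpoint pot (c : R) g n k : R :=
  if n is n'.+1 then pot c g n' k./2 + g n' k./2 else c.

Lemma half_lt_expn k n : (k < 2 ^ n.+1)%N -> (k./2 < 2 ^ n)%N.
Proof. by rewrite expnS mul2n ltn_half_double. Qed.

Lemma mart_le_pot c X n k : mart X -> `|X 0 0| <= c -> (k < 2 ^ n)%N ->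
  `|X n k| <= pot c (fun n k => `|hdif X n k|) n k.
Proof.
move=> mX Xc; elim: n k => [|n IH] k kn /=.
  by move: kn; rewrite expn0 ltnS leqn0 => /eqP ->.
apply: le_trans (lerD (IH _ (half_lt_expn kn)) (lexx _)).
rewrite -[in leLHS](odd_double_half k); case: (odd k); rewrite ?add0n ?add1n.
  by rewrite mart_doubleS// ler_normB.
by rewrite mart_double// ler_normD.
Qed.

Lemma pot_ge c g n k : (forall n k, 0 <= g n k) -> c <= pot c g n k.
Proof. by move=> g0; elim: n k => //= n IH k; rewrite ler_wpDr. Qed.

(** The mean over generation [n] of the square deviation of the potential of
    generation [N] from its value at the ancestor in generation [n]. It bounds the
    energy of every function of the potential that is Lipschitz with constant
    one. *)
Definition osc c g (N n : nat) : R :=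
  lavg n (fun k => subavg (N - n) (fun l => (pot c g N l - pot c g n k) ^+ 2) k).

Lemma osc_ge0 c g N n : 0 <= osc c g N n.
Proof. by apply: lavg_ge0 => k _; apply: subavg_ge0 => l; exact: sqr_ge0. Qed.

Let t0 : 0 < t. Proof. exact: lt_trans t_gt1. Qed.
Let tN0 : t != 0. Proof. by rewrite gt_eqF. Qed.
Let t21 : 0 < t ^+ 2 - 1. Proof. by rewrite subr_gt0 expr_gt1// ltW. Qed.
Let t21N0 : t ^+ 2 - 1 != 0. Proof. by rewrite gt_eqF. Qed.

(** The factor [t ^+ 2] on the first square leaves room in [osc_rec], whose
    recursion is summed against weights of ratio [t ^+ 4]. *)
Lemma sqrD_le (a b : R) :
  (a + b) ^+ 2 <= t ^+ 2 * a ^+ 2 + t ^+ 2 / (t ^+ 2 - 1) * b ^+ 2.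
Proof.
rewrite -subr_ge0; set e := (X in 0 <= X).
rewrite (_ : e = ((t ^+ 2 - 1) * a - b) ^+ 2 / (t ^+ 2 - 1)); last first.
  by rewrite /e; field.
by rewrite divr_ge0 ?sqr_ge0// ltW.
Qed.

Lemma osc_rec c g N n : (n < N)%N ->
  osc c g N n <= t ^+ 2 * osc c g N n.+1 +
                 t ^+ 2 / (t ^+ 2 - 1) * lavg n (fun k => g n k ^+ 2).
Proof.
move=> nN; rewrite /osc lavgS -!lavgZ -lavgD; apply: le_lavg => k _.
rewrite -(subnSK nN) /= doubleK uphalf_double.
set d := (N - n.+1)%N.
have H j : subavg d (fun l => (pot c g N l - pot c g n k) ^+ 2) j <=
    t ^+ 2 * subavg d (fun l => (pot c g N l - (pot c g n k + g n k)) ^+ 2) j +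
    t ^+ 2 / (t ^+ 2 - 1) * g n k ^+ 2.
  rewrite -(subavg_cst d (_ / _ * _) j) -subavgZ -subavgD; apply: le_subavg => l.
  apply: le_trans (sqrD_le _ _).
  by rewrite (_ : _ - _ + _ = pot c g N l - pot c g n k) //; ring.
by have := H k.*2; have := H k.*2.+1; lra.
Qed.

Definition Cpot : R := t ^+ 2 / (t ^+ 2 - 1) / (1 - t ^- 2).

Let tV2_lt1 : t ^- 2 < 1.
Proof. by rewrite invf_lt1 ?exprn_gt0// expr_gt1// ltW. Qed.

Lemma Cpot_ge0 : 0 <= Cpot.
Proof. by rewrite !divr_ge0 ?exprn_ge0 ?subr_ge0 ?ltW// -subr_gt0. Qed.

Lemma sum_osc_le c g N :
  \sum_(n < N) t ^+ 4 ^+ n * osc c g N n <=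
  Cpot * \sum_(n < N) t ^+ 4 ^+ n * lavg n (fun k => g n k ^+ 2).
Proof.
have := @geometric_absorb R (t ^- 2) (fun n => t ^+ 4 ^+ n * osc c g N n)
  (fun n => t ^+ 2 / (t ^+ 2 - 1) * (t ^+ 4 ^+ n * lavg n (fun k => g n k ^+ 2))) N.
have oscN : osc c g N N = 0.
  rewrite /osc subnn -(lavg_cst N 0); apply: eq_lavg => k _ /=.
  by rewrite subrr expr0n.
rewrite oscN !mulr0 add0r -mulr_sumr.
set A := \sum_(n < N) _; set B := \sum_(n < N) _.
rewrite (_ : t ^+ 2 / (t ^+ 2 - 1) * B / (1 - t ^- 2) = Cpot * B); last first.
  by rewrite /Cpot mulrAC.
apply => //; first by rewrite invr_ge0 exprn_ge0// ltW.
  by move=> n; rewrite mulr_ge0 ?osc_ge0// !exprn_ge0// ltW.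
move=> n nN; apply: le_trans (ler_wpM2l _ (osc_rec c g nN)) _.
  by rewrite !exprn_ge0// ltW.
rewrite le_eqVlt; apply/orP; left; apply/eqP.
rewrite [t ^+ 4 ^+ n.+1]exprS; move: (t ^+ 4 ^+ n) => w.
by field; rewrite tN0 t21N0.
Qed.

(** Maz'ya's truncation at two consecutive powers of two. *)
Definition tau j (x : R) : R := Num.min x (2 ^+ j.+1) - Num.min x (2 ^+ j).

Lemma sum_tau L x : \sum_(j < L) tau j x = Num.min x (2 ^+ L) - Num.min x 1.
Proof.
elim: L => [|L IH]; first by rewrite big_ord0 expr0 subrr.
by rewrite big_ord_recr /= IH /tau; lra.
Qed.

Lemma tau_homo j x y : x <= y -> tau j x <= tau j y.
Proof.
move=> xy; rewrite /tau; have : (2 : R) ^+ j <= 2 ^+ j.+1.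
  by rewrite exprS ler_peMl// ?exprn_ge0// ler1n.
move: (2 ^+ j) (2 ^+ j.+1) => u v uv; rewrite /Num.min.
by case: (ltP x v); case: (ltP x u); case: (ltP y v); case: (ltP y u); lra.
Qed.

Lemma sum_sqr_le_sqr_sum L (a : nat -> R) : (forall j, 0 <= a j) ->
  \sum_(j < L) a j ^+ 2 <= (\sum_(j < L) a j) ^+ 2.
Proof.
move=> a0; elim: L => [|L IH]; first by rewrite !big_ord0 expr0n.
rewrite !big_ord_recr /= (le_trans (lerD IH (lexx _)))// sqrrD -addrA lerD2l.
by rewrite lerDr mulrn_wge0// mulr_ge0// sumr_ge0.
Qed.

(** The truncations cut [x - y] into increments of one sign. *)
Lemma sum_tau_sqr_le L x y : \sum_(j < L) (tau j x - tau j y) ^+ 2 <= (x - y) ^+ 2.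
Proof.
wlog xy : x y / y <= x => [H|].
  have [/H//|/ltW/H] := leP y x.
  rewrite -[leRHS]sqrrN opprB; apply: le_trans; apply: ler_sum => j _.
  by rewrite -[leLHS]sqrrN opprB.
apply: le_trans (sum_sqr_le_sqr_sum (a := fun j => tau j x - tau j y) _ _) _.
  by move=> j; rewrite subr_ge0 tau_homo.
have h : \sum_(j < L) (tau j x - tau j y) <= x - y.
  have : (1 : R) <= 2 ^+ L by rewrite exprn_ege1// ler1n.
  rewrite big_split sumrN /= !sum_tau /Num.min; move: (2 ^+ L) => u u1.
  by case: (ltP x u); case: (ltP x 1); case: (ltP y u); case: (ltP y 1); lra.
rewrite ler_sqr ?nnegrE ?subr_ge0// sumr_ge0// => j _.
by rewrite subr_ge0 tau_homo.
Qed.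

(** The squared Sobolev norm of the step function with values [f] on the
    intervals of generation [N]. *)
Definition sob N f : R :=
  lavg N (fun k => f k ^+ 2) + \sum_(n < N) t ^+ 4 ^+ n * energy (cond N f) n.

Lemma sob_ge0 N f : 0 <= sob N f.
Proof.
rewrite addr_ge0//; first by apply: lavg_ge0 => k _; exact: sqr_ge0.
by apply: sumr_ge0 => n _; rewrite mulr_ge0 ?energy_ge0// !exprn_ge0// ltW.
Qed.

Lemma sobZ N c f : sob N (fun k => c * f k) = c ^+ 2 * sob N f.
Proof.
rewrite /sob mulrDr -lavgZ mulr_sumr; congr (_ + _).
  by apply: eq_lavg => k _; rewrite exprMn.
apply: eq_bigr => n _; rewrite [RHS]mulrCA; congr (_ * _).
rewrite /energy -lavgZ; apply: eq_lavg => k _; rewrite -exprMn; congr (_ ^+ 2).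
by rewrite /hdif /cond !subavgZ; ring.
Qed.

Lemma sob1 N : sob N (fun=> 1) = 1.
Proof.
rewrite /sob expr1n lavg_cst big1 ?addr0// => n _.
rewrite (_ : energy _ _ = 0) ?mulr0// -(lavg_cst n 0).
by apply: eq_lavg => k _; rewrite /hdif /cond !subavg_cst subrr mul0r expr0n.
Qed.

(** The strong type estimate: up to constants, all dyadic truncations together have
    no more energy than the potential, whose energy is controlled by [g]. *)
Lemma sum_sob_tau L g N : (forall n k, 0 <= g n k) ->
  \sum_(j < L) sob N (fun k => tau j (pot 1 g N k)) <=
  2 + 3 * Cpot * \sum_(n < N) t ^+ 4 ^+ n * lavg n (fun k => g n k ^+ 2).
Proof.
move=> g0; set F := pot 1 g.
have F1 n k : 1 <= F n k by exact: pot_ge.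
rewrite big_split /=.
set G := \sum_(n < N) t ^+ 4 ^+ n * _.
have G0 : 0 <= G.
  apply: sumr_ge0 => n _; rewrite mulr_ge0//; first by rewrite !exprn_ge0// ltW.
  by apply: lavg_ge0 => k _; exact: sqr_ge0.
have oscG : osc 1 g N 0 <= Cpot * G.
  apply: le_trans (sum_osc_le 1 g N); case: (N) => [|M].
    rewrite big_ord0 /osc subnn lavg0 /= subrr expr0n//=.
  rewrite big_ord_recl expr0 mul1r lerDl; apply: sumr_ge0 => n _.
  by rewrite mulr_ge0 ?osc_ge0// !exprn_ge0// ltW.
have h1 : \sum_(j < L) lavg N (fun k => tau j (F N k) ^+ 2) <= 2 + 2 * (Cpot * G).
  apply: (@le_trans _ _ (2 + 2 * osc 1 g N 0)); last by lra.
  have -> : osc 1 g N 0 = lavg N (fun l => (F N l - 1) ^+ 2).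
    by rewrite /osc lavg0 subn0 -[N in RHS]add0n -lavg_subavg lavg0.
  rewrite lavg_sum -lavgZ -{1}(lavg_cst N 2) -lavgD.
  apply: le_lavg => k _.
  apply: le_trans (sum_sqr_le_sqr_sum (a := fun j => tau j (F N k)) _ _) _.
    move=> j; apply: le_trans (tau_homo j (ltW (lt_le_trans ltr01 (F1 N k)))).
    by rewrite /tau !min_l ?exprn_ge0// subrr.
  rewrite sum_tau.
  have Fk := F1 N k; move: (F N k) Fk => x x1.
  rewrite (min_r x1).
  have : (2 : R) ^+ L >= 1 by rewrite exprn_ege1// ler1n.
  have : 0 <= (x - 1) ^+ 2 by exact: sqr_ge0.
  move: (2 ^+ L) => u; rewrite /Num.min; case: ltP => [_|ux] h0 u1; first by lra.
  have : 0 <= (x - u) * (x + u - 2) by apply: mulr_ge0; lra.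
  by lra.
have h2 : \sum_(j < L) \sum_(n < N) t ^+ 4 ^+ n *
    energy (cond N (fun k => tau j (F N k))) n <= Cpot * G.
  apply: le_trans (sum_osc_le 1 _ _); rewrite exchange_big /=.
  apply: ler_sum => n _; rewrite -mulr_sumr ler_wpM2l ?exprn_ge0 ?(ltW t0)//.
  rewrite lavg_sum; apply: le_lavg => k _.
  apply: (@le_trans _ _ (\sum_(j < L)
     subavg (N - n) (fun l => (tau j (F N l) - tau j (F n k)) ^+ 2) k)).
    by apply: ler_sum => j _; exact: hdif_cond_sqr_le.
  by rewrite -subavg_sum; apply: le_subavg => l; exact: sum_tau_sqr_le.
lra.
Qed.
End Potential.

Section Embedding.
Variables (R : realType) (t : R).
Hypothesis t_gt1 : 1 < t.
Implicit Types (X g al : nat -> nat -> R).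

Definition desc_closed (S : nat -> nat -> bool) :=
  forall n k, S n k -> S n.+1 k.*2 && S n.+1 k.*2.+1.

(** The discrete shadow of the capacitary Carleson condition: the mass that
    [al] puts on a union of subtrees is controlled by the energy of any test
    function that is at least one on the leaves of these subtrees. *)
Definition carleson kappa al :=
  forall N S f, desc_closed S -> (forall k, (k < 2 ^ N)%N -> S N k -> 1 <= f k) ->
  \sum_(n < N.+1) \sum_(k < 2 ^ n) (S n k)%:R * al n k <= kappa * sob t N f.

(** The highest level [2 ^+ j.+1] below [x] alone contributes [(2 ^+ j.+2) ^+ 2]. *)
Lemma dyadic_layers L (x : R) : 0 <= x -> x < 2 ^+ L.+1 ->
  x ^+ 2 <= 4 + \sum_(j < L) 4 ^+ j.+2 * (2 ^+ j.+1 <= x)%R%:R.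
Proof.
move=> x0; elim: L => [|L IH] xL.
  by rewrite big_ord0 addr0; nra.
rewrite big_ord_recr /=; case: (leP (2 ^+ L.+1) x) => [_|xl]; last by rewrite mulr0 addr0 IH.
rewrite mulr1 addrA ler_wpDl//; first by rewrite addr_ge0// sumr_ge0.
have -> : (4 : R) ^+ L.+2 = (2 ^+ L.+2) ^+ 2.
  by rewrite -exprM mulnC exprM; congr (_ ^+ _); ring.
by rewrite ler_sqr ?nnegrE ?exprn_ge0// ltW.
Qed.

Definition Cemb : R := 36 + 48 * Cpot t.

Let t0 : 0 < t. Proof. exact: lt_trans t_gt1. Qed.

Lemma Cemb_ge0 : 0 <= Cemb.
Proof. by rewrite addr_ge0// mulr_ge0// Cpot_ge0. Qed.

(** The potential can only grow from an interval to its halves. *)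
Lemma pot_desc_closed c g (a : R) : (forall n k, 0 <= g n k) ->
  desc_closed (fun n k => a <= pot c g n k).
Proof.
move=> g0 n k ank /=; rewrite doubleK uphalf_double.
by rewrite !ler_wpDr.
Qed.

(** On each layer between consecutive powers of two, the truncated potential
    divided by its height is an admissible test function. *)
Lemma carleson_pot kappa al g N : 0 <= kappa -> (forall n k, 0 <= al n k) ->
  carleson kappa al -> (forall n k, 0 <= g n k) ->
  \sum_(n < N) t ^+ 4 ^+ n * lavg n (fun k => g n k ^+ 2) <= 1 ->
  \sum_(n < N.+1) \sum_(k < 2 ^ n) al n k * pot 1 g n k ^+ 2 <= Cemb * kappa.
Proof.
move=> k0 al0 car g0 G1; set F := pot 1 g.
have F1 n k : 1 <= F n k by exact: pot_ge.
(* only finitely many layers occur among the intervals in question *)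
have [L HL] : exists L, forall n k, (n < N.+1)%N -> (k < 2 ^ n)%N -> F n k < 2 ^+ L.+1.
  pose M := \sum_(n < N.+1) \sum_(k < 2 ^ n) F n k.
  exists (Num.truncn M) => n k nN kn.
  apply: (@le_lt_trans _ _ M).
    rewrite /M (bigD1 (Ordinal nN))//= (bigD1 (Ordinal kn))//= -addrA lerDl.
    rewrite addr_ge0// ?sumr_ge0// => i _; last first.
      by apply: sumr_ge0 => j _; exact: le_trans (F1 _ _).
    exact: le_trans (F1 _ _).
  apply: lt_le_trans (truncnS_gt M) _.
  by rewrite -natrX ler_nat ltnW// ltn_expl.
apply: (@le_trans _ _ (\sum_(n < N.+1) \sum_(k < 2 ^ n)
    (4 * al n k + \sum_(j < L) 4 ^+ j.+2 * ((2 ^+ j.+1 <= F n k)%R%:R * al n k)))).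
  apply: ler_sum => n _; apply: ler_sum => k _.
  rewrite (_ : 4 * al n k + _ =
     al n k * (4 + \sum_(j < L) 4 ^+ j.+2 * (2 ^+ j.+1 <= F n k)%R%:R)); last first.
    rewrite mulrDr mulrC; congr (_ + _); rewrite mulr_sumr.
    by apply: eq_bigr => j _; ring.
  rewrite ler_wpM2l// dyadic_layers ?HL//; exact: le_trans (F1 _ _).
have h0 : \sum_(n < N.+1) \sum_(k < 2 ^ n) al n k <= kappa.
  have := car N (fun _ _ => true) (fun=> 1) (fun _ _ _ => isT) (fun _ _ _ => lexx _).
  rewrite sob1 mulr1; apply: le_trans; apply: ler_sum => n _.
  by apply: ler_sum => k _; rewrite mul1r.
have hj (j : 'I_L) : \sum_(n < N.+1) \sum_(k < 2 ^ n)
    4 ^+ j.+2 * ((2 ^+ j.+1 <= F n k)%R%:R * al n k) <=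
    16 * kappa * sob t N (fun k => tau j (F N k)).
  under eq_bigr do rewrite -mulr_sumr.
  rewrite -mulr_sumr.
  have := car N (fun n k => 2 ^+ j.+1 <= F n k) (fun k => 2 ^- j * tau j (F N k))
    (@pot_desc_closed 1 g _ g0).
  rewrite sobZ => /(_ _)/wrap[k _ Fk|H].
    rewrite /tau (min_r Fk) min_r; last first.
      by apply: le_trans Fk; rewrite exprS ler_peMl ?exprn_ge0// ler1n.
    rewrite exprS (_ : 2 * 2 ^+ j - 2 ^+ j = 2 ^+ j); last by ring.
    by rewrite mulVf// expf_neq0.
  apply: le_trans (ler_wpM2l _ H) _; first by rewrite exprn_ge0.
  rewrite le_eqVlt; apply/orP; left; apply/eqP.
  rewrite !exprS (_ : (4 : R) ^+ j = 2 ^+ j * 2 ^+ j).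
    by move: (sob _ _ _) => s; field; rewrite expf_neq0.
  by rewrite -exprMn; congr (_ ^+ _); ring.
under eq_bigr do rewrite big_split /= -mulr_sumr exchange_big /=.
rewrite big_split /= -mulr_sumr exchange_big /=.
have hs : \sum_(j < L) \sum_(n < N.+1) \sum_(k < 2 ^ n)
    4 ^+ j.+2 * ((2 ^+ j.+1 <= F n k)%R%:R * al n k) <=
    16 * kappa * (2 + 3 * Cpot t).
  apply: (@le_trans _ _ (16 * kappa * \sum_(j < L) sob t N (fun k => tau j (F N k)))).
    by rewrite mulr_sumr; apply: ler_sum => j _; exact: hj.
  rewrite ler_wpM2l ?mulr_ge0//.
  apply: le_trans (sum_sob_tau t_gt1 _ _ g0) _.
  rewrite lerD2l -[leRHS]mulr1 ler_wpM2l// mulr_ge0// Cpot_ge0//.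
have := Cpot_ge0 t_gt1; rewrite /Cemb => C0.
move: hs; set A := \sum_(j < L) _ => hs.
have := ler_wpM2l (ler0n R 4) h0; lra.
Qed.

(** The dyadic Carleson embedding theorem: averages are dominated by the potential
    of the absolute half differences, which has the same energies. Dividing by the
    square root of [Gam] makes this potential start from one. *)
Lemma carleson_embedding kappa al X N Gam : 0 <= kappa ->
  (forall n k, 0 <= al n k) -> carleson kappa al -> mart X -> 0 < Gam ->
  X 0 0 ^+ 2 + \sum_(n < N) t ^+ 4 ^+ n * energy X n <= Gam ->
  \sum_(n < N.+1) \sum_(k < 2 ^ n) al n k * X n k ^+ 2 <= Cemb * kappa * Gam.
Proof.
move=> k0 al0 car mX G0 XG.
pose c := (Num.sqrt Gam)^-1; have c0 : 0 < c by rewrite invr_gt0 sqrtr_gt0.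
have c2 : c ^+ 2 * Gam = 1 by rewrite exprVn sqr_sqrtr ?ltW// mulVf// gt_eqF.
pose Y n k := c * X n k.
have mY : mart Y by move=> n k; rewrite /Y mX; ring.
have hY n k : hdif Y n k = c * hdif X n k by rewrite /hdif /Y; ring.
have eY n : energy Y n = c ^+ 2 * energy X n.
  by rewrite /energy -lavgZ; apply: eq_lavg => k _; rewrite hY exprMn.
have X0 : 0 <= X 0 0 ^+ 2 by exact: sqr_ge0.
have S0 : 0 <= \sum_(n < N) t ^+ 4 ^+ n * energy X n.
  by apply: sumr_ge0 => n _; rewrite mulr_ge0 ?energy_ge0// !exprn_ge0// ltW.
have Y1 : `|Y 0 0| <= 1.
  rewrite -(@ler_pXn2r _ 2) ?nnegrE// expr1n real_normK ?num_real// exprMn -c2.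
  by rewrite ler_wpM2l ?sqr_ge0//; lra.
have := @carleson_pot kappa al (fun n k => `|hdif Y n k|) N k0 al0 car.
move=> /(_ _ _)/wrap[//||].
  under eq_bigr => n _.
    rewrite (_ : lavg _ _ = energy Y n); last first.
      by apply: eq_lavg => k _; rewrite real_normK ?num_real.
    rewrite eY mulrCA. over.
  by rewrite -mulr_sumr -c2 ler_wpM2l ?sqr_ge0//; lra.
move=> /(ler_wpM2r (ltW G0)); apply: le_trans.
rewrite mulr_suml; apply: ler_sum => n _; rewrite mulr_suml; apply: ler_sum => k _.
rewrite -mulrA ler_wpM2l//.
set p := pot _ _ _ _.
have P : `|Y n k| <= p by exact: mart_le_pot.
have : `|Y n k| ^+ 2 <= p ^+ 2.
  by rewrite ler_sqr ?nnegrE// (le_trans _ P).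
move=> /(ler_wpM2r (ltW G0)); apply: le_trans.
by rewrite real_normK ?num_real// exprMn mulrAC c2 mul1r.
Qed.
End Embedding.

(** * Averages over dyadic intervals *)

Section Averages.
Variable R : realType.
Implicit Types (f g : R -> R) (n k : nat) (x : R).

Definition Dy n k : set R := `[k%:R * 2 ^- n, k.+1%:R * 2 ^- n[.
Definition idx n x : nat := Num.truncn (x * 2 ^+ n).

Notation mu := (@leb01 R).
Notation L1 f := (mu.-integrable setT (EFin \o f)).

Lemma DyE n k x : Dy n k x <-> (0 <= x) && (idx n x == k).
Proof.
have p0 : (0 : R) < 2 ^+ n by rewrite exprn_gt0.
rewrite /Dy /= in_itv /= ler_pdivrMr// ltr_pdivlMr// /idx.
split=> [/andP[h1 h2]|/andP[x0 /eqP <-]].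
  have x0 : 0 <= x * 2 ^+ n by exact: le_trans h1.
  rewrite -(pmulr_lge0 x p0) x0 /=; apply/eqP.
  by apply: truncn_def; rewrite h1 h2.
by apply: truncn_itv; rewrite mulr_ge0// ltW.
Qed.

Lemma idxS n x : 0 <= x -> (idx n.+1 x)./2 = idx n x.
Proof.
move=> x0; apply/esym/truncn_def.
have y0 : 0 <= x * 2 ^+ n.+1 by rewrite mulr_ge0.
have /andP[h1 h2] := truncn_itv y0.
have e : x * 2 ^+ n.+1 = x * 2 ^+ n * 2 by rewrite exprS; ring.
rewrite -/(idx n.+1 x) e in h1 h2.
have := odd_double_half (idx n.+1 x); set m := (_./2) => E.
have E1 : (m.*2 <= idx n.+1 x)%N by rewrite -E leq_addl.
have E2 : (idx n.+1 x < m.+1.*2)%N.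
  by rewrite -E doubleS -addn2 addnC; case: odd; rewrite ltn_add2l.
apply/andP; split.
  rewrite -(@ler_pM2r _ 2)// -natrM muln2; apply: le_trans h1.
  by rewrite ler_nat.
rewrite -(@ltr_pM2r _ 2)// -natrM muln2; apply: lt_le_trans h2 _.
by rewrite ler_nat.
Qed.

Lemma idx_lt n x : 0 <= x -> x < 1 -> (idx n x < 2 ^ n)%N.
Proof.
move=> x0 x1; rewrite /idx truncn_lt_nat ?mulr_ge0//.
by rewrite natrX -[ltRHS]mul1r ltr_pM2r// exprn_gt0.
Qed.

Lemma measurable_Dy n k : measurable (Dy n k).
Proof. exact: measurable_itv. Qed.
Hint Extern 0 (@measurable _ _ (Dy _ _)) => exact: measurable_Dy : core.

Lemma Dy_split n k : Dy n k = Dy n.+1 k.*2 `|` Dy n.+1 k.*2.+1.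
Proof.
apply/seteqP; split=> x /=.
  move=> /DyE/andP[x0 /eqP <-]; rewrite -idxS//.
  have := odd_double_half (idx n.+1 x); case: odd; rewrite ?add1n ?add0n => E.
    by right; apply/DyE; rewrite x0 -{1}E eqxx.
  by left; apply/DyE; rewrite x0 -{1}E eqxx.
by move=> [] /DyE/andP[x0 /eqP E]; apply/DyE; rewrite x0 -idxS// E /=
  ?doubleK ?uphalf_double eqxx.
Qed.

Lemma Dy_disjoint n k l : k != l -> [disjoint Dy n k & Dy n l].
Proof.
move=> kl; apply/disj_setPS => x [/DyE/andP[_ /eqP E]] /DyE/andP[_ /eqP F].
by move: kl; rewrite -E -F eqxx.
Qed.

Lemma Dy_sub01 n k : (k < 2 ^ n)%N -> Dy n k `<=` `[0, 1[%classic.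
Proof.
move=> kn; rewrite /Dy => x /=; rewrite !in_itv /= => /andP[h1 h2].
apply/andP; split; first by apply: le_trans h1; rewrite mulr_ge0.
apply: lt_le_trans h2 _; rewrite ler_pdivrMr ?exprn_gt0// mul1r -natrX ler_nat.
exact: kn.
Qed.

Lemma Dy00 : Dy 0 0 = `[0, 1[%classic.
Proof. by rewrite /Dy expr0 invr1 !mulr1. Qed.

Lemma leb01_le A : measurable A -> (mu A <= lebesgue_measure A)%E.
Proof.
move=> mA; rewrite /leb01 /= /mrestr le_measure ?inE//.
by apply: measurableI.
Qed.

Lemma leb01_sub (A : set R) : A `<=` `[0, 1]%classic -> mu A = lebesgue_measure A.
Proof. by move=> A01; rewrite /leb01 /= /mrestr setIidl. Qed.

Lemma leb01_Dy n k : (k < 2 ^ n)%N -> mu (Dy n k) = (2 ^- n)%:E.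
Proof.
move=> kn; rewrite leb01_sub; last first.
  by apply: subset_trans (Dy_sub01 kn) _; apply: subset_itv; rewrite bnd_simp.
rewrite lebesgue_measure_itv /= lte_fin ltr_pM2r ?invr_gt0 ?exprn_gt0//.
rewrite ltr_nat ltnSn -EFinD; congr EFin.
by rewrite -addn1 natrD mulrDl mul1r addrAC subrr add0r.
Qed.

Lemma leb01T : mu setT = 1%E.
Proof.
rewrite /leb01 /= /mrestr setTI lebesgue_measure_itv /= lte_fin ltr01.
by rewrite oppr0 adde0.
Qed.

Lemma leb01_setD : mu (~` Dy 0 0) = 0%E.
Proof.
rewrite /leb01 /= /mrestr Dy00.
apply/eqP; rewrite -measure_le0; apply: (@le_trans _ _ (lebesgue_measure [set (1 : R)])).
  apply: le_measure; rewrite ?inE//.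
    by apply: measurableI => //; apply: measurableC.
  move=> x /= []; rewrite !in_itv /= => /negP; rewrite negb_and -ltNge -leNgt.
  by move=> /orP[x0|x1] /andP[x0' x1']; apply/eqP; rewrite eq_le ?x1 ?x1'//; lra.
by rewrite lebesgue_measure_set1.
Qed.

Lemma L1S f A : measurable A -> L1 f -> mu.-integrable A (EFin \o f).
Proof. by move=> mA; apply: integrableS. Qed.

Lemma L1_measurable f : L1 f -> measurable_fun setT f.
Proof. by move=> /measurable_int/measurable_EFinP. Qed.

Lemma L1_bounded f M : measurable_fun setT f -> (forall x, `|f x| <= M) -> L1 f.
Proof.
move=> mf fM; apply: measurable_bounded_integrable => //.
  by rewrite leb01T ltry.
by exists M; split; rewrite ?num_real// => y My x _; exact: le_trans (fM x) (ltW My).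
Qed.

Lemma L1_cst c : L1 (fun=> c).
Proof. by apply: (@L1_bounded _ `|c|) => //. Qed.

Lemma L1D f g : L1 f -> L1 g -> L1 (fun x => f x + g x).
Proof. by move=> hf hg; exact: (integrableD measurableT hf hg). Qed.

Lemma L1Z c f : L1 f -> L1 (fun x => c * f x).
Proof. by move=> hf; exact: (integrableZl measurableT c hf). Qed.

Lemma L1N f : L1 f -> L1 (fun x => - f x).
Proof. by move=> /(L1Z (-1)); under eq_fun do rewrite mulN1r. Qed.

Lemma L1B f g : L1 f -> L1 g -> L1 (fun x => f x - g x).
Proof. by move=> hf /L1N; exact: L1D. Qed.

Lemma L1_sum (I : Type) (r : seq I) (F : I -> R -> R) :
  (forall i, L1 (F i)) -> L1 (fun x => \sum_(i <- r) F i x).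
Proof.
move=> hF; elim: r => [|i r IH].
  by under eq_fun do rewrite big_nil; exact: L1_cst.
by under eq_fun do rewrite big_cons; exact: L1D.
Qed.

Lemma L1_le f g : measurable_fun setT f -> L1 g -> (forall x, `|f x| <= g x) -> L1 f.
Proof.
move=> mf hg fg; apply: (le_integrable measurableT _ _ hg); first exact/measurable_EFinP.
by move=> x _ /=; rewrite lee_fin (le_trans (fg x))// ler_norm.
Qed.

Definition Av f n k : R := 2 ^+ n * \int[mu]_(x in Dy n k) f x.

Lemma AvD f g n k : L1 f -> L1 g -> Av (fun x => f x + g x) n k = Av f n k + Av g n k.
Proof.
move=> hf hg; rewrite /Av -mulrDr; congr (_ * _).
by apply: RintegralD => //; exact: L1S.
Qed.

Lemma AvZ c f n k : L1 f -> Av (fun x => c * f x) n k = c * Av f n k.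
Proof.
move=> hf; rewrite /Av mulrCA; congr (_ * _).
by apply: RintegralZl => //; exact: L1S.
Qed.

Lemma AvB f g n k : L1 f -> L1 g -> Av (fun x => f x - g x) n k = Av f n k - Av g n k.
Proof.
move=> hf hg; rewrite /Av -mulrBr; congr (_ * _).
by apply: RintegralB => //; exact: L1S.
Qed.

Lemma Av_cst c n k : (k < 2 ^ n)%N -> Av (fun=> c) n k = c.
Proof.
move=> kn; rewrite /Av Rintegral_cst// leb01_Dy//=.
by rewrite mulrCA mulfV ?mulr1// expf_neq0.
Qed.

Lemma Av_ge0 f n k : (forall x, 0 <= f x) -> 0 <= Av f n k.
Proof. by move=> f0; rewrite /Av mulr_ge0// Rintegral_ge0. Qed.

Lemma eq_Av f g n k : {in Dy n k, f =1 g} -> Av f n k = Av g n k.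
Proof. by move=> fg; rewrite /Av; congr (_ * _); exact: eq_Rintegral. Qed.

Lemma Av_mart f : L1 f -> mart (Av f).
Proof.
move=> hf n k; rewrite /Av Dy_split Rintegral_setU//.
- by rewrite exprS; field.
- by apply: L1S => //; apply: measurableU.
- by apply: Dy_disjoint; rewrite neq_ltn ltnSn.
Qed.

Lemma Av00 f : L1 f -> Av f 0 0 = \int[mu]_x f x.
Proof.
move=> hf; rewrite /Av expr0 mul1r /Rintegral.
rewrite (negligible_integral _ _ hf leb01_setD) //; last exact: measurableC.
by rewrite setTD setCK.
Qed.

Lemma lavg_Av f n : L1 f -> lavg n (Av f n) = \int[mu]_x f x.
Proof. by move=> hf; rewrite (lavg_mart _ (Av_mart hf)) Av00. Qed.

Lemma powRN12_sqr n : ((2 ^- n : R) `^ (- 2^-1)) ^+ 2 = 2 ^+ n.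
Proof.
rewrite -powR_mulrn ?powR_ge0// -powRrM mulNr mulVf// powR_inv1 ?invrK//.
Qed.

Lemma haarE (I : dyad) x : haar I x = (dlen R I) `^ (- 2^-1) *
   (\1_(Dy (dgen I).+1 (dpos I).*2) x - \1_(Dy (dgen I).+1 (dpos I).*2.+1) x).
Proof. by []. Qed.

Lemma L1_indicM f (A : set R) : measurable A -> L1 f -> L1 (fun x => f x * \1_A x).
Proof.
move=> mA hf; apply: (@L1_le _ (fun x => `|f x|)).
- apply: measurable_funM; first exact: L1_measurable.
  exact: measurable_indic.
- exact: integrable_norm hf.
- move=> x; rewrite normrM indicE; case: (_ \in _) => /=.
    by rewrite normr1 mulr1.
  by rewrite normr0 mulr0.
Qed.

Lemma Rintegral_indicM f (A : set R) : measurable A ->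
  \int[mu]_x (f x * \1_A x) = \int[mu]_(x in A) f x.
Proof.
move=> mA; rewrite [RHS]Rintegral_mkcond; apply: eq_Rintegral => x _.
by rewrite patchE indicE; case: (_ \in _); rewrite ?mulr1 ?mulr0.
Qed.

Lemma inner_haar f (I : dyad) : L1 f ->
  inner f (haar I) =
  (dlen R I) `^ (- 2^-1) * (2 ^- dgen I * hdif (Av f) (dgen I) (dpos I)).
Proof.
move=> hf; rewrite /inner; set c := _ `^ _.
have -> : (fun x => f x * haar I x) = (fun x => c *
   (f x * \1_(Dy (dgen I).+1 (dpos I).*2) x - f x * \1_(Dy (dgen I).+1 (dpos I).*2.+1) x)).
  by apply/funext => x; rewrite haarE -/c; ring.
rewrite RintegralZl//; last by apply: L1B; exact: L1_indicM.
rewrite RintegralB//; try exact: L1_indicM.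
rewrite !Rintegral_indicM// /hdif /Av exprS; congr (_ * _).
by field; rewrite expf_neq0.
Qed.

Lemma inner_haar_sqr f (I : dyad) : L1 f ->
  inner f (haar I) ^+ 2 = 2 ^- dgen I * hdif (Av f) (dgen I) (dpos I) ^+ 2.
Proof.
move=> hf; rewrite inner_haar// !exprMn powRN12_sqr mulrA; congr (_ * _).
by rewrite expr2 mulrA mulfV ?mul1r// expf_neq0.
Qed.
End Averages.

(** * Step functions and variances *)

Section StepVariance.
Variable R : realType.
Implicit Types (f g : R -> R) (p : nat -> R) (n k : nat) (x : R).

Notation mu := (@leb01 R).
Notation L1 f := (mu.-integrable setT (EFin \o f)).
Notation L2 f := (f \in Lfun mu 2%:E).
#[local] Hint Extern 0 (@measurable _ _ (Dy _ _)) => exact: measurable_Dy : core.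

Definition stp N p x : R := \sum_(k < 2 ^ N) p k * \1_(Dy N k) x.

Lemma stpE N p x : stp N p x = if (0 <= x) && (x < 1) then p (idx N x) else 0.
Proof.
rewrite /stp; case: ifPn => [/andP[x0 x1]|x01].
  have kN := idx_lt N x0 x1.
  rewrite (bigD1 (Ordinal kN))//= big1 ?addr0 => [|j jN].
    by rewrite indicE mem_set ?mulr1//; apply/DyE; rewrite x0 eqxx.
  rewrite indicE memNset ?mulr0// => /DyE/andP[_ /eqP E].
  by move/eqP : jN; apply; apply/val_inj.
rewrite big1// => j _; rewrite indicE memNset ?mulr0// => /(Dy_sub01 (ltn_ord j)) /=.
by rewrite in_itv /= (negPf x01).
Qed.

Lemma measurable_stp N p : measurable_fun setT (stp N p).
Proof.
by apply: measurable_sum => k; apply: measurable_funM.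
Qed.

Lemma L1_stp N p : L1 (stp N p).
Proof.
by apply: L1_sum => k; apply: (L1_indicM (f := cst _)) => //; exact: L1_cst.
Qed.

Lemma stp_comp N p (h : R -> R) x : h 0 = 0 -> stp N (fun k => h (p k)) x = h (stp N p x).
Proof. by move=> h0; rewrite !stpE; case: ifP. Qed.

Lemma idx_divn N n x : 0 <= x -> (N <= n)%N -> idx N x = (idx n x %/ 2 ^ (n - N))%N.
Proof.
move=> x0; elim: n => [|n IH]; first by rewrite leqn0 => /eqP ->; rewrite divn1.
rewrite leq_eqVlt => /predU1P[->|]; first by rewrite subnn divn1.
rewrite ltnS => Nn; rewrite subSn// expnS divnMA IH// -(idxS n x0).
by rewrite divn2.
Qed.

Lemma Av_stp N n p j : (N <= n)%N -> (j < 2 ^ n)%N ->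
  Av (stp N p) n j = p (j %/ 2 ^ (n - N))%N.
Proof.
move=> Nn jn; rewrite -[RHS](@Av_cst R _ n j)//; apply: eq_Av => x /set_mem xD.
have := Dy_sub01 jn xD; rewrite /= in_itv /= stpE => /andP[x0 ->]; rewrite x0 /=.
by move: xD => /DyE/andP[_ /eqP <-]; rewrite (idx_divn x0 Nn).
Qed.

Lemma doubleS_lt_expn k n : (k < 2 ^ n)%N -> (k.*2.+1 < 2 ^ n.+1)%N.
Proof. by rewrite expnS mul2n ltn_Sdouble. Qed.

Lemma double_lt_expn k n : (k < 2 ^ n)%N -> (k.*2 < 2 ^ n.+1)%N.
Proof. by rewrite expnS mul2n ltn_double. Qed.

Lemma mart_cond X N p : mart X -> (forall k, (k < 2 ^ N)%N -> X N k = p k) ->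
  forall n k, (n <= N)%N -> (k < 2 ^ n)%N -> X n k = cond N p n k.
Proof.
move=> mX Xp n k nN; rewrite /cond; move: nN => /subnKC.
move: (N - n)%N => d; elim: d n k => [|d IH] n k /=.
  by rewrite addn0 => -> /Xp.
rewrite addnS -addSn => e kn.
by rewrite mX !IH// ?doubleS_lt_expn ?double_lt_expn.
Qed.

Lemma Av_stp_cond N n p k : (n <= N)%N -> (k < 2 ^ n)%N ->
  Av (stp N p) n k = cond N p n k.
Proof.
move=> nN kn; apply: mart_cond => //; first exact/Av_mart/L1_stp.
by move=> l lN; rewrite Av_stp// subnn expn0 divn1.
Qed.

Lemma hdif_stp_fine N n p k : (N <= n)%N -> (k < 2 ^ n)%N ->
  hdif (Av (stp N p)) n k = 0.
Proof.
move=> Nn kn; rewrite /hdif !Av_stp ?doubleS_lt_expn ?double_lt_expn ?leqW//.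
rewrite subSn// expnS !divnMA !divn2 doubleK /= uphalf_double subrr.
by rewrite mul0r.
Qed.

Lemma energy_stp_fine N n p : (N <= n)%N -> energy (Av (stp N p)) n = 0.
Proof.
move=> Nn; rewrite -(lavg_cst n 0); apply: eq_lavg => k kn.
by rewrite hdif_stp_fine// expr0n.
Qed.

Lemma hdif_stp N n p k : (n < N)%N -> (k < 2 ^ n)%N ->
  hdif (Av (stp N p)) n k = hdif (cond N p) n k.
Proof.
by move=> nN kn; rewrite /hdif !Av_stp_cond ?doubleS_lt_expn ?double_lt_expn.
Qed.

Lemma energy_stp N n p : (n < N)%N -> energy (Av (stp N p)) n = energy (cond N p) n.
Proof. by move=> nN; apply: eq_lavg => k kn; rewrite hdif_stp. Qed.

Lemma integral_stp N p : \int[mu]_x stp N p x = lavg N p.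
Proof.
rewrite -(lavg_Av N (L1_stp N p)); apply: eq_lavg => k kN.
by rewrite Av_stp// subnn divn1.
Qed.

Lemma L2_measurable f : L2 f -> measurable_fun setT f.
Proof. by move=> /sub_Lfun_mfun; rewrite inE. Qed.

Lemma L2_L1 f : L2 f -> L1 f.
Proof. by move=> /Lfun_subset12/Lfun1_integrable; apply; rewrite leb01T. Qed.

Lemma L2_sqr f : L2 f -> L1 (fun x => f x ^+ 2).
Proof. exact: Lfun2_integrable_sqr. Qed.

Lemma L2M f g : L2 f -> L2 g -> L1 (fun x => f x * g x).
Proof. by move=> hf hg; apply/Lfun1_integrable; exact: Lfun2_mul_Lfun1. Qed.

Lemma integral_sqrE f :
  (\int[mu]_x (`|(EFin \o f) x| `^ 2) = \int[mu]_x (f x ^+ 2)%:E)%E.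
Proof.
apply: eq_integral => x _.
by rewrite /= powR_mulrn// real_normK// num_real.
Qed.

Lemma Lq_norm_sqr f : (Lq_norm 2 f ^+ 2)%E = (\int[mu]_x (f x ^+ 2)%:E)%E.
Proof.
have I0 : (0 <= \int[mu]_x (f x ^+ 2)%:E)%E.
  by apply: integral_ge0 => x _; rewrite lee_fin sqr_ge0.
by rewrite /Lq_norm unlock integral_sqrE poweR12_sqrt// sqr_sqrte.
Qed.

Lemma L2_intro f : measurable_fun setT f -> L1 (fun x => f x ^+ 2) -> L2 f.
Proof.
move=> mf f2; rewrite inE; apply/andP; split; rewrite inE//= /finite_norm.
rewrite unlock poweR_lty//.
by move: (integrable_lty measurableT f2); rewrite -integral_sqrE.
Qed.

Lemma L2Z c f : L2 f -> L2 (fun x => c * f x).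
Proof.
move=> hf; apply: L2_intro; first by apply: measurable_funM => //; exact: L2_measurable.
by under eq_fun do rewrite exprMn; apply/L1Z/L2_sqr.
Qed.

Lemma L2D f g : L2 f -> L2 g -> L2 (fun x => f x + g x).
Proof.
move=> hf hg; apply: L2_intro.
  by apply: measurable_funD; exact: L2_measurable.
under eq_fun do rewrite sqrrD -mulr_natl.
by apply: L1D; [apply: L1D; [exact: L2_sqr|apply/L1Z/L2M]|exact: L2_sqr].
Qed.

Lemma L2_stp N p : L2 (stp N p).
Proof.
apply: L2_intro; first exact: measurable_stp.
under eq_fun do rewrite -(stp_comp _ _ _ (h := fun y => y ^+ 2)) ?expr0n//.
exact: L1_stp.
Qed.

Definition Cov f g n k := Av (fun x => f x * g x) n k - Av f n k * Av g n k.
Definition Var f n k := Av (fun x => f x ^+ 2) n k - Av f n k ^+ 2.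

Lemma Var_ge0 f n k : L2 f -> (k < 2 ^ n)%N -> 0 <= Var f n k.
Proof.
move=> hf kn; set c := Av f n k.
have : 0 <= Av (fun x => (f x - c) ^+ 2) n k.
  by apply: (@Av_ge0 R) => x; exact: sqr_ge0.
rewrite (_ : (fun x => _) = fun x => f x ^+ 2 + ((- 2 * c) * f x + c ^+ 2)); last first.
  by apply/funext => x; ring.
have f1 := L2_L1 hf; have c1 := @L1_cst R (c ^+ 2).
have Z1 : L1 (fun x => - 2 * c * f x) by exact: L1Z.
have S1 := L2_sqr hf; have D1 := L1D Z1 c1.
by rewrite AvD// AvD// AvZ// Av_cst// -/c /Var -/c; lra.
Qed.

Lemma Var_lin f g a c n k : L2 f -> L2 g ->
  Var (fun x => a * f x + c * g x) n k =
  a ^+ 2 * Var f n k + 2 * a * c * Cov f g n k + c ^+ 2 * Var g n k.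
Proof.
move=> hf hg; have [f1 g1] := (L2_L1 hf, L2_L1 hg).
rewrite /Var.
rewrite [X in Av X n k - _](_ : _ = fun x =>
  (a ^+ 2 * f x ^+ 2 + (2 * a * c) * (f x * g x)) + c ^+ 2 * g x ^+ 2); last first.
  by apply/funext => x; ring.
have F2 := L2_sqr hf; have G2 := L2_sqr hg; have FG := L2M hf hg.
have F1 := L1Z (a ^+ 2) F2; have C1 := L1Z (2 * a * c) FG.
have G1 := L1Z (c ^+ 2) G2; have FC := L1D F1 C1.
have f2 := L1Z a f1; have g2 := L1Z c g1.
by rewrite AvD// AvD// AvD// !AvZ// /Cov; ring.
Qed.

(** Cauchy-Schwarz: the variance of a combination [a * f + c * g] is a nonnegative
    quadratic form in [a] and [c]. *)
Lemma Cov_sqr_le f g n k : L2 f -> L2 g -> (k < 2 ^ n)%N ->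
  Cov f g n k ^+ 2 <= Var f n k * Var g n k.
Proof.
move=> hf hg kn.
have V a c : 0 <= a ^+ 2 * Var f n k + 2 * a * c * Cov f g n k + c ^+ 2 * Var g n k.
  rewrite -Var_lin//; apply: Var_ge0 => //.
  by apply: L2D; exact: L2Z.
have := Var_ge0 hf kn; have := Var_ge0 hg kn; move: V.
move: (Var f n k) (Var g n k) (Cov f g n k) => v w c V w0 v0.
have [w1|wle] := ltP 0 w.
  have := V w (- c); have -> : w ^+ 2 * v + 2 * w * - c * c + (- c) ^+ 2 * w =
    w * (v * w - c ^+ 2) by ring.
  by rewrite pmulr_rge0// subr_ge0.
have {w0 wle} w0 : w = 0 by apply/eqP; rewrite eq_le w0 wle.
rewrite {w}w0 in V *.
have [v1|vle] := ltP 0 v.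
  have := V c (- v); have -> : c ^+ 2 * v + 2 * c * - v * c + (- v) ^+ 2 * 0 =
    v * (v * 0 - c ^+ 2) by ring.
  by rewrite pmulr_rge0// subr_ge0.
have := V 1 (- c); have -> : v = 0 by apply/eqP; rewrite eq_le v0 vle.
by lra.
Qed.
End StepVariance.

(** * Square functions: convergence of averages and completeness *)

Section Convergence.
Variable R : realType.
Implicit Types (f g : R -> R) (p : nat -> R) (n k : nat) (x : R).

Notation mu := (@leb01 R).
Notation L1 f := (mu.-integrable setT (EFin \o f)).
Notation L2 f := (f \in Lfun mu 2%:E).
#[local] Hint Extern 0 (@measurable _ _ (Dy _ _)) => exact: measurable_Dy : core.

Lemma integral_leb01_Dy f n k : (k < 2 ^ n)%N ->
  (\int[mu]_(x in Dy n k) (f x)%:E =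
   \int[@lebesgue_measure R]_(x in Dy n k) (f x)%:E)%E.
Proof.
move=> kn; apply: eq_measure_integral => A mA AD; apply: leb01_sub.
apply: subset_trans AD _; apply: subset_trans (Dy_sub01 kn) _.
by apply: subset_itv; rewrite bnd_simp.
Qed.

Lemma lebesgue_Dy n k : lebesgue_measure (Dy n k) = (2 ^- n)%:E :> \bar R.
Proof.
rewrite lebesgue_measure_itv /= lte_fin ltr_pM2r ?invr_gt0 ?exprn_gt0//.
rewrite ltr_nat ltnSn -EFinD; congr EFin.
by rewrite -addn1 natrD mulrDl mul1r addrAC subrr add0r.
Qed.

(** The balls for negative [x] only complete the family; dyadic intervals lie in
    [[0, 1[]. *)
Lemma nicely_shrinking_Dy x : nicely_shrinking x
  (fun n => if 0 <= x then Dy n (idx n x) else ball x (2 ^- n)).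
Proof.
split=> [n|]; first by case: ifP => _; [exact: measurable_Dy|exact: measurable_ball].
have p0 n : 0 < (2 ^- n : R) by rewrite invr_gt0 exprn_gt0.
exists (2, fun n => PosNum (p0 n)); split => //=.
- have h : `|2^-1 : R| < 1 by rewrite ger0_norm// invf_lt1// ltr1n.
  have := cvg_expr h; apply: cvg_trans; apply: near_eq_cvg; apply: nearW => n /=.
  by rewrite exprVn.
- move=> n; case: ifP => x0 y /= yD; last exact: yD.
  have xD : Dy n (idx n x) x by apply/DyE; rewrite x0 eqxx.
  move: xD yD; rewrite /Dy /= !in_itv /= -[(idx n x).+1%:R]natr1 mulrDl mul1r.
  rewrite /ball /= => /andP[h1 h2] /andP[h3 h4].
  by rewrite ltr_norml; apply/andP; split; lra.
- move=> n; rewrite lebesgue_measure_ball ?(ltW (p0 n))//.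
  case: ifP => x0; rewrite ?lebesgue_Dy ?lebesgue_measure_ball ?(ltW (p0 n))//.
    by rewrite -EFinM lee_fin mulr_natl.
  by rewrite -EFinM lee_fin ler_peMl ?mulrn_wge0 ?(ltW (p0 n))// ler1n.
Qed.

Lemma lebesgue_integrable_patch f : L1 f ->
  (@lebesgue_measure R).-integrable setT (EFin \o (fun x => f x * \1_(Dy 0 0) x)).
Proof.
move=> hf; apply/integrableP; split.
  apply/measurable_EFinP; apply: measurable_funM; first exact: L1_measurable.
  by apply: measurable_indic; exact: measurable_Dy.
have -> : (\int[@lebesgue_measure R]_x `|(EFin \o (fun x => (f x * \1_(Dy 0 0) x)%R)) x| =
    \int[mu]_(x in Dy 0 0) `|f x|%:E)%E.
  rewrite integral_leb01_Dy// [RHS]integral_mkcond; apply: eq_integral => x _.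
  rewrite /= patchE indicE; case: (_ \in _); rewrite ?mulr1// mulr0 normr0//.
have /integrableP[_] := hf; apply: le_lt_trans.
apply: ge0_subset_integral => //.
by apply/measurable_EFinP; apply: measurableT_comp => //; exact: L1_measurable.
Qed.

(** Lebesgue differentiation along dyadic intervals. *)
Lemma Av_cvg f : L1 f ->
  {ae mu, forall x, Dy 0 0 x -> Av f n (idx n x) @[n --> \oo] --> f x}.
Proof.
move=> hf; pose h x := f x * \1_(Dy 0 0) x.
have lh : locally_integrable setT h.
  by apply: open_integrable_locally; [exact: openT|exact: lebesgue_integrable_patch].
have [N [mN N0 sub]] := lebesgue_differentiation lh.
exists N; split => //.
  apply/eqP; rewrite -measure_le0 -N0; exact: leb01_le.
apply: subset_trans sub => x /= H Hx; apply: H => Dx.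
have := nice_lebesgue_differentiation nicely_shrinking_Dy lh Hx.
have /andP[x0 x1] : (0 <= x) && (x < 1) by move: Dx; rewrite Dy00 /= in_itv.
have hx : h x = f x by rewrite /h indicE mem_set// mulr1.
rewrite x0 hx => /fine_cvg; apply: cvg_trans; apply: near_eq_cvg; apply: nearW => n /=.
have kn := idx_lt n x0 x1.
rewrite lebesgue_Dy inver gt_eqF ?invr_gt0 ?exprn_gt0// invrK.
rewrite (_ : (\int[lebesgue_measure]_(y in _) _)%E =
   (\int[mu]_(y in Dy n (idx n x)) (f y)%:E)%E); last first.
  rewrite integral_leb01_Dy//; apply: eq_integral => y /set_mem /(Dy_sub01 kn).
  by rewrite -Dy00 /h indicE => yD; rewrite mem_set// mulr1.
rewrite fineM//; apply: integrable_fin_num => //.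
exact: L1S.
Qed.

Definition sqn f : R := \int[mu]_x (f x ^+ 2).
(** The squared distance in [L^2] from [f] to its averages over generation [n],
    which is the sum of the energies from generation [n] on, and also the mean of
    the variances over this generation. *)
Definition mvar f n := sqn f - lavg n (fun k => Av f n k ^+ 2).

Lemma sqnE f : L2 f -> (\int[mu]_x (f x ^+ 2)%:E = (sqn f)%:E)%E.
Proof. by move=> /L2_sqr hf; rewrite fineK//; exact: integrable_fin_num. Qed.

(** Averages converge almost everywhere, so this is Fatou's lemma. *)
Lemma bounded_averages_L2 f M : L1 f ->
  (forall n, lavg n (fun k => Av f n k ^+ 2) <= M) -> L2 f /\ sqn f <= M.
Proof.
move=> hf hM.
have mf := L1_measurable hf.
pose F n x := (stp n (fun k => Av f n k ^+ 2) x)%:E.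
have F0 n x : (0 <= F n x)%E.
  by rewrite lee_fin stpE; case: ifP => // _; exact: sqr_ge0.
have mF n : measurable_fun setT (F n).
  by apply/measurable_EFinP; exact: measurable_stp.
have IF n : (\int[mu]_x F n x = (lavg n (fun k => Av f n k ^+ 2))%:E)%E.
  rewrite -integral_stp fineK//; apply: integrable_fin_num => //.
  exact: L1_stp.
have einf0 x : (0 <= limn_einf (F ^~ x))%E.
  rewrite limn_einf_lim; apply: lime_ge; first exact: is_cvg_einfs.
  by apply: nearW => n; apply: le_ereal_inf_tmp => _ [m _ <-].
have meinf : measurable_fun setT (fun x => limn_einf (F ^~ x)).
  apply: (measurableT_comp (f := -%E)) => //.
  apply: measurable_fun_limn_esup => n.
  exact: (measurableT_comp (f := -%E)).
have I : (\int[mu]_x (f x ^+ 2)%:E <= M%:E)%E.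
  apply: (@le_trans _ _ (limn_einf (fun n => \int[mu]_x F n x))%E); last first.
    rewrite limn_einf_lim; apply: lime_le; first exact: is_cvg_einfs.
    apply: nearW => n; apply: (@le_trans _ _ (\int[mu]_x F n x)%E).
      by apply: ereal_inf_lbound; exists n => /=.
    by rewrite IF lee_fin.
  apply: le_trans (fatou mu measurableT mF _) => //.
  apply: ae_ge0_le_integral => //.
  - by move=> x _; rewrite lee_fin sqr_ge0.
  - by apply/measurable_EFinP; exact: measurable_funX.
  have [N [mN N0 sub]] := Av_cvg hf.
  exists (N `|` ~` Dy 0 0); split.
  - by apply: measurableU => //; apply: measurableC.
  - by rewrite measureU0//; [exact: measurableC|exact: leb01_setD].
  move=> x /= H; apply: contrapT => /not_orP[xN /contrapT xD]; apply: H => _.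
  have {xN} cv : Av f n (idx n x) @[n --> \oo] --> f x.
    by apply: contrapT => ncv; apply: xN; apply: sub => /(_ xD).
  have {cv} : F n x @[n --> \oo] --> (f x ^+ 2)%:E.
    have /andP[x0 x1] : (0 <= x) && (x < 1) by move: xD; rewrite Dy00 /= in_itv.
    rewrite /F; under eq_fun do rewrite stpE x0 x1 /=.
    by apply: cvg_EFin; [exact: nearW|exact: (cvgM cv cv)].
  by move=> /cvg_limn_einf_sup[-> _].
have h2 : L1 (fun x => f x ^+ 2).
  apply/integrableP; split; first by apply/measurable_EFinP; exact: measurable_funX.
  apply: le_lt_trans (ltry M); apply: le_trans I.
  by under eq_integral => x _ do rewrite /= ger0_norm ?sqr_ge0//.
have f2 := L2_intro mf h2; split => //.
by rewrite -lee_fin -sqnE.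
Qed.

Lemma lavg_Var f n : L2 f -> lavg n (Var f n) = mvar f n.
Proof.
move=> hf; rewrite /mvar /sqn -(lavg_Av n (L2_sqr hf)).
rewrite -[X in _ - X]mul1r -mulNr -lavgZ -lavgD.
by apply: eq_lavg => k _; rewrite mulN1r.
Qed.

Lemma mvar_ge0 f n : L2 f -> 0 <= mvar f n.
Proof. by move=> hf; rewrite -lavg_Var//; apply: lavg_ge0 => k; exact: Var_ge0. Qed.

Lemma mvarS f n : L2 f -> mvar f n = energy (Av f) n + mvar f n.+1.
Proof. by move=> /L2_L1/Av_mart mf; rewrite energyE// /mvar; ring. Qed.

Lemma mvar_sum f n m : L2 f -> mvar f n = \sum_(i < m) energy (Av f) (n + i) + mvar f (n + m).
Proof.
move=> hf; elim: m => [|m IH]; first by rewrite big_ord0 add0r addn0.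
by rewrite big_ord_recr /= IH [X in _ + X = _]mvarS// addnS addrA.
Qed.

Lemma mvar_le f n m : L2 f -> (n <= m)%N -> mvar f m <= mvar f n.
Proof.
move=> hf /subnKC <-; rewrite (mvar_sum n (m - n) hf) lerDr.
by apply: sumr_ge0 => i _; exact: energy_ge0.
Qed.

(** Otherwise the mean squares of the averages would stay below a bound smaller
    than that of [f], against [bounded_averages_L2]. *)
Lemma mvar_small f e : L2 f -> 0 < e -> exists N, forall n, (N <= n)%N -> mvar f n <= e.
Proof.
move=> hf e0; suff [N Ne] : exists N, mvar f N <= e.
  by exists N => n /(mvar_le hf) h; exact: le_trans Ne.
apply: contrapT => /forallNP H.
have [] := @bounded_averages_L2 f (sqn f - e) (L2_L1 hf).
  by move=> n; have /negP := H n; rewrite -ltNge /mvar; lra.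
by move=> _; lra.
Qed.

Lemma mvar_le_tail f n B : L2 f -> (forall m, \sum_(i < m) energy (Av f) (n + i) <= B) ->
  mvar f n <= B.
Proof.
move=> hf hB; apply/ler_addgt0Pr => e /(mvar_small hf)[N He].
by rewrite (mvar_sum n N hf) lerD// He// leq_addl.
Qed.

Lemma sum_energy_le_sqn f n : L2 f -> Av f 0 0 ^+ 2 + \sum_(i < n) energy (Av f) i <= sqn f.
Proof.
move=> hf; have := mvar_sum 0 n hf; have := mvar_ge0 n hf.
by rewrite /mvar lavg0 add0n; lra.
Qed.

(** The energies are the increments of the mean squares of the averages. *)
Lemma energy_L2 f M : L1 f -> (forall n, \sum_(i < n) energy (Av f) i <= M) ->
  L2 f /\ sqn f <= Av f 0 0 ^+ 2 + M.
Proof.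
move=> hf hM; apply: bounded_averages_L2 => // n.
by have := hM n; rewrite sum_energy; [lra|exact: Av_mart].
Qed.

Section Weighted.
Variable q : R.
Hypothesis q_gt1 : 1 < q.
Let q0 : 0 < q. Proof. exact: lt_trans q_gt1. Qed.

Lemma weighted_tail (a : nat -> R) G n m : (forall i, 0 <= a i) ->
  (forall N, \sum_(i < N) q ^+ i * a i <= G) ->
  q ^+ n * \sum_(i < m) a (n + i)%N <= G.
Proof.
move=> a0 aG; apply: le_trans (aG (n + m)%N).
rewrite big_split_ord /= mulr_sumr ler_wpDl//.
  by apply: sumr_ge0 => i _; rewrite mulr_ge0// exprn_ge0// ltW.
apply: ler_sum => i _; rewrite ler_wpM2r// exprD ler_peMr ?exprn_ge0 ?(ltW q0)//.
by rewrite exprn_ege1// ltW.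
Qed.

Lemma weighted_mvar_le f G n : L2 f ->
  (forall N, \sum_(i < N) q ^+ i * energy (Av f) i <= G) -> q ^+ n * mvar f n <= G.
Proof.
move=> hf hG; rewrite mulrC -ler_pdivlMr ?exprn_gt0//; apply: mvar_le_tail => // m.
rewrite ler_pdivlMr ?exprn_gt0// mulrC weighted_tail// => i; exact: energy_ge0.
Qed.

Lemma sum_energy_le_weighted f G : (forall N, \sum_(i < N) q ^+ i * energy (Av f) i <= G) ->
  forall N, \sum_(i < N) energy (Av f) i <= G.
Proof.
move=> hG N; have := weighted_tail 0 N (energy_ge0 (Av f)) hG.
by rewrite expr0 mul1r.
Qed.

Definition Cmvar : R := (1 + q^-1) / (1 - q^-1).

Lemma Cmvar_ge0 : 0 <= Cmvar.
Proof.
have qV : 0 <= q^-1 by rewrite invr_ge0 ltW.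
by apply: divr_ge0; [exact: addr_ge0|rewrite subr_ge0 invf_le1// ltW].
Qed.

(** A mean variance is one energy plus the next mean variance, and the weights grow
    by [q]: the recursion contracts with factor [q^-1]. *)
Lemma sum_mvar_le f G N : L2 f ->
  (forall N, \sum_(i < N) q ^+ i * energy (Av f) i <= G) ->
  \sum_(n < N) q ^+ n * mvar f n <= Cmvar * G.
Proof.
move=> hf hG; have qV1 : q^-1 < 1 by rewrite invf_lt1.
have qV0 : 0 <= q^-1 by rewrite invr_ge0 ltW.
have := @geometric_absorb R q^-1 (fun n => q ^+ n * mvar f n)
  (fun n => q ^+ n * energy (Av f) n) N qV0 qV1.
move=> /(_ _ _)/wrap[n|n _|].
- by rewrite mulr_ge0 ?mvar_ge0// exprn_ge0// ltW.
- rewrite (_ : q^-1 * _ = q ^+ n * mvar f n.+1).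
    by rewrite [mvar f n]mvarS// mulrDr addrC.
  by rewrite exprS !mulrA mulVf ?gt_eqF// mul1r.
move=> /le_trans; apply; rewrite /Cmvar mulrAC ler_wpM2r ?invr_ge0 ?subr_ge0 ?(ltW qV1)//.
have := ler_wpM2l qV0 (weighted_mvar_le N hf hG); have := hG N; lra.
Qed.
End Weighted.
End Convergence.

Section Synthesis.
Variable R : realType.
Implicit Types (f g : R -> R) (X : nat -> nat -> R) (n k : nat) (x : R).

Notation mu := (@leb01 R).
Notation L1 f := (mu.-integrable setT (EFin \o f)).
#[local] Hint Extern 0 (@measurable _ _ (Dy _ _)) => exact: measurable_Dy : core.

Lemma mart_idxS X n x : mart X -> 0 <= x ->
  `|X n.+1 (idx n.+1 x) - X n (idx n x)| = `|hdif X n (idx n x)|.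
Proof.
move=> mX x0; rewrite -(idxS n x0); set l := idx n.+1 x.
rewrite -{1}(odd_double_half l); case: (odd l); rewrite ?add1n ?add0n.
  by rewrite mart_doubleS// addrAC subrr add0r normrN.
by rewrite mart_double// addrAC subrr add0r.
Qed.

Variables (q G : R) (X : nat -> nat -> R).
Hypothesis q_gt1 : 1 < q.
Hypothesis mX : mart X.
Hypothesis hG : forall N, \sum_(n < N) q ^+ n * energy X n <= G.

Let incr n x : R := stp n (fun k => `|hdif X n k|) x.
Let total x : \bar R := (\sum_(n <oo) (incr n x)%:E)%E.

Let incr0 n x : 0 <= incr n x.
Proof. by rewrite /incr stpE; case: ifP. Qed.

Let mincr n : measurable_fun setT (incr n).
Proof. exact: measurable_stp. Qed.

Let sum_incr N : \sum_(n < N) lavg n (fun k => `|hdif X n k|) <=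
  (G + (1 - q^-1)^-1) / 2.
Proof.
have q0 : 0 < q by exact: lt_trans q_gt1.
apply: (@le_trans _ _ ((\sum_(n < N) q ^+ n * energy X n + \sum_(n < N) q^-1 ^+ n) / 2)).
  rewrite -big_split mulr_suml; apply: ler_sum => n _ /=.
  (* by the inequality [2 * h <= q ^+ n * h ^+ 2 + q ^- n] *)
  rewrite -(lavg_cst n (q^-1 ^+ n)) /energy -lavgZ -lavgD mulrC -lavgZ.
  apply: le_lavg => k _; rewrite -[hdif X n k ^+ 2]real_normK ?num_real//.
  move: `|hdif X n k| => h; rewrite exprVn.
  have w0 : 0 < q ^+ n by rewrite exprn_gt0.
  move: (q ^+ n) w0 => w w0; rewrite -subr_ge0; set e := (X in 0 <= X).
  rewrite (_ : e = (w * h - 1) ^+ 2 / (2 * w)); last by rewrite /e; field; rewrite gt_eqF.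
  by rewrite divr_ge0 ?sqr_ge0// mulr_ge0// ltW.
rewrite ler_pM2r// lerD//.
have qV1 : q^-1 < 1 by rewrite invf_lt1.
have qV0 : 0 <= q^-1 by rewrite invr_ge0 ltW.
rewrite -[leRHS]mul1r ler_pdivlMr ?subr_gt0//.
have := subrX1 (q^-1) N; have : 0 <= q^-1 ^+ N by rewrite exprn_ge0.
by lra.
Qed.

Let mtotal : measurable_fun setT total.
Proof.
apply: ge0_emeasurable_sum => n *; first by rewrite lee_fin.
by apply/measurable_EFinP; exact: mincr.
Qed.

Let total0 x : (0 <= total x)%E.
Proof. by apply: nneseries_ge0 => n _ _; rewrite lee_fin. Qed.

Let itotal : mu.-integrable setT total.
Proof.
apply/integrableP; split => //.
under eq_integral do rewrite gee0_abs//.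
rewrite integral_nneseries//; last 2 first.
- by move=> n; by apply/measurable_EFinP; exact: mincr.
- by move=> n x _; rewrite lee_fin.
apply: (@le_lt_trans _ _ ((G + (1 - q^-1)^-1) / 2)%:E); last exact: ltry.
apply: lime_le.
  by apply: is_cvg_nneseries => n _ _; apply: integral_ge0 => x _; rewrite lee_fin.
apply: nearW => N.
rewrite (_ : (\sum_(0 <= n < N) _)%E =
  (\sum_(n < N) lavg n (fun k => `|hdif X n k|))%:E) ?lee_fin//.
rewrite big_mkord -sumEFin; apply: eq_bigr => n _.
by rewrite -integral_stp fineK//; apply: integrable_fin_num => //; exact: L1_stp.
Qed.

Let approx n x : R := stp n (X n) x.
Let syn x : R := fine (limn_esup (fun n => (approx n x)%:E)).

Let msyn : measurable_fun setT syn.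
Proof.
apply: (measurableT_comp (f := fine)) => //.
by apply: measurable_fun_limn_esup => n; apply/measurable_EFinP; exact: measurable_stp.
Qed.

Let approx_le n x : Dy 0 0 x ->
  `|approx n x| <= `|X 0 0| + \sum_(i < n) incr i x.
Proof.
rewrite Dy00 /= in_itv /= /approx => x01; rewrite stpE x01; have /andP[x0 x1] := x01.
elim: n => [|n IH].
  have := idx_lt 0 x0 x1; rewrite expn0 ltnS leqn0 => /eqP ->.
  by rewrite big_ord0 addr0.
rewrite big_ord_recr /= addrA.
rewrite [in leRHS]/incr stpE x01 -(mart_idxS n mX x0).
apply: le_trans (lerD IH (lexx _)); rewrite addrC -lerBlDr.
exact: lerB_dist.
Qed.

Let approx_cvg x : Dy 0 0 x -> (total x < +oo)%E ->
  approx n x @[n --> \oo] --> syn x.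
Proof.
move=> xD tx.
have x01 : (0 <= x) && (x < 1) by move: xD; rewrite Dy00 /= in_itv.
have /andP[x0 x1] := x01.
suff : cvgn (approx ^~ x).
  move=> /cvg_ex[l cl]; suff -> : syn x = l by [].
  have : (approx n x)%:E @[n --> \oo] --> l%:E by apply: cvg_EFin; [exact: nearW|].
  by move=> /cvg_limn_einf_sup[_ e]; rewrite /syn e.
pose u n := approx n.+1 x - approx n x.
have : cvgn (series u).
  apply: normed_cvg; apply: nondecreasing_is_cvgn.
    by apply: nondecreasing_series => n _ _; exact: normr_ge0.
  exists (fine (total x)) => _ [N _ <-].
  have tfin : total x \is a fin_num by rewrite ge0_fin_numE.
  rewrite -lee_fin fineK//.
  apply: le_trans (nneseries_lim_ge N _); last by move=> n _ _; rewrite lee_fin.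
  rewrite /series /= -sumEFin; apply: lee_sum => n _.
  by rewrite lee_fin /u /approx /incr !stpE x01 mart_idxS.
have E : approx ^~ x = fun n => series u n + approx 0%N x.
  apply/funext => n; rewrite /series /= telescope_sumr//.
  by rewrite subrK.
rewrite E => cs; apply: is_cvgD => //; exact: is_cvg_cst.
Qed.

Let syn_dominated D : measurable D ->
  mu.-integrable D (EFin \o syn) /\
  (\int[mu]_(x in D) (approx n x)%:E @[n --> \oo] --> \int[mu]_(x in D) (syn x)%:E)%E.
Proof.
move=> mD; pose b x := ((`|X 0 0|)%:E + total x)%E.
have ib : mu.-integrable setT b.
  by apply: integrableD => //; exact: L1_cst.
have [] := @dominated_convergence _ _ _ mu D mD (fun n => EFin \o approx n)
    (EFin \o syn) b.
- move=> n; apply/measurable_EFinP; apply: measurable_funS (measurable_stp n (X n)) => //.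
- by apply/measurable_EFinP; apply: measurable_funS msyn.
- have [N [mN N0 sub]] := integrable_ae measurableT itotal.
  exists (N `|` ~` Dy 0 0); split.
  + by apply: measurableU => //; apply: measurableC.
  + by rewrite measureU0//; [exact: measurableC|exact: leb01_setD].
  move=> x /= H; apply: contrapT => /not_orP[xN /contrapT xD]; apply: H => _.
  apply: cvg_EFin; first exact: nearW.
  apply: approx_cvg => //; apply: contrapT => tx; apply: xN; apply: sub => /= /(_ I).
  by rewrite ge0_fin_numE.
- exact: integrableS ib.
- exists (~` Dy 0 0); split; [exact: measurableC|exact: leb01_setD|].
  move=> x /= H xD; apply: H => n _; apply: (@le_trans _ _ (`|X 0 0| + \sum_(i < n) incr i x)%:E).
    by rewrite lee_fin approx_le.
  rewrite EFinD leeD2l// -sumEFin -(big_mkord xpredT (fun i => (incr i x)%:E)).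
  by apply: nneseries_lim_ge => i _ _; rewrite lee_fin.
by move=> h1 _ h2; split.
Qed.

(** The increments along branches are summable in [L^1] because their energies
    decay geometrically; hence the step functions of the array converge almost
    everywhere, dominated by the sum of all increments, and their limit has the
    given averages. *)
Lemma synthesis : exists g : R -> R, L1 g /\
  forall n k, (k < 2 ^ n)%N -> Av g n k = X n k.
Proof.
exists syn; split; first by case: (syn_dominated measurableT).
move=> n k kn; have [h1 h2] := syn_dominated (@measurable_Dy R n k).
rewrite /Av; set I := Rintegral _ _ _.
suff -> : I = 2 ^- n * X n k by rewrite mulrA mulfV ?mul1r// expf_neq0.
rewrite /I /Rintegral; apply: EFin_inj; rewrite fineK; last exact: integrable_fin_num.
have c2 : (\int[mu]_(x in Dy n k) (approx m x)%:E @[m --> \oo] --> (2 ^- n * X n k)%:E)%E.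
  apply: cvg_near_cst; exists n => // m /= nm.
  have := Av_stp_cond (X m) nm kn.
  rewrite -(mart_cond mX _ nm kn)// /Av => <-.
  rewrite mulrA mulVf ?mul1r ?expf_neq0// fineK//.
  apply: integrable_fin_num => //; apply: L1S => //; exact: L1_stp.
exact: (cvg_unique _ h2 c2).
Qed.
End Synthesis.

(** * Oscillation of a Carleson symbol *)

Section SymbolVariance.
Variables (R : realType) (t : R).
Hypothesis t_gt1 : 1 < t.
Implicit Types (b : R -> R) (n k m : nat).
Notation mu := (@leb01 R).
Notation L2 f := (f \in Lfun mu 2%:E).

(** The terms of the Carleson condition for the part of [b] at generations at
    least [m]. *)
Definition coefw m b n k : R :=
  (m <= n)%:R * (t ^+ 4 ^+ n * (2 ^- n * hdif (Av b) n k ^+ 2)).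

Let t0 : 0 < t. Proof. exact: lt_trans t_gt1. Qed.
Let w1 : 1 < t ^+ 4. Proof. by rewrite expr_gt1// ltW. Qed.
Let w0 : 0 < t ^+ 4. Proof. exact: lt_trans w1. Qed.

Lemma coefw_ge0 m b n k : 0 <= coefw m b n k.
Proof.
apply: mulr_ge0 => //; apply: mulr_ge0; first by rewrite exprn_ge0// ltW.
by apply: mulr_ge0; rewrite ?sqr_ge0// invr_ge0 exprn_ge0.
Qed.

(** Inclusion of the [k']-th interval of generation [n'] in the [k]-th interval of
    generation [n]. *)
Definition below n k n' k' : bool := (n <= n')%N && (k' %/ 2 ^ (n' - n) == k)%N.

Lemma below_double n k n' k' : (n <= n')%N ->
  (below n k n'.+1 k'.*2 = below n k n' k') * (below n k n'.+1 k'.*2.+1 = below n k n' k').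
Proof.
move=> nn; rewrite /below nn leqW//= subSn// expnS !divnMA !divn2 doubleK.
by rewrite /= uphalf_double.
Qed.

Lemma below_desc_closed n k : desc_closed (below n k).
Proof.
move=> n' k' H; have /andP[nn _] := H.
by rewrite !(below_double _ _ nn) H.
Qed.

(** The value [1 + 1 / (w - 1)] comes from the geometric sum in [sob_below]. *)
Definition Cvar : R := 1 + (t ^+ 4 - 1)^-1.

Lemma Cvar_ge0 : 0 <= Cvar.
Proof. by rewrite addr_ge0// invr_ge0 subr_ge0 ltW. Qed.

Lemma sum_below n k : (k < 2 ^ n)%N -> lavg n (fun k' => (below n k n k')%:R) = 2 ^- n :> R.
Proof.
move=> kn; rewrite /lavg (bigD1 (Ordinal kn))//= big1 => [|j jk].
  by rewrite /below leqnn subnn divn1 eqxx addr0 mulr1.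
rewrite /below leqnn subnn divn1; case: eqP => // e; move/eqP : jk; case.
exact/val_inj.
Qed.

Lemma stp_below n k N x : (n <= N)%N ->
  stp N (fun k' => (below n k N k')%:R) x = stp n (fun k' => (below n k n k')%:R) x :> R.
Proof.
move=> nN; rewrite !stpE; case: ifP => // /andP[x0 _].
by rewrite /below leqnn subnn divn1 nN (idx_divn x0 nN).
Qed.

(** The indicator of a dyadic interval as a test function for its capacity: its
    energies are at most [2 ^- n] before generation [n] and vanish afterwards. *)
Lemma sob_below n k N : (k < 2 ^ n)%N -> (n <= N)%N ->
  sob t N (fun k' => (below n k N k')%:R) <= Cvar * (2 ^- n * t ^+ 4 ^+ n).
Proof.
move=> kn nN.
pose f := stp n (fun k' => (below n k n k')%:R : R).
have fE : stp N (fun k' => (below n k N k')%:R) = f by apply/funext => x; exact: stp_below.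
have sq (M : nat) (k' : nat) : ((below n k M k')%:R : R) ^+ 2 = (below n k M k')%:R.
  by case: below; rewrite ?expr1n ?expr0n.
have l1 : lavg N (fun k' => (below n k N k')%:R) = 2 ^- n :> R.
  by rewrite -integral_stp fE /f integral_stp sum_below.
have e1 i : (i < N)%N -> energy (cond N (fun k' => (below n k N k')%:R : R)) i =
    energy (Av f) i by move=> iN; rewrite -energy_stp// fE.
rewrite /sob (eq_lavg (g := fun k' => (below n k N k')%:R)); last by move=> ? _; exact: sq.
rewrite l1 (eq_bigr (fun i : 'I_N => t ^+ 4 ^+ i * energy (Av f) i)); last first.
  by move=> i _; rewrite e1.
rewrite -(subnKC nN) big_split_ord /= [X in _ + (_ + X)]big1 ?addr0; last first.
  by move=> i _; rewrite energy_stp_fine ?mulr0// leq_addr.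
have e2 i : (i < n)%N -> energy (Av f) i <= 2 ^- n.
  move=> ni; rewrite energy_stp//.
  have <- : lavg i (subavg (n - i) (fun k' => (below n k n k')%:R)) = 2 ^- n :> R.
    by rewrite lavg_subavg subnKC ?sum_below// ltnW.
  apply: le_lavg => k' _; apply: le_trans (hdif_cond_sqr_le _ _ 0 ni) _.
  by apply: le_subavg => l; rewrite subr0 sq.
have p0 : 0 <= (2 ^- n : R) by rewrite invr_ge0 exprn_ge0.
apply: (@le_trans _ _ (2 ^- n + \sum_(i < n) t ^+ 4 ^+ i * 2 ^- n)).
  rewrite lerD2l; apply: ler_sum => i _; rewrite ler_wpM2l ?e2//.
  by rewrite exprn_ge0// ltW.
rewrite -mulr_suml; set S := \sum_(i < n) _.
rewrite (_ : _ + _ = 2 ^- n * (1 + S)); last by ring.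
rewrite mulrCA ler_wpM2l//.
have w10 : 0 < t ^+ 4 - 1 by rewrite subr_gt0.
have wn : 1 <= t ^+ 4 ^+ n by rewrite exprn_ege1// ltW.
have -> : S = (t ^+ 4 ^+ n - 1) / (t ^+ 4 - 1).
  by rewrite subrX1 mulrAC mulfV ?mul1r// gt_eqF.
rewrite /Cvar [leRHS]mulrDl mul1r; apply: lerD => //.
by rewrite mulrC ler_wpM2l ?invr_ge0 ?(ltW w10)// gerBl.
Qed.

Lemma Var_rec b n k : L2 b ->
  Var b n k = hdif (Av b) n k ^+ 2 + (Var b n.+1 k.*2 + Var b n.+1 k.*2.+1) / 2.
Proof.
move=> hb; have m1 := Av_mart (L2_L1 hb); have m2 := Av_mart (L2_sqr hb).
by rewrite /Var (mart_double _ _ m1) (mart_doubleS _ _ m1) [in LHS]m2; field.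
Qed.

(** The variance on an interval is a normalised sum of squared coefficients below
    it. Each of them has at least the weight of generation [n], which cancels
    against the capacity bound [sob_below]. *)
Lemma Var_le b n k m kappa : L2 b -> 0 <= kappa -> carleson t kappa (coefw m b) ->
  (m <= n)%N -> (k < 2 ^ n)%N -> Var b n k <= Cvar * kappa.
Proof.
move=> hb k0 car mn kn.
have p0 : 0 < (2 ^- n : R) by rewrite invr_gt0 exprn_gt0.
pose W d := lavg (n + d) (fun k' => (below n k (n + d) k')%:R * Var b (n + d) k').
pose H d := lavg (n + d) (fun k' => (below n k (n + d) k')%:R * hdif (Av b) (n + d) k' ^+ 2).
have WS d : W d = H d + W d.+1.
  rewrite /W /H addnS lavgS -lavgD; apply: eq_lavg => k' _.
  rewrite !(below_double _ _ (leq_addr d n)) (Var_rec _ _ hb).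
  by field.
have W0 : W 0%N = 2 ^- n * Var b n k.
  rewrite /W addn0 mulrC -(sum_below kn) -lavgZ; apply: eq_lavg => k' kn'.
  rewrite /below leqnn subnn divn1; case: eqP => [->|]; last by rewrite mul0r mulr0.
  by rewrite mulrC.
have WE d : W 0%N = \sum_(i < d) H i + W d.
  elim: d => [|d IH]; first by rewrite big_ord0 add0r.
  by rewrite big_ord_recr /= IH WS addrA.
have Wv d : W d <= mvar b (n + d).
  rewrite -lavg_Var//; apply: le_lavg => k' kn'.
  by rewrite ler_piMl ?Var_ge0//; case: below.
have Hk d : t ^+ 4 ^+ n * \sum_(i < d) H i <= kappa * (Cvar * (2 ^- n * t ^+ 4 ^+ n)).
  have := car (n + d)%N (below n k) (fun k' => (below n k (n + d) k')%:R)
    (@below_desc_closed n k).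
  move=> /(_ _)/wrap[k' _ ->//|].
  move=> /le_trans/(_ (ler_wpM2l k0 (sob_below kn (leq_addr d n)))); apply: le_trans.
  rewrite -addnS big_split_ord /= ler_wpDl//.
    apply: sumr_ge0 => i _; apply: sumr_ge0 => j _.
    by rewrite mulr_ge0// coefw_ge0.
  rewrite big_ord_recr /= ler_wpDr//.
    by apply: sumr_ge0 => j _; rewrite mulr_ge0// coefw_ge0.
  rewrite mulr_sumr; apply: ler_sum => i _.
  rewrite /H /lavg mulrA mulr_sumr; apply: ler_sum => j _.
  rewrite /coefw (leq_trans mn (leq_addr _ _)) mul1r mulrCA ler_wpM2l//.
  rewrite -[leLHS]mulrA ler_wpM2r//.
    by apply: mulr_ge0; rewrite ?sqr_ge0// invr_ge0 exprn_ge0.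
  by apply: ler_weXn2l; [exact: ltW|exact: leq_addr].
have HK d : \sum_(i < d) H i <= Cvar * kappa * 2 ^- n.
  have wn : 0 < t ^+ 4 ^+ n by rewrite exprn_gt0.
  rewrite -(ler_pM2l wn) (le_trans (Hk d))// le_eqVlt; apply/orP; left.
  by apply/eqP; ring.
apply/ler_addgt0Pr => e e0.
have [N HN] := mvar_small hb (mulr_gt0 e0 p0).
rewrite -(ler_pM2l p0) -W0 (WE N).
have := Wv N; have := HN _ (leq_addl n N); have := HK N; lra.
Qed.
End SymbolVariance.

(** * Sobolev norms and capacities in terms of averages *)

Section DyadSums.
Variable R : realType.
Implicit Types (I J : dyad) (n k N : nat).

Definition mkdyad n k (kn : (k < 2 ^ n)%N) : dyad := exist _ (n, k) kn.

Definition dyad_of N (p : {n : 'I_N & 'I_(2 ^ n)}) : dyad :=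
  mkdyad (ltn_ord (projT2 p)).

(** A cofinal sequence among the finite sets of intervals. *)
Definition gens N : {fset dyad} :=
  [fset dyad_of p | p in {: {n : 'I_N & 'I_(2 ^ n)}}]%fset.

Lemma mem_gens N I : (I \in gens N) = (dgen I < N)%N.
Proof.
apply/imfsetP/idP => /= [[[n k] _ ->]|]; first exact: ltn_ord.
case: I => -[n k] /= kn; rewrite /dgen /= => nN.
exists (Tagged (fun n : 'I_N => 'I_(2 ^ n)) (Ordinal kn : 'I_(2 ^ (Ordinal nN)))) => //.
exact: val_inj.
Qed.

Lemma sum_gens (V : nmodType) N (a : nat -> nat -> V) :
  \sum_(I <- gens N) a (dgen I) (dpos I) = \sum_(n < N) \sum_(k < 2 ^ n) a n k.
Proof.
rewrite big_imfset /=; last first.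
  move=> [n k] [n' k'] _ _ /(congr1 val) /= [].
  move=> /val_inj e; case: _ / e in k' *.
  by move=> /val_inj ->.
rewrite big_enum /=.
rewrite (@sig_big_dep _ _ _ 'I_N (fun n : 'I_N => 'I_(2 ^ n)) xpredT
  (fun _ => xpredT) (fun (n : 'I_N) (k : 'I_(2 ^ n)) => a n k)) /=.
by apply: eq_bigl.
Qed.

Lemma gens_le_esum N (D : set dyad) (a : dyad -> \bar R) :
  (forall I, D I -> 0 <= a I)%E ->
  (\sum_(I <- gens N) (if I \in D then a I else 0) <= \esum_(I in D) a I)%E.
Proof.
move=> a0; rewrite [leRHS]esum_mkcond; apply: esum_ge.
exists [set` gens N]; first by split => //; exact: finite_fset.
by rewrite fsbig_finite//= set_fsetK.
Qed.

Lemma esum_le_gens (D : set dyad) (a : nat -> nat -> R) B :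
  (forall n k, 0 <= a n k) ->
  (forall N, \sum_(n < N) \sum_(k < 2 ^ n) a n k <= B) ->
  (\esum_(I in D) (a (dgen I) (dpos I))%:E <= B%:E)%E.
Proof.
move=> a0 aB; apply: ge_ereal_sup => _ [A [finA AD] <-].
rewrite fsbig_finite//= sumEFin lee_fin.
set F := fset_set A; pose N := (\max_(I <- F) (dgen I).+1)%N.
apply: le_trans (aB N); rewrite -sum_gens.
have FN : {subset F <= gens N}.
  move=> I IF; rewrite mem_gens /N big_seq_fsetE /=.
  by rewrite -[I]/(val [`IF]%fset) (leq_bigmax [`IF]%fset).
rewrite [leRHS](bigID (mem F))/= -[X in X <= _]addr0 lerD ?sumr_ge0//.
rewrite le_eqVlt; apply/orP; left; apply/eqP.
rewrite -[RHS]big_filter; apply: perm_big.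
apply: uniq_perm; rewrite ?filter_uniq ?fset_uniq// => I.
by rewrite mem_filter /=; case: (boolP (I \in F)) => //= /FN ->.
Qed.
End DyadSums.

Section Dictionary.
Variables (R : realType) (s : R).
Hypothesis s_gt0 : 0 < s.
Implicit Types (f b : R -> R) (I J : dyad) (n k N m : nat).
Notation mu := (@leb01 R).
Notation L1 f := (mu.-integrable setT (EFin \o f)).
Notation L2 f := (f \in Lfun mu 2%:E).

(** The fourth root of the scale [4 `^ s] of the weights [|I| `^ (- 2 * s)]. *)
Definition scale : R := 2 `^ (s / 2).
Notation t := scale.

Lemma scale_gt1 : 1 < t.
Proof.
have : (1 : R) `^ (s / 2) < 2 `^ (s / 2).
  by apply: gt0_ltr_powR; rewrite ?divr_gt0 ?nnegrE ?ltr1n.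
by rewrite powR1.
Qed.

Lemma weightE I : (dlen R I) `^ (- 2 * s) = t ^+ 4 ^+ dgen I.
Proof.
rewrite /dlen; move: (dgen I) => n.
have -> : (2 ^- n : R) = 2 `^ (- n%:R) by rewrite powR_invn.
have -> : t ^+ 4 ^+ n = 2 `^ (s / 2 * (4 * n)%:R).
  by rewrite -exprM powRrM powR_mulrn ?powR_ge0.
by rewrite -powRrM natrM; congr (_ `^ _); field.
Qed.

Let w0 : 0 < t ^+ 4.
Proof. by rewrite exprn_gt0// powR_gt0. Qed.

(** The term of the squared norm of [D^s f] at the [k]-th interval of generation
    [n]. *)
Definition sobterm f n k : R := t ^+ 4 ^+ n * (2 ^- n * hdif (Av f) n k ^+ 2).

Lemma sobterm_ge0 f n k : 0 <= sobterm f n k.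
Proof.
apply: mulr_ge0; first by rewrite exprn_ge0// ltW.
by apply: mulr_ge0; rewrite ?sqr_ge0// invr_ge0 exprn_ge0.
Qed.

Lemma sobterm_sum f n : \sum_(k < 2 ^ n) sobterm f n k = t ^+ 4 ^+ n * energy (Av f) n.
Proof. by rewrite /sobterm -!mulr_sumr. Qed.

Lemma termE f I : L1 f -> (dlen R I) `^ (- 2 * s) * `|inner f (haar I)| ^+ 2 =
  sobterm f (dgen I) (dpos I).
Proof. by move=> hf; rewrite real_normK ?num_real// inner_haar_sqr// weightE. Qed.

Lemma Ds_sqnorm_le f G : L1 f ->
  (forall N, \sum_(n < N) t ^+ 4 ^+ n * energy (Av f) n <= G) ->
  (Ds_sqnorm s f <= G%:E)%E.
Proof.
move=> hf hG; rewrite /Ds_sqnorm; under eq_esum do rewrite termE//.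
apply: esum_le_gens => [|N]; first exact: sobterm_ge0.
by under eq_bigr do rewrite sobterm_sum.
Qed.

Lemma le_Ds_sqnorm f N : L1 f ->
  ((\sum_(n < N) t ^+ 4 ^+ n * energy (Av f) n)%:E <= Ds_sqnorm s f)%E.
Proof.
move=> hf; apply: le_trans (gens_le_esum N _); last first.
  by move=> I _; rewrite lee_fin mulr_ge0 ?powR_ge0// exprn_ge0.
under [leRHS]eq_bigr do rewrite mem_set// termE//.
rewrite sumEFin lee_fin sum_gens.
by under [leRHS]eq_bigr do rewrite sobterm_sum.
Qed.

Lemma Ds_sqnorm_ge0 f : (0 <= Ds_sqnorm s f)%E.
Proof. by apply: esum_ge0 => I _; rewrite lee_fin mulr_ge0 ?powR_ge0// exprn_ge0. Qed.

Lemma Hs_sqnorm_ge0 f : (0 <= Hs_sqnorm s f)%E.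
Proof.
rewrite adde_ge0 ?Ds_sqnorm_ge0// Lq_norm_sqr integral_ge0// => x _.
by rewrite lee_fin sqr_ge0.
Qed.

Lemma Hs_bounds f : Hs s f -> L2 f /\ exists2 G, Hs_sqnorm s f = G%:E &
  forall N, Av f 0 0 ^+ 2 + \sum_(n < N) t ^+ 4 ^+ n * energy (Av f) n <= G.
Proof.
move=> [hf hlt]; split => //; have f1 := L2_L1 hf.
have hfin : Hs_sqnorm s f \is a fin_num by rewrite ge0_fin_numE ?Hs_sqnorm_ge0.
exists (fine (Hs_sqnorm s f)); first by rewrite fineK.
move=> N; rewrite -lee_fin fineK// addrC EFinD /Hs_sqnorm leeD ?le_Ds_sqnorm//.
rewrite Lq_norm_sqr sqnE// lee_fin.
by have := sum_energy_le_sqn 0 hf; rewrite big_ord0 addr0.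
Qed.

Lemma Hs_intro f G : L1 f ->
  (forall N, \sum_(n < N) t ^+ 4 ^+ n * energy (Av f) n <= G) ->
  Hs s f /\ (Hs_sqnorm s f <= (Av f 0 0 ^+ 2 + 2 * G)%:E)%E.
Proof.
move=> f1 hG.
have w1 : 1 < t ^+ 4 by rewrite expr_gt1 ?scale_gt1// ltW// powR_gt0.
have [f2 hs] := energy_L2 f1 (sum_energy_le_weighted w1 hG).
have h : (Hs_sqnorm s f <= (Av f 0 0 ^+ 2 + 2 * G)%:E)%E.
  rewrite (_ : _ + 2 * G = G + (Av f 0 0 ^+ 2 + G)); last by ring.
  rewrite EFinD leeD ?Ds_sqnorm_le//.
  by rewrite Lq_norm_sqr sqnE.
by split => //; split => //; exact: le_lt_trans h (ltry _).
Qed.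

Lemma Cap_ge0 (E : set R) : (0 <= Cap s E)%E.
Proof. by apply: le_ereal_inf_tmp => _ [f _ <-]; exact: Hs_sqnorm_ge0. Qed.

Lemma stp_sob N p : Hs s (stp N p) /\ (Hs_sqnorm s (stp N p) <= (sob t N p)%:E)%E.
Proof.
have f1 := L1_stp N p.
have hG M : \sum_(n < M) t ^+ 4 ^+ n * energy (Av (stp N p)) n <=
    \sum_(n < N) t ^+ 4 ^+ n * energy (cond N p) n.
  have p0 n : 0 <= t ^+ 4 ^+ n * energy (cond N p) n.
    by rewrite mulr_ge0 ?energy_ge0// exprn_ge0// ltW.
  elim: M => [|M IH]; first by rewrite big_ord0 sumr_ge0.
  have [MN|NM] := ltnP M N; last first.
    by rewrite big_ord_recr /= energy_stp_fine// mulr0 addr0.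
  apply: le_trans (ler_sum_ord p0 MN).
  by apply: ler_sum => i _; rewrite energy_stp// (leq_trans (ltn_ord i)).
have [hs _] := Hs_intro f1 hG; split => //.
rewrite /sob addrC EFinD leeD ?Ds_sqnorm_le//.
rewrite Lq_norm_sqr sqnE ?L2_stp// lee_fin /sqn.
under eq_Rintegral do rewrite -(stp_comp _ _ _ (h := fun y => y ^+ 2)) ?expr0n//.
by rewrite integral_stp.
Qed.

Lemma Cap_le_sob (E : set R) N p : (forall x, E x -> 1 <= stp N p x) ->
  (Cap s E <= (sob t N p)%:E)%E.
Proof.
move=> hE; have [h1 h2] := stp_sob N p; apply: le_trans h2.
apply: ereal_inf_lbound; exists (stp N p) => //; split => //.
exact: aeW.
Qed.

(** Clears a denominator that may vanish or be infinite. *)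
Lemma le_of_ratio (S C : \bar R) (kappa u : R) : 0 <= kappa -> 0 <= u ->
  (0 <= S -> 0 <= C -> C <= u%:E -> S / C <= kappa%:E -> S <= (kappa * u)%:E)%E.
Proof.
move=> k0 u0 S0 C0 Cu.
have [->|Cn0] := eqVneq C 0%E.
  rewrite inve0; have [->|Sn0] := eqVneq S 0%E.
    by move=> _; rewrite lee_fin mulr_ge0.
  by rewrite gt0_muley ?leye_eq// lt0e Sn0.
have Cf : C \is a fin_num by rewrite ge0_fin_numE// (le_lt_trans Cu) ?ltry.
move=> H; have C1 : (0 < C)%E by rewrite lt0e Cn0.
have : (S / C * C <= kappa%:E * C)%E by rewrite lee_wpmul2r.
rewrite -muleA mulVe// mule1 => /le_trans; apply.
by rewrite EFinM lee_wpmul2l// lee_fin.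
Qed.
End Dictionary.

Section Stopping.
Variables (R : realType) (s : R).
Hypothesis s_gt0 : 0 < s.
Implicit Types (f b : R -> R) (I J : dyad) (n k N m : nat).
Notation mu := (@leb01 R).
Notation L1 f := (mu.-integrable setT (EFin \o f)).
Notation L2 f := (f \in Lfun mu 2%:E).
Notation t := (scale s).

Lemma dintE I x : @dint R I x <-> (0 <= x) && (idx (dgen I) x == dpos I).
Proof. exact: DyE. Qed.

Lemma desc_closed_div (S : nat -> nat -> bool) n k m : desc_closed S -> (m <= n)%N ->
  S m (k %/ 2 ^ (n - m))%N -> S n k.
Proof.
move=> dS /subnKC <-; rewrite addKn; elim: (n - m)%N k => [|d IH] k.
  by rewrite divn1 addn0.
rewrite expnS divnMA divn2 addnS => /IH /dS /andP[h1 h2].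
by rewrite -(odd_double_half k); case: (odd k); rewrite ?add1n ?add0n.
Qed.

(** The maximal intervals of a union of subtrees. *)
Definition stopping (S : nat -> nat -> bool) n k :=
  S n k && ((n == 0)%N || ~~ S n.-1 k./2).

Lemma stopping_above (S : nat -> nat -> bool) n k : S n k ->
  exists2 m, (m <= n)%N & stopping S m (k %/ 2 ^ (n - m))%N.
Proof.
elim: n k => [|n IH] k Snk.
  by exists 0%N; rewrite // /stopping divn1 Snk.
have [/IH[m mn hm]|Sn] := boolP (S n k./2).
  exists m; first exact: leqW.
  by rewrite subSn// expnS divnMA divn2.
by exists n.+1; rewrite // /stopping subnn divn1 Snk /= Sn.
Qed.

Lemma stopping_disjoint (S : nat -> nat -> bool) (x : R) n m : desc_closed S -> 0 <= x ->
  stopping S n (idx n x) -> stopping S m (idx m x) -> n = m.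
Proof.
move=> dS x0; wlog nm : n m / (n < m)%N => [H|].
  by move=> hn hm; case: (ltngtP n m) => // nm; [exact: H|apply/esym/H].
case/andP=> Sn _ /andP[_]; rewrite -[m](ltn_predK nm) /= idxS// => /negP[].
apply: (desc_closed_div dS (m := n)); first by rewrite -ltnS (ltn_predK nm).
by rewrite -idx_divn// -ltnS (ltn_predK nm).
Qed.

(** The maximal intervals of a union of subtrees form a disjoint family, so the
    capacitary condition controls the whole union. *)
Lemma carleson_of_ratio b (K : set dyad) m kappa : L1 b -> 0 <= kappa ->
  (forall I, (m <= dgen I)%N -> K I) ->
  (forall F, disjoint_families R F -> (Cap_ratio s b K F <= kappa%:E)%E) ->
  carleson t kappa (coefw t m b).
Proof.
move=> hb k0 hK hF N S p dS Sp.
have al0 n k : 0 <= coefw t m b n k by exact/coefw_ge0/scale_gt1.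
pose F := [fset I in gens N.+1 | stopping S (dgen I) (dpos I)]%fset.
have FE I : (I \in F) = (dgen I < N.+1)%N && stopping S (dgen I) (dpos I).
  by rewrite !inE mem_gens.
have cover n k : (n < N.+1)%N -> (k < 2 ^ n)%N -> S n k ->
    exists2 I, I \in F & forall x, @Dy R n k x -> @dint R I x.
  move=> nN kn /stopping_above[n0 n0n h].
  have h0 : (k %/ 2 ^ (n - n0) < 2 ^ n0)%N.
    by rewrite ltn_divLR ?expn_gt0// -expnD subnKC.
  exists (mkdyad h0); first by rewrite FE /= (leq_ltn_trans n0n nN).
  move=> x /DyE/andP[x0 /eqP e]; apply/dintE.
  by rewrite x0 /= (idx_divn x0 n0n) e eqxx.
have [F0|Fn0] := eqVneq F fset0.
  rewrite big1 ?mulr_ge0 ?sob_ge0 ?scale_gt1// => n _; rewrite big1// => k _.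
  case: (boolP (S n k)) => [Snk|_]; last by rewrite mul0r.
  have [I] := cover _ _ (ltn_ord n) (ltn_ord k) Snk.
  by rewrite F0.
have dF : disjoint_families R F.
  split => // I J /= IF JF [x [xI xJ]].
  move: IF JF; rewrite !FE => /andP[_ hI] /andP[_ hJ].
  move: xI xJ => /dintE/andP[x0 /eqP eI] /dintE/andP[_ /eqP eJ].
  rewrite -eI in hI; rewrite -eJ in hJ.
  have e := stopping_disjoint dS x0 hI hJ.
  apply/val_inj; rewrite [val I]surjective_pairing [val J]surjective_pairing.
  by congr pair => //; rewrite -/(dpos I) -/(dpos J) -eI -eJ e.
have capF : (Cap s (\bigcup_(I in [set` F]) @dint R I) <= (sob t N p)%:E)%E.
  apply: Cap_le_sob => // x [I /= IF /dintE/andP[x0 /eqP xI]].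
  move: IF; rewrite FE => /andP[IN hI].
  have x1 : x < 1.
    have : Dy (dgen I) (dpos I) x by apply/DyE; rewrite x0 xI eqxx.
    by move=> /(Dy_sub01 (valP I)); rewrite /= in_itv /= => /andP[].
  rewrite stpE x0 x1; apply: Sp; first exact: idx_lt.
  apply: (desc_closed_div dS (m := dgen I)) => //.
  by rewrite -(idx_divn x0)// xI; case/andP: hI.
have := hF _ dF; rewrite /Cap_ratio.
set E := (\sum_(I <- F) _)%E => hE.
have E0 : (0 <= E)%E.
  apply: sume_ge0 => I _; apply: esum_ge0 => J _.
  by rewrite lee_fin mulr_ge0 ?powR_ge0// exprn_ge0.
have := le_of_ratio k0 (sob_ge0 (scale_gt1 s_gt0) N p) E0 (Cap_ge0 s _) capF hE.
rewrite -lee_fin; apply: le_trans.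
pose inside I n k : R := if `[< Dy n k `<=` @dint R I >] then coefw t m b n k else 0.
have in0 I n k : 0 <= inside I n k by rewrite /inside; case: ifP.
apply: (@le_trans _ _ (\sum_(I <- F) \sum_(n < N.+1) \sum_(k < 2 ^ n) inside I n k)%:E).
  rewrite lee_fin exchange_big /=; apply: ler_sum => n _.
  rewrite exchange_big /=; apply: ler_sum => k _.
  case: (boolP (S n k)) => [Snk|_]; last by rewrite mul0r sumr_ge0.
  have [I IF hI] := cover _ _ (ltn_ord n) (ltn_ord k) Snk.
  rewrite mul1r (big_fsetD1 I)//= {1}/inside asboolT; last by move=> x /hI.
  by rewrite lerDl sumr_ge0.
rewrite -sumEFin; apply: lee_sum => I _.
apply: le_trans (gens_le_esum N.+1 _); last first.
  by move=> J _; rewrite lee_fin mulr_ge0 ?powR_ge0// exprn_ge0.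
rewrite -(sum_gens N.+1 (inside I)) -sumEFin; apply: lee_sum => J _.
rewrite /inside; case: asboolP => [JI|_]; last first.
  by case: ifP => _; rewrite lee_fin// mulr_ge0 ?powR_ge0// exprn_ge0.
rewrite /coefw; case: (leqP m (dgen J)) => mJ; last first.
  by rewrite mul0r; case: ifP => _; rewrite lee_fin// mulr_ge0 ?powR_ge0// exprn_ge0.
by rewrite mem_set ?termE// ?mul1r//; split => //; exact: hK.
Qed.

Lemma Cap_ratio_ge0 b K F : (0 <= Cap_ratio s b K F)%E.
Proof.
rewrite mule_ge0 ?inve_ge0 ?Cap_ge0//.
apply: sume_ge0 => I _; apply: esum_ge0 => J _.
by rewrite lee_fin mulr_ge0 ?powR_ge0// exprn_ge0.
Qed.

Lemma disjoint_singleton I : disjoint_families R [fset I]%fset.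
Proof.
split; first by apply/fset0Pn; exists I; rewrite inE.
by move=> i j /=; rewrite !inE => /eqP -> /eqP ->.
Qed.

Lemma BMO_carleson b : BMOs s b -> exists beta : R,
  [/\ 0 <= beta, BMOs_norm s b = beta%:E, L1 b & carleson t (beta ^+ 2) (coefw t 0 b)].
Proof.
move=> [/Lfun1_integrable hb hlt].
have top : (0 < 2 ^ 0)%N by [].
have h0 : (0 <= BMOs_norm s b)%E.
  apply: (@le_trans _ _ (sqrte (Cap_ratio s b setT [fset mkdyad top]%fset))).
    exact: sqrte_ge0.
  rewrite /BMOs_norm; apply: ereal_sup_ubound.
  by exists [fset mkdyad top]%fset => //; exact: disjoint_singleton.
have hfin : BMOs_norm s b \is a fin_num by rewrite ge0_fin_numE.
exists (fine (BMOs_norm s b)); rewrite fineK// fine_ge0//; split => //.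
apply: (carleson_of_ratio (K := setT)) => //; first exact: sqr_ge0.
move=> F dF; rewrite -[leLHS]sqr_sqrte ?Cap_ratio_ge0// EFin_expe fineK//.
rewrite lee_sqr ?sqrte_ge0//.
by rewrite /BMOs_norm; apply: ereal_sup_ubound; exists F.
Qed.

(** The whole interval, with the constant one as a test function. *)
Lemma carleson_energy b kappa N : carleson t kappa (coefw t 0 b) ->
  \sum_(n < N) t ^+ 4 ^+ n * energy (Av b) n <= kappa.
Proof.
move=> car.
have := car N (fun _ _ => true) (fun=> 1) (fun _ _ _ => isT) (fun _ _ _ => lexx _).
rewrite sob1 mulr1; apply: le_trans.
apply: (@le_trans _ _ (\sum_(n < N.+1) t ^+ 4 ^+ n * energy (Av b) n)).
  apply: (ler_sum_ord (u := fun n => t ^+ 4 ^+ n * energy (Av b) n)) => // n.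
  by rewrite mulr_ge0 ?energy_ge0// !exprn_ge0// powR_ge0.
apply: ler_sum => n _; rewrite -sobterm_sum; apply: ler_sum => k _.
by rewrite /coefw leq0n !mul1r.
Qed.

Lemma carleson_L2 b kappa : L1 b -> carleson t kappa (coefw t 0 b) -> L2 b.
Proof.
move=> hb car.
by have [[]] := Hs_intro s_gt0 hb (fun N => carleson_energy N car).
Qed.

Lemma CMO_carleson b e : CMOs s b -> 0 < e ->
  exists m, carleson t e (coefw t m b).
Proof.
move=> [[/Lfun1_integrable hb _] hcv] e0.
have [fin cv] := (fine_cvgP _ _).1 hcv.
have [N1 _ h1] := fin.
have /cvgrPdist_le/(_ e e0)[N2 _ h2] := cv.
pose N := maxn N1 N2; exists N.+1.
have hf := h1 N (leq_maxl _ _); have := h2 N (leq_maxr _ _) => /=.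
rewrite sub0r normrN => h3.
apply: (carleson_of_ratio (K := ~` coarse R N)) => //; first exact: ltW.
  move=> I /= NI; rewrite /coarse /= /dlen lef_pV2 ?posrE ?exprn_gt0//.
  by rewrite ler_eXn2l ?ltr1n// => /(leq_trans NI); rewrite ltnn.
move=> F dF; apply: (@le_trans _ _ (ereal_sup [set Cap_ratio s b (~` coarse R N) F
                        | F in disjoint_families R])).
  by apply: ereal_sup_ubound; exists F.
rewrite -[leLHS]fineK// lee_fin; apply: le_trans h3.
exact: ler_norm.
Qed.
End Stopping.

(** * The Haar shift *)

Section Shift.
Variable R : realType.
Implicit Types (f g : R -> R) (X : nat -> nat -> R) (I J : dyad) (n k N m : nat).
Notation mu := (@leb01 R).
Notation L1 f := (mu.-integrable setT (EFin \o f)).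
Notation L2 f := (f \in Lfun mu 2%:E).
#[local] Hint Extern 0 (@measurable _ _ (Dy _ _)) => exact: measurable_Dy : core.

Definition sqrt2 : R := Num.sqrt 2.

(** The half differences of the shift of a function with averages [X]: the
    coefficient of the parent, with a sign, normalised by the ratio [sqrt2] of the
    heights of the two Haar functions. *)
Definition sdif X n k : R :=
  if n is m.+1 then (-1) ^+ odd k * sqrt2 * hdif X m k./2 else 0.

(** The averages of the shift of a function with averages [X]. *)
Fixpoint shiftA X n k : R :=
  if n is m.+1 then shiftA X m k./2 + (-1) ^+ odd k * sdif X m k./2 else 0.

Lemma shiftA_mart X : mart (shiftA X).
Proof.
by move=> n k /=; rewrite odd_double /= doubleK uphalf_double expr0 expr1; field.
Qed.

Lemma hdif_shiftA X n k : hdif (shiftA X) n k = sdif X n k.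
Proof.
by rewrite /hdif /= odd_double /= doubleK uphalf_double expr0 expr1; field.
Qed.

Lemma sqrt2_sqr : sqrt2 ^+ 2 = 2.
Proof. by rewrite sqr_sqrtr. Qed.

Lemma sdif_sqr X n k : sdif X n.+1 k ^+ 2 = 2 * hdif X n k./2 ^+ 2.
Proof. by rewrite /= !exprMn sqrr_sign sqrt2_sqr mul1r. Qed.

Lemma energy_shiftA0 X : energy (shiftA X) 0 = 0.
Proof. by rewrite /energy lavg0 hdif_shiftA /= expr0n. Qed.

Lemma energy_shiftAS X n : energy (shiftA X) n.+1 = 2 * energy X n.
Proof.
rewrite /energy -(lavg_half n) -lavgZ; apply: eq_lavg => k _.
by rewrite hdif_shiftA sdif_sqr.
Qed.

Lemma mart_ext X Y : mart X -> mart Y -> X 0 0 = Y 0 0 ->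
  (forall n k, (k < 2 ^ n)%N -> hdif X n k = hdif Y n k) ->
  forall n k, (k < 2 ^ n)%N -> X n k = Y n k.
Proof.
move=> mX mY e0 e; elim=> [|n IH] k.
  by rewrite expn0 ltnS leqn0 => /eqP ->.
move=> /half_lt_expn kn; rewrite -(odd_double_half k).
case: (odd k); rewrite ?add1n ?add0n.
  by rewrite (mart_doubleS _ _ mX) (mart_doubleS _ _ mY) IH// e.
by rewrite (mart_double _ _ mX) (mart_double _ _ mY) IH// e.
Qed.

Lemma AvB_hdif f g n k : L1 f -> L1 g ->
  hdif (Av (fun x => f x - g x)) n k = hdif (Av f) n k - hdif (Av g) n k.
Proof. by move=> hf hg; rewrite /hdif !AvB//; ring. Qed.

Lemma AvD_hdif f g n k : L1 f -> L1 g ->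
  hdif (Av (fun x => f x + g x)) n k = hdif (Av f) n k + hdif (Av g) n k.
Proof. by move=> hf hg; rewrite /hdif !AvD//; ring. Qed.

Lemma AvZ_hdif c f n k : L1 f -> hdif (Av (fun x => c * f x)) n k = c * hdif (Av f) n k.
Proof. by move=> hf; rewrite /hdif !AvZ//; ring. Qed.

Lemma mem_Dy n k (x : R) : 0 <= x -> (x \in Dy n k) = (idx n x == k).
Proof.
move=> x0; apply/idP/idP => [/set_mem/DyE/andP[]//|e].
by apply/mem_set/DyE; rewrite x0.
Qed.

Lemma haar_stp I : haar I = stp (dgen I).+1 (fun l => (dlen R I) `^ (- 2^-1) *
  ((l == (dpos I).*2)%:R - (l == (dpos I).*2.+1)%:R)).
Proof.
apply/funext => x; rewrite haarE stpE.
have pI := valP I; rewrite -/(dgen I) -/(dpos I) in pI.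
case: ifPn => [/andP[x0 x1]|x01].
  by rewrite !indicE !mem_Dy.
rewrite !indicE !memNset ?subrr ?mulr0// => /Dy_sub01 /=.
  by move=> /(_ (doubleS_lt_expn pI)); rewrite in_itv /= (negPf x01).
by move=> /(_ (double_lt_expn pI)); rewrite in_itv /= (negPf x01).
Qed.

Lemma doubleS_neq k l : (k.*2.+1 == l.*2) = false.
Proof. by apply/eqP => /(congr1 odd); rewrite /= !odd_double. Qed.

Lemma double_neqS k l : (k.*2 == l.*2.+1) = false.
Proof. by apply/eqP => /(congr1 odd); rewrite /= !odd_double. Qed.

Lemma L1_haar I : L1 (@haar R I).
Proof. by rewrite haar_stp; exact: L1_stp. Qed.

Lemma Av_haar_coarse I n k : (n <= dgen I)%N -> (k < 2 ^ n)%N -> Av (@haar R I) n k = 0.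
Proof.
move=> nI kn; have mX := Av_mart (L1_haar I).
rewrite (@mart_cond R (Av (haar I)) (dgen I) (fun=> 0))//; last first.
  move=> l lI; rewrite mX haar_stp !Av_stp ?doubleS_lt_expn ?double_lt_expn//.
  by rewrite subnn !divn1 doubleS_neq double_neqS eqSS; ring.
by rewrite /cond subavg_cst.
Qed.

(** Orthogonality of the Haar system. *)
Lemma hdif_haar I n k : (k < 2 ^ n)%N -> hdif (Av (@haar R I)) n k =
  ((n == dgen I) && (k == dpos I))%:R * (dlen R I) `^ (- 2^-1).
Proof.
case: (ltngtP n (dgen I)) => [nI|nI|->] kn /=.
- by rewrite /hdif !Av_haar_coarse ?doubleS_lt_expn ?double_lt_expn// subrr !mul0r.
- by rewrite haar_stp hdif_stp_fine// mul0r.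
rewrite /hdif haar_stp !Av_stp ?doubleS_lt_expn ?double_lt_expn//.
rewrite subnn !divn1 doubleS_neq double_neqS eqSS (inj_eq double_inj).
by case: (k == dpos I) => /=; field.
Qed.

Lemma norm_haar I : (dlen R I) `^ (- 2^-1) ^+ 2 = 2 ^+ dgen I.
Proof. exact: powRN12_sqr. Qed.

Lemma norm_haar_half I J : dgen J = (dgen I).+1 ->
  (dlen R J) `^ (- 2^-1) = sqrt2 * (dlen R I) `^ (- 2^-1).
Proof.
move=> e; apply/eqP; rewrite -(@eqrXn2 _ 2) ?mulr_ge0 ?powR_ge0 ?sqrtr_ge0//.
by rewrite exprMn !norm_haar sqrt2_sqr e exprS.
Qed.

(** The interval [(n, k)] belongs to [F]; stated on the pair so as not to require a
    proof that [k < 2 ^ n]. *)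
Definition has_node (F : {fset dyad}) n k : bool :=
  has (fun I => (dgen I == n) && (dpos I == k)) F.

Lemma shift_psumE f F : shift_psum f F = fun x => \sum_(I <- F)
  inner f (haar I) * (haar (lhalf I) x - haar (rhalf I) x).
Proof. by []. Qed.

Lemma L1_psum f F : L1 (@shift_psum R f F).
Proof. by apply: L1_sum => I; apply/L1Z/L1B; exact: L1_haar. Qed.

Lemma hdif_sum (I : eqType) (r : seq I) (G : I -> R -> R) n k : (forall i, L1 (G i)) ->
  hdif (Av (fun x => \sum_(i <- r) G i x)) n k = \sum_(i <- r) hdif (Av (G i)) n k.
Proof.
move=> hG; elim: r => [|i r IH].
  rewrite big_nil (_ : (fun x => _) = cst 0 * cst 0); last first.
    by apply/funext => x; rewrite big_nil /= mul0r.
  have h0 := @L1_cst R 0.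
  by have := @AvZ_hdif 0 (cst 0) n k h0; rewrite mul0r.
rewrite big_cons -IH -AvD_hdif//; last exact: L1_sum.
by congr (hdif (Av _) _ _); apply/funext => x; rewrite big_cons.
Qed.

(** A partial sum of the shift series retains the coefficients of the intervals
    whose parent was chosen. *)
Lemma hdif_psum f F n k : L1 f -> (k < 2 ^ n)%N ->
  hdif (Av (shift_psum f F)) n k =
  (if n is m.+1 then has_node F m k./2 else false)%:R * sdif (Av f) n k.
Proof.
move=> hf kn; rewrite shift_psumE hdif_sum; last first.
  by move=> I; apply/L1Z/L1B; exact: L1_haar.
pose T I : R := inner f (haar I) * (hdif (Av (@haar R (lhalf I))) n k -
  hdif (Av (@haar R (rhalf I))) n k).
rewrite (eq_bigr T) => [|I _]; last first.
  rewrite AvZ_hdif; last by apply: L1B; exact: L1_haar.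
  by rewrite AvB_hdif//; exact: L1_haar.
have TE I : T I = if n is m.+1 then
   ((dgen I == m) && (dpos I == k./2))%:R * sdif (Av f) n k else 0.
  rewrite /T !hdif_haar//.
  rewrite (norm_haar_half (I := I) (J := lhalf I))//.
  rewrite inner_haar//; case: n kn @T => [|m] kn _ /=.
    by rewrite !mul0r subrr mulr0.
  rewrite eqSS eq_sym; case: eqVneq => [e|] /=; last by rewrite !mul0r subrr mulr0.
  rewrite -{1 2}(odd_double_half k).
  have c2 := norm_haar I; move: c2; set c := _ `^ _ => c2.
  have e2 : c * 2 ^- dgen I * c = 1 by rewrite mulrAC -expr2 c2 mulfV// expf_neq0.
  have -> : (odd k + k./2.*2 == dpos (lhalf I))%N = ~~ odd k && (dpos I == k./2).
    rewrite /dpos /= -/(dpos I).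
    by case: (odd k); rewrite ?add1n ?add0n ?doubleS_neq// (inj_eq double_inj) eq_sym.
  have -> : (odd k + k./2.*2 == dpos (rhalf I))%N = odd k && (dpos I == k./2).
    rewrite /dpos /= -/(dpos I).
    by case: (odd k); rewrite ?add1n ?add0n ?double_neqS// eqSS (inj_eq double_inj) eq_sym.
  case: (eqVneq (dpos I) k./2) => [->|ne]; last by rewrite !andbF !mul0r subrr mulr0.
  rewrite !andbT; move: e2; rewrite e; clear c2; clearbody c.
  set v := 2 ^- m; set r := sqrt2; set d := hdif _ _ _; clearbody v r d => e2.
  case: (odd k); rewrite /= ?expr0 ?expr1 ?mul0r ?mul1r ?sub0r ?subr0.
    have -> : c * (v * d) * - (r * c) = - (c * v * c * (r * d)) by ring.
    by rewrite e2; ring.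
  have -> : c * (v * d) * (r * c) = c * v * c * (r * d) by ring.
  by rewrite e2; ring.
case: n kn T TE => [|m] kn T TE.
  by rewrite big1 ?mul0r// => I _; rewrite TE.
rewrite (eq_bigr _ (fun I _ => TE I)) -mulr_suml; congr (_ * _).
rewrite /has_node; case: hasP => [[P PF /andP[/eqP gP /eqP pP]]|H].
  rewrite (big_fsetD1 P)//= gP pP !eqxx big1_fset ?addr0// => I.
  rewrite !inE => /andP[IP _] _; case: eqP => //= gI; case: eqP => //= pI.
  move/eqP : IP; case; apply/val_inj.
  by rewrite [val I]surjective_pairing [val P]surjective_pairing
    -/(dgen I) -/(dpos I) -/(dgen P) -/(dpos P) gI pI gP pP.
rewrite big1_seq// => I /andP[_ IF]; case: andP => // e.
by exfalso; apply: H; exists I => //; apply/andP.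
Qed.
End Shift.

Section ShiftVersions.
Variable R : realType.
Implicit Types (f g w : R -> R) (X : nat -> nat -> R) (I J : dyad) (n k N m : nat).
Notation mu := (@leb01 R).
Notation L1 f := (mu.-integrable setT (EFin \o f)).
Notation L2 f := (f \in Lfun mu 2%:E).
#[local] Hint Extern 0 (@measurable _ _ (Dy _ _)) => exact: measurable_Dy : core.

#[local] Instance totally_proper : ProperFilter (@summability.totally dyad) :=
  summability.totally_filter.

Lemma L1_le_Lq (q : R) w : 1 < q -> measurable_fun setT w ->
  (\int[mu]_x `|w x|%:E <= Lq_norm q w)%E.
Proof.
move=> q1 mw; have q0 : 0 < q by exact: lt_trans q1.
pose r := (1 - q^-1)^-1; have r0 : 0 < r by rewrite invr_gt0 subr_gt0 invf_lt1.
have := @hoelder _ _ _ mu w (cst 1) q r mw (measurable_cst _) q0 r0.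
rewrite /r invrK addrC subrK => /(_ erefl).
rewrite Lnorm_cst1 leb01T poweR1r mule1 Lnorm1; apply: le_trans.
by under [leRHS]eq_integral do rewrite /= mulr1.
Qed.

Lemma Lq_L1 (q : R) w : 1 < q -> w \in Lfun mu q%:E -> L1 w.
Proof.
move=> q1 hw; apply/Lfun1_integrable; apply: (@Lfun_subset _ _ _ _ 1%E q%:E) hw => //.
- by rewrite lee_fin ltW.
- by rewrite leb01T.
- by rewrite lee_fin ltW.
Qed.

Lemma norm_Av_le w n k : L1 w -> `|Av w n k| <= 2 ^+ n * \int[mu]_x `|w x|.
Proof.
move=> hw; rewrite /Av normrM ger0_norm ?exprn_ge0// ler_wpM2l ?exprn_ge0//.
apply: le_trans (le_normr_Rintegral _ _) _ => //; first exact: L1S.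
rewrite -Rintegral_indicM//; apply: le_Rintegral => //.
- by apply: L1_indicM => //; exact: integrable_norm hw.
- exact: integrable_norm hw.
- by move=> x _; rewrite indicE; case: (_ \in _); rewrite ?mulr1 ?mulr0.
Qed.

Lemma Lq_small (q e : R) w n k : 1 < q -> L1 w -> (Lq_norm q w <= e%:E)%E ->
  `|Av w n k| <= 2 ^+ n * e.
Proof.
move=> q1 hw we; apply: le_trans (norm_Av_le _ _ hw) _.
rewrite ler_wpM2l ?exprn_ge0// -lee_fin fineK.
  by apply: le_trans we; apply: L1_le_Lq => //; exact: L1_measurable.
by apply: integrable_fin_num => //; exact: integrable_norm hw.
Qed.

Lemma eq0_small (a c : R) : 0 <= c -> (forall e, 0 < e -> `|a| <= c * e) -> a = 0.
Proof.
move=> c0 H; apply/eqP; rewrite -normr_le0; apply/ler_addgt0Pr => e e0.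
have := H (e / (c + 1)) (divr_gt0 e0 (ltr_wpDl c0 ltr01)); rewrite add0r => /le_trans; apply.
rewrite mulrA ler_pdivrMr ?ltr_wpDl// mulrC ler_wpM2l ?(ltW e0)//; lra.
Qed.

Lemma Av_psum00 f F : Av (@shift_psum R f F) 0 0 = 0.
Proof.
rewrite shift_psumE; elim: (enum_fset F) => [|I r IH].
  rewrite (_ : (fun x => _) = cst 0); first by rewrite Av_cst.
  by apply/funext => x; rewrite big_nil.
rewrite (_ : (fun x => _) = fun x => inner f (haar I) * (haar (lhalf I) x - haar (rhalf I) x) +
  \sum_(I <- r) inner f (haar I) * (haar (lhalf I) x - haar (rhalf I) x)); last first.
  by apply/funext => x; rewrite big_cons.
have hI J : L1 (@haar R J) by exact: L1_haar.
rewrite AvD; last 2 first.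
- by apply/L1Z/L1B.
- by apply: L1_sum => J; apply/L1Z/L1B.
by rewrite IH AvZ ?AvB ?Av_haar_coarse ?subrr ?mulr0 ?addr0//; exact: L1B.
Qed.

Lemma has_node_gens n k (F : {fset dyad}) M : (gens M `<=` F)%fset -> (n < M)%N ->
  (k < 2 ^ n)%N -> has_node F n k.
Proof.
move=> MF nM kn; apply/hasP; exists (mkdyad kn); last by rewrite /= !eqxx.
by apply: (fsubsetP MF); rewrite mem_gens.
Qed.

(** Averages are continuous in [L^q], and the averages of a partial sum are
    eventually those predicted by the action of the shift on the coefficients.
    Hence all versions of a shift agree as far as averages can see. *)
Lemma shift_averages f g : is_haar_shift f g -> [/\ L1 f, L1 g &
  forall n k, (k < 2 ^ n)%N -> Av g n k = shiftA (Av f) n k].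
Proof.
move=> [q q1 [hf hg cv]]; have f1 := Lq_L1 q1 hf; have g1 := Lq_L1 q1 hg.
split => //.
have small (e : R) M : 0 < e -> exists2 F : {fset dyad}, (gens M `<=` F)%fset &
    (Lq_norm q (g \- shift_psum f F)%R <= e%:E)%E.
  move=> e0; have [fin /cvgrPdist_le/(_ e e0) h] := (fine_cvgP _ _).1 cv.
  have hM : summability.totally [set F : {fset dyad} | (gens M `<=` F)%fset].
    by exists (gens M).
  have [F [[h1 h2] h3]] := filter_ex (filterI (filterI fin h) hM).
  exists F => //; rewrite -[leLHS]fineK// lee_fin.
  by move: h2; rewrite /= sub0r normrN => /(le_trans (ler_norm _)).
have wL1 F : L1 (fun x => g x - shift_psum f F x) by apply: L1B => //; exact: L1_psum.
apply: mart_ext; [exact: Av_mart|exact: shiftA_mart| |].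
  apply: (@eq0_small _ (2 ^+ 0)) => // e e0; have [F _ he] := small e 0%N e0.
  have := Lq_small 0 0 q1 (wL1 F) he.
  by rewrite (AvB _ _ g1 (L1_psum f F)) Av_psum00 subr0.
move=> n k kn; rewrite hdif_shiftA; apply/eqP; rewrite -subr_eq0; apply/eqP.
apply: (@eq0_small _ (2 ^+ n.+1)) => // e e0; have [F FM he] := small e n e0.
have E : hdif (Av (shift_psum f F)) n k = sdif (Av f) n k.
  rewrite hdif_psum//; case: n kn FM => [|n] kn FM; first by rewrite /= mulr0.
  by rewrite (has_node_gens FM) ?mul1r// half_lt_expn.
rewrite -E -AvB_hdif//; last exact: L1_psum.
rewrite /hdif normrM [ `|2^-1| ]ger0_norm// ler_pdivrMr//.
apply: le_trans (ler_normB _ _) _.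
have h j := Lq_small n.+1 j q1 (wL1 F) he.
by have := h k.*2; have := h k.*2.+1; lra.
Qed.

Section Existence.
Variables (q G : R) (f : R -> R).
Hypothesis q_gt1 : 1 < q.
Hypothesis f2 : L2 f.
Hypothesis hG : forall N, \sum_(n < N) q ^+ n * energy (Av f) n <= G.

Let f1 : L1 f. Proof. exact: L2_L1. Qed.
Let q0 : 0 < q. Proof. exact: lt_trans q_gt1. Qed.

Lemma shiftA_energy_le N :
  \sum_(n < N) q ^+ n * energy (shiftA (Av f)) n <= 2 * q * G.
Proof.
apply: (@le_trans _ _ (\sum_(n < N.+1) q ^+ n * energy (shiftA (Av f)) n)).
  apply: (ler_sum_ord (u := fun n => q ^+ n * energy (shiftA (Av f)) n)) => // n.
  by rewrite mulr_ge0 ?energy_ge0// exprn_ge0// ltW.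
rewrite big_ord_recl energy_shiftA0 mulr0 add0r.
rewrite (eq_bigr (fun n : 'I_N => 2 * q * (q ^+ n * energy (Av f) n))) => [|n _].
  by rewrite -mulr_sumr; apply: ler_wpM2l; [rewrite mulr_ge0// ltW|exact: hG].
by rewrite lift0 energy_shiftAS exprS; ring.
Qed.

(** Outside the chosen intervals only the tail of the energy is left. *)
Lemma shift_error g M (F : {fset dyad}) : L1 g ->
  (forall n k, (k < 2 ^ n)%N -> Av g n k = shiftA (Av f) n k) -> (gens M `<=` F)%fset ->
  let w := fun x => g x - shift_psum f F x in L2 w /\ sqn w <= 2 * mvar f M.
Proof.
move=> g1 hg MF w; have w1 : L1 w by apply: L1B => //; exact: L1_psum.
have hw n k : (k < 2 ^ n)%N -> hdif (Av w) n k = sdif (Av f) n k -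
    (if n is m.+1 then has_node F m k./2 else false)%:R * sdif (Av f) n k.
  move=> kn; rewrite AvB_hdif//; last exact: L1_psum.
  by rewrite hdif_psum// -hdif_shiftA /hdif !hg ?doubleS_lt_expn ?double_lt_expn.
have e0 : energy (Av w) 0 = 0 by rewrite /energy lavg0 hw//= mulr0 subrr expr0n.
have eS n : energy (Av w) n.+1 <= 2 * energy (Av f) n.
  rewrite -energy_shiftAS; apply: le_lavg => k kn; rewrite hdif_shiftA hw//.
  case: has_node; first by rewrite mul1r subrr expr0n sqr_ge0.
  by rewrite mul0r subr0.
have ez n : (n < M)%N -> energy (Av w) n.+1 = 0.
  move=> nM; rewrite -(lavg_cst n.+1 0); apply: eq_lavg => k kn; rewrite hw//.
  by rewrite (has_node_gens MF) ?half_lt_expn// mul1r subrr expr0n.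
have b0 : 0 <= 2 * mvar f M by rewrite mulr_ge0// mvar_ge0.
have := @energy_L2 R w (2 * mvar f M) w1.
have -> : Av w 0 0 = 0.
  by rewrite (AvB _ _ g1 (L1_psum f F)) hg//= Av_psum00 subrr.
rewrite expr0n add0r; apply=> N.
apply: (@le_trans _ _ (\sum_(n < (M + N).+1) energy (Av w) n)).
  by apply: ler_sum_ord; [exact: energy_ge0|rewrite leqW// leq_addl].
rewrite big_ord_recl e0 add0r; under eq_bigr do rewrite lift0.
rewrite big_split_ord /= big1 ?add0r; last by move=> i _; rewrite ez.
rewrite (mvar_sum M N f2) mulrDr mulr_sumr ler_wpDr//; first by rewrite mulr_ge0// mvar_ge0.
by apply: ler_sum => i _; exact: eS.
Qed.

(** The shifted array still decays geometrically, so it comes from a function; the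
    partial sums converge to it in [L^2] by [shift_error]. *)
Lemma shift_exists : exists g, is_haar_shift f g.
Proof.
have [g [g1 hg]] := synthesis q_gt1 (@shiftA_mart R (Av f)) shiftA_energy_le.
have eg n : energy (Av g) n = energy (shiftA (Av f)) n.
  apply: eq_lavg => k kn.
  by rewrite /hdif !hg ?doubleS_lt_expn ?double_lt_expn.
have [g2 _] : L2 g /\ sqn g <= Av g 0 0 ^+ 2 + 2 * q * G.
  apply: energy_L2 => // N; apply: (sum_energy_le_weighted q_gt1) => M.
  by under eq_bigr do rewrite eg; exact: shiftA_energy_le.
exists g, 2; first by rewrite ltr1n.
split => //.
have small (e : R) : 0 < e -> \forall F \near summability.totally,
    (Lq_norm 2 (g \- shift_psum f F)%R <= e%:E)%E.
  move=> e0; have [M hM] := mvar_small f2 (divr_gt0 (exprn_gt0 2 e0) (ltr0n R 2)).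
  exists (gens M) => // F /= MF.
  have [w2 hw] := shift_error g1 hg MF.
  rewrite -lee_sqr ?lee_fin ?(ltW e0)//; last exact: Lnorm_ge0.
  rewrite Lq_norm_sqr sqnE// -EFin_expe lee_fin (le_trans hw)//.
  by have := hM M (leqnn M); rewrite ler_pdivlMr// mulrC.
have l0 F : (0 <= Lq_norm 2 (g \- @shift_psum R f F)%R)%E by exact: Lnorm_ge0.
apply/fine_cvgP; split.
  apply: filterS (small 1 ltr01) => F h.
  by rewrite ge0_fin_numE// (le_lt_trans h)// ltry.
apply/cvgrPdist_le => e e0; apply: filterS (small e e0) => F h.
rewrite /= sub0r normrN ger0_norm ?fine_ge0// -lee_fin fineK//.
by rewrite ge0_fin_numE// (le_lt_trans h)// ltry.
Qed.
End Existence.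
End ShiftVersions.

(** * Products and the commutator *)

Section Commutator.
Variables (R : realType) (t : R).
Hypothesis t_gt1 : 1 < t.
Implicit Types (b f g u : R -> R) (n k N m : nat).
Notation mu := (@leb01 R).
Notation L1 f := (mu.-integrable setT (EFin \o f)).
Notation L2 f := (f \in Lfun mu 2%:E).
Notation w := (t ^+ 4).

Let t0 : 0 < t. Proof. exact: lt_trans t_gt1. Qed.
Let w1 : 1 < w. Proof. by rewrite expr_gt1// ltW. Qed.
Let w0 : 0 < w. Proof. exact: lt_trans w1. Qed.
Let wX0 n : 0 <= w ^+ n. Proof. by rewrite exprn_ge0// ltW. Qed.

(** The average of a product is the product of the averages up to a covariance, and
    averages satisfy the discrete product rule. *)
Lemma hdif_mul b g n k : L2 b -> L2 g -> hdif (Av (fun x => b x * g x)) n k =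
  Av b n k * hdif (Av g) n k + Av g n k * hdif (Av b) n k + hdif (Cov b g) n k.
Proof.
move=> hb hg; have mb := Av_mart (L2_L1 hb); have mg := Av_mart (L2_L1 hg).
have E l : Av (fun x => b x * g x) n.+1 l = Av b n.+1 l * Av g n.+1 l + Cov b g n.+1 l.
  by rewrite /Cov; ring.
rewrite {1}/hdif !E (mart_double _ _ mb) (mart_doubleS _ _ mb).
by rewrite (mart_double _ _ mg) (mart_doubleS _ _ mg) /hdif; field.
Qed.

Section Bounded.
Variables (b : R -> R) (m : nat) (K : R).
Hypothesis hb : L2 b.
Hypothesis K0 : 0 <= K.
Hypothesis hK : forall n k, (m <= n)%N -> (k < 2 ^ n)%N -> Var b n k <= K.

(** A symbol of bounded variance turns covariances into variances. *)
Lemma lavg_Cov_le g n : L2 g -> (m <= n)%N -> lavg n (fun k => Cov b g n k ^+ 2) <= K * mvar g n.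
Proof.
move=> hg mn; rewrite -lavg_Var// -lavgZ; apply: le_lavg => k kn.
apply: le_trans (Cov_sqr_le hb hg kn) _.
by rewrite ler_wpM2r ?Var_ge0// hK.
Qed.

Lemma lavg_hdif_Cov_le g n : L2 g -> (m <= n.+1)%N ->
  lavg n (fun k => hdif (Cov b g) n k ^+ 2) <= K * mvar g n.+1.
Proof.
move=> hg mn; apply: le_trans (lavg_Cov_le hg mn).
rewrite lavgS; apply: le_lavg => k _; rewrite /hdif.
move: (Cov _ _ _ _) (Cov _ _ _ _) => x y.
rewrite -subr_ge0; set e := (X in 0 <= X).
by rewrite (_ : e = ((x + y) / 2) ^+ 2) ?sqr_ge0// /e; field.
Qed.

Lemma hdif_sqr_le n k : (m <= n)%N -> (k < 2 ^ n)%N -> hdif (Av b) n k ^+ 2 <= K.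
Proof.
move=> mn kn; apply: le_trans (hK mn kn); rewrite (Var_rec _ _ hb) lerDl.
by rewrite divr_ge0// addr_ge0// Var_ge0// ?doubleS_lt_expn ?double_lt_expn.
Qed.
End Bounded.

(** The energy of generation [n] of the paraproduct of [b] with the averages [X]. *)
Definition cross b (X : nat -> nat -> R) n := lavg n (fun k => (X n k * hdif (Av b) n k) ^+ 2).

Lemma cross_ge0 b X n : 0 <= cross b X n.
Proof. by apply: lavg_ge0 => k _; exact: sqr_ge0. Qed.

Lemma sum_cross_le b X m kappa Gam N : 0 <= kappa -> carleson t kappa (coefw t m b) ->
  mart X -> 0 < Gam ->
  (forall N, X 0 0 ^+ 2 + \sum_(n < N) w ^+ n * energy X n <= Gam) ->
  \sum_(n < N) (m <= n)%:R * (w ^+ n * cross b X n) <= Cemb t * kappa * Gam.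
Proof.
move=> k0 car mX G0 XG.
apply: le_trans (carleson_embedding t_gt1 k0 (@coefw_ge0 _ _ t_gt1 m b) car mX G0 (XG N)).
apply: (@le_trans _ _ (\sum_(n < N.+1) (m <= n)%:R * (w ^+ n * cross b X n))).
  apply: (ler_sum_ord (u := fun n => (m <= n)%:R * (w ^+ n * cross b X n))) => // n.
  by apply: mulr_ge0 => //; rewrite mulr_ge0 ?cross_ge0.
apply: ler_sum => n _; rewrite /cross /lavg !mulr_sumr; apply: ler_sum => k _.
rewrite /coefw le_eqVlt; apply/orP; left; apply/eqP.
by case: (m <= n)%N; rewrite ?mul1r ?mul0r//; ring.
Qed.

Section Estimate.
Variables (b f g u : R -> R) (h : R -> R) (Gam : R).
Hypothesis hb : L2 b.
Hypothesis hf : L2 f.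
Hypothesis hg : L2 g.
Hypothesis hh : L1 h.
Hypothesis gE : forall n k, (k < 2 ^ n)%N -> Av g n k = shiftA (Av f) n k.
Hypothesis hE : forall n k, (k < 2 ^ n)%N ->
  Av h n k = shiftA (Av (fun x => b x * f x)) n k.
Hypothesis uE : u = fun x => b x * g x - h x.
Hypothesis G0 : 0 < Gam.
Hypothesis fG : forall N, Av f 0 0 ^+ 2 + \sum_(n < N) w ^+ n * energy (Av f) n <= Gam.

Let fG' N : \sum_(n < N) w ^+ n * energy (Av f) n <= Gam.
Proof. by apply: le_trans (fG N); rewrite lerDr sqr_ge0. Qed.

Let gG' N : \sum_(n < N) w ^+ n * energy (Av g) n <= 2 * w * Gam.
Proof.
apply: le_trans (shiftA_energy_le w1 fG' N); apply: ler_sum => n _.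
rewrite ler_wpM2l// le_eqVlt; apply/orP; left; apply/eqP; apply: eq_lavg => k kn.
by rewrite /hdif !gE ?doubleS_lt_expn ?double_lt_expn.
Qed.

Let G1 : 0 < 2 * w * Gam. Proof. by rewrite !mulr_gt0. Qed.

Let gG N : Av g 0 0 ^+ 2 + \sum_(n < N) w ^+ n * energy (Av g) n <= 2 * w * Gam.
Proof. by rewrite (@gE 0%N 0%N)//= expr0n /= add0r; exact: gG'. Qed.

Let bg1 : L1 (fun x => b x * g x). Proof. exact: L2M. Qed.

Lemma Av_commutator00 : Av u 0 0 = Cov b g 0 0.
Proof. by rewrite uE AvB// hE// /Cov (@gE 0%N 0%N)//= mulr0. Qed.

Lemma hdif_commutator0 : hdif (Av u) 0 0 = hdif (Cov b g) 0 0.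
Proof.
rewrite uE AvB_hdif// hdif_mul// /hdif !gE// !hE//=.
by rewrite !(expr0, expr1, mulr0, addr0, subrr, mul0r) add0r subr0.
Qed.

(** The average of [b] on an interval in the first product and on its parent in
    the second differ by a jump, which yields the first term. *)
Lemma hdif_commutatorS n k : (k < 2 ^ n.+1)%N ->
  hdif (Av u) n.+1 k =
    sqrt2 R * (hdif (Av f) n k./2 * hdif (Av b) n k./2)
    + Av g n.+1 k * hdif (Av b) n.+1 k + hdif (Cov b g) n.+1 k
    - (-1) ^+ odd k * sqrt2 R * (Av f n k./2 * hdif (Av b) n k./2)
    - (-1) ^+ odd k * sqrt2 R * hdif (Cov b f) n k./2.
Proof.
move=> kn; have mb := Av_mart (L2_L1 hb).
have e1 : hdif (Av g) n.+1 k = (-1) ^+ odd k * sqrt2 R * hdif (Av f) n k./2.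
  by rewrite -[RHS]/(sdif (Av f) n.+1 k) -hdif_shiftA /hdif !gE ?doubleS_lt_expn
    ?double_lt_expn.
have e2 : hdif (Av h) n.+1 k = (-1) ^+ odd k * sqrt2 R *
    hdif (Av (fun x => b x * f x)) n k./2.
  by rewrite -[RHS]/(sdif (Av (fun x => b x * f x)) n.+1 k) -hdif_shiftA /hdif !hE
    ?doubleS_lt_expn ?double_lt_expn.
have e3 : Av b n.+1 k = Av b n k./2 + (-1) ^+ odd k * hdif (Av b) n k./2.
  rewrite -[in LHS](odd_double_half k); case: (odd k); rewrite ?add1n ?add0n.
    by rewrite (mart_doubleS _ _ mb) expr1 mulN1r.
  by rewrite (mart_double _ _ mb) expr0 mul1r.
rewrite uE AvB_hdif// hdif_mul// e1 e2 hdif_mul// e3.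
by case: (odd k); rewrite /= ?expr0 ?expr1; ring.
Qed.

(** The square of a sum of five terms is at most five times the sum of the
    squares. *)
Lemma energy_commutatorS n : energy (Av u) n.+1 <=
  5 * (2 * cross b (hdif (Av f)) n + cross b (Av g) n.+1
       + lavg n.+1 (fun k => hdif (Cov b g) n.+1 k ^+ 2)
       + 2 * cross b (Av f) n + 2 * lavg n (fun k => hdif (Cov b f) n k ^+ 2)).
Proof.
rewrite /cross -!lavgZ -!(lavg_half n) -!lavgD -lavgZ; apply: le_lavg => k kn.
rewrite hdif_commutatorS//.
have s2 := sqrt2_sqr R; move: (sqrt2 R) s2 => r s2.
set x1 := hdif (Av f) n _ * _; set x2 := Av g _ _ * _; set x3 := hdif (Cov b g) _ _.
set x4 := Av f _ _ * _; set x5 := hdif (Cov b f) _ _.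
clearbody x1 x2 x3 x4 x5.
have e2 : ((-1) ^+ odd k : R) ^+ 2 = 1 by exact: sqrr_sign.
move: ((-1) ^+ odd k : R) e2 => e e2.
have -> : 2 * x1 ^+ 2 = (r * x1) ^+ 2 by rewrite exprMn s2.
have -> : 2 * x4 ^+ 2 = (e * r * x4) ^+ 2 by rewrite !exprMn s2 e2 mul1r.
have -> : 2 * x5 ^+ 2 = (e * r * x5) ^+ 2 by rewrite !exprMn s2 e2 mul1r.
move: (r * x1) (e * r * x4) (e * r * x5) => {x1 x4 x5}x1 x4 x5.
rewrite -subr_ge0; set d := (X in 0 <= X).
rewrite (_ : d = (x1 - x2) ^+ 2 + (x1 - x3) ^+ 2 + (x1 + x4) ^+ 2 + (x1 + x5) ^+ 2 +
  (x2 - x3) ^+ 2 + (x2 + x4) ^+ 2 + (x2 + x5) ^+ 2 + (x3 + x4) ^+ 2 + (x3 + x5) ^+ 2 +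
  (x4 - x5) ^+ 2); last by rewrite /d; ring.
by rewrite !addr_ge0 ?sqr_ge0.
Qed.

Definition Ctail : R := 20 * w * (Cvar t + Cemb t + Cvar t * Cmvar w).

(** The part of the commutator at generations finer than [m] sees only the part
    of the symbol at generations at least [m]. *)
Lemma commutator_tail m kappa N : 0 <= kappa -> carleson t kappa (coefw t m b) ->
  \sum_(n < N) (m <= n)%:R * (w ^+ n.+1 * energy (Av u) n.+1) <= Ctail * kappa * Gam.
Proof.
move=> k0 car.
pose K := Cvar t * kappa; have K0 : 0 <= K by rewrite mulr_ge0// Cvar_ge0.
have hK n k : (m <= n)%N -> (k < 2 ^ n)%N -> Var b n k <= K.
  by move=> mn kn; exact: (Var_le t_gt1 hb k0 car mn kn).
pose i n : R := (m <= n)%:R.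
have i01 n : 0 <= i n <= 1 by rewrite /i; case: (m <= n)%N => /=; rewrite ?lexx ?ler01.
pose rhs n := 5 * (2 * K * w * (w ^+ n * energy (Av f) n)
    + i n.+1 * (w ^+ n.+1 * cross b (Av g) n.+1)
    + K * (w ^+ n.+1 * mvar g n.+1)
    + 2 * w * (i n * (w ^+ n * cross b (Av f) n))
    + 2 * K * w * (w ^+ n * mvar f n)).
have H n : i n * (w ^+ n.+1 * energy (Av u) n.+1) <= rhs n.
  have vg := mvar_ge0 n.+1 hg; have vf := mvar_ge0 n hf.
  have ef := energy_ge0 (Av f) n.
  have c1 := cross_ge0 b (Av g) n.+1; have c2 := cross_ge0 b (Av f) n.
  have wn := wX0 n; have w0' := ltW w0.
  rewrite /rhs /i; case: (leqP m n) => mn; last first.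
    rewrite !mul0r; apply: mulr_ge0 => //; rewrite !mulr0 addr0.
    by do ![assumption | exact: wX0 | exact: ler0n | apply: addr_ge0 | apply: mulr_ge0].
  rewrite (leqW mn) !mul1r.
  apply: le_trans (ler_wpM2l (wX0 _) (energy_commutatorS n)) _.
  have h1 : cross b (hdif (Av f)) n <= K * energy (Av f) n.
    rewrite /cross -lavgZ; apply: le_lavg => k kn.
    by rewrite exprMn mulrC ler_wpM2r ?sqr_ge0// (hdif_sqr_le hb hK).
  have h2 := lavg_hdif_Cov_le hb hK hg (leqW (leqW mn)).
  have h3 := lavg_hdif_Cov_le hb hK hf (leqW mn).
  have v1 := ler_wpM2l K0 (mvar_le hg (leqnSn n.+1)).
  have v2 := ler_wpM2l K0 (mvar_le hf (leqnSn n)).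
  rewrite mulrCA ler_wpM2l// exprS.
  move: h1 h2 h3 v1 v2.
  set a1 := cross b (hdif _) n; set a2 := cross b (Av g) _; set a3 := lavg n.+1 _.
  set a4 := cross b (Av f) n; set a5 := lavg n _; move: (w ^+ n) wn => v v0.
  move=> h1 h2 h3 l1 l2.
  apply: (@le_trans _ _ (w * v * (2 * (K * energy (Av f) n) + a2 + K * mvar g n.+1 + 2 * a4 +
     2 * (K * mvar f n)))).
    by apply: ler_wpM2l; [exact: mulr_ge0|lra].
  by rewrite le_eqVlt; apply/orP; left; apply/eqP; ring.
have shift (v : nat -> R) : (forall n, 0 <= v n) ->
    \sum_(n < N) v n.+1 <= \sum_(n < N.+1) v n.
  by move=> v0; rewrite big_ord_recl lerDr.
apply: (@le_trans _ _ (\sum_(n < N) rhs n)); first by apply: ler_sum => n _; exact: H.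
rewrite /rhs -mulr_sumr !big_split /= -!mulr_sumr.
have S1 := fG' N.
have S2 := le_trans (shift (fun n => i n * (w ^+ n * cross b (Av g) n))
  (fun n => mulr_ge0 (proj1 (andP (i01 n))) (mulr_ge0 (wX0 n) (cross_ge0 b _ n))))
  (sum_cross_le N.+1 k0 car (Av_mart (L2_L1 hg)) G1 gG).
have S3 := le_trans (shift (fun n => w ^+ n * mvar g n)
  (fun n => mulr_ge0 (wX0 n) (mvar_ge0 n hg))) (sum_mvar_le w1 N.+1 hg gG').
have S4 := sum_cross_le N k0 car (Av_mart (L2_L1 hf)) G0 fG.
have S5 := sum_mvar_le w1 N hf fG'.
have w0' := ltW w0; have C0 := Cvar_ge0 t_gt1.
have Kw : 0 <= 2 * K * w by do 2 apply: mulr_ge0 => //.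
have w20 : 0 <= 2 * w by apply: mulr_ge0.
have := ler_wpM2l Kw S1; have := ler_wpM2l K0 S3; have := ler_wpM2l w20 S4.
have := ler_wpM2l Kw S5; move: S2.
set s1 := \sum_(n < N) w ^+ n * energy _ _; set s2 := \sum_(n < N) i n.+1 * _.
set s3 := \sum_(n < N) w ^+ n.+1 * _; set s4 := \sum_(n < N) _ * (_ * cross _ _ _).
set s5 := \sum_(n < N) w ^+ n * mvar _ _.
move=> S2' S5' S4' S3' S1'.
have pos : 0 <= 10 * w * (Cvar t * kappa) * Gam.
  by apply: mulr_ge0; [do 2 apply: mulr_ge0 => //; exact: mulr_ge0|exact: ltW].
apply: (@le_trans _ _ (5 * (2 * K * w * Gam + Cemb t * kappa * (2 * w * Gam) +
  K * (Cmvar w * (2 * w * Gam)) + 2 * w * (Cemb t * kappa * Gam) + 2 * K * w * (Cmvar w * Gam)))).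
  by rewrite ler_wpM2l// !lerD.
rewrite -subr_ge0; set d := (X in 0 <= X).
by rewrite (_ : d = 10 * w * (Cvar t * kappa) * Gam)// /d /Ctail /K; ring.
Qed.

Lemma commutator_mean kappa : 0 <= kappa -> carleson t kappa (coefw t 0 b) ->
  Av u 0 0 ^+ 2 <= 2 * w * Cvar t * kappa * Gam.
Proof.
move=> k0 car.
have K0 : 0 <= Cvar t * kappa by rewrite mulr_ge0// Cvar_ge0.
have hK n k : (0 <= n)%N -> (k < 2 ^ n)%N -> Var b n k <= Cvar t * kappa.
  by move=> mn kn; exact: (Var_le t_gt1 hb k0 car mn kn).
have := lavg_Cov_le hb hK hg (leqnn 0); rewrite lavg0 Av_commutator00.
have := ler_wpM2l K0 (weighted_mvar_le w1 0 hg gG').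
by rewrite expr0 mul1r; lra.
Qed.

Lemma commutator_top kappa : 0 <= kappa -> carleson t kappa (coefw t 0 b) ->
  energy (Av u) 0 <= 2 * w * Cvar t * kappa * Gam.
Proof.
move=> k0 car.
have K0 : 0 <= Cvar t * kappa by rewrite mulr_ge0// Cvar_ge0.
have hK n k : (0 <= n)%N -> (k < 2 ^ n)%N -> Var b n k <= Cvar t * kappa.
  by move=> mn kn; exact: (Var_le t_gt1 hb k0 car mn kn).
have := lavg_hdif_Cov_le hb hK hg (leq0n 1).
rewrite /energy !lavg0 hdif_commutator0.
have := ler_wpM2l K0 (weighted_mvar_le w1 0 hg gG').
have := ler_wpM2l K0 (mvar_le hg (leq0n 1)).
by rewrite expr0 mul1r; lra.
Qed.

Definition Ccom : R := Ctail + 2 * w * Cvar t.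

Lemma commutator_energy kappa N : 0 <= kappa -> carleson t kappa (coefw t 0 b) ->
  \sum_(n < N) w ^+ n * energy (Av u) n <= Ccom * kappa * Gam.
Proof.
move=> k0 car.
apply: (@le_trans _ _ (\sum_(n < N.+1) w ^+ n * energy (Av u) n)).
  apply: (ler_sum_ord (u := fun n => w ^+ n * energy (Av u) n)) => // n.
  by rewrite mulr_ge0 ?energy_ge0.
rewrite big_ord_recl expr0 mul1r /Ccom.
have := commutator_top k0 car.
have := commutator_tail N k0 car.
under eq_bigr do rewrite leq0n mul1r.
under [X in _ -> _ -> _ + X <= _]eq_bigr do rewrite lift0.
by lra.
Qed.
End Estimate.
End Commutator.

(** * Boundedness *)

Section Boundedness.
Variables (R : realType) (t : R).
Hypothesis t_gt1 : 1 < t.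
Implicit Types (b f g u : R -> R) (n k N m : nat).
Notation mu := (@leb01 R).
Notation L1 f := (mu.-integrable setT (EFin \o f)).
Notation L2 f := (f \in Lfun mu 2%:E).
Notation w := (t ^+ 4).

Let t0 : 0 < t. Proof. exact: lt_trans t_gt1. Qed.
Let w1 : 1 < w. Proof. by rewrite expr_gt1// ltW. Qed.
Let w0 : 0 < w. Proof. exact: lt_trans w1. Qed.

(** A symbol with bounded jumps grows at most linearly in the generation, hence
    less than any geometric sequence. *)
Lemma Av_growth b K : mart (Av b) -> 0 <= K ->
  (forall n k, (k < 2 ^ n)%N -> `|hdif (Av b) n k| <= K) ->
  exists2 D, 0 <= D & forall n k, (k < 2 ^ n)%N -> `|Av b n k| <= D * t ^+ n.
Proof.
move=> mb K0 hK; have t1 : 0 < t - 1 by rewrite subr_gt0.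
pose D := `|Av b 0 0| + K / (t - 1); have D0 : 0 <= D.
  by rewrite addr_ge0// divr_ge0// ltW.
have DK : K <= D * (t - 1).
  by rewrite /D mulrDl mulfVK ?gt_eqF// lerDr mulr_ge0// ltW.
exists D => //; elim=> [|n IH] k.
  rewrite expn0 ltnS leqn0 => /eqP ->; rewrite expr0 mulr1 /D lerDl.
  by rewrite divr_ge0// ltW.
move=> /half_lt_expn kn.
have step : `|Av b n k./2| + K <= D * t ^+ n.+1.
  apply: le_trans (lerD (IH _ kn) DK) _.
  have tn : 1 <= t ^+ n by rewrite exprn_ege1// ltW.
  have : D * (t - 1) <= D * (t - 1) * t ^+ n by rewrite ler_peMr// mulr_ge0// ltW.
  by rewrite exprS; lra.
apply: le_trans step; apply: le_trans (lerD (lexx _) (hK _ _ kn)).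
rewrite -[in leLHS](odd_double_half k); case: (odd k); rewrite ?add1n ?add0n.
  by rewrite (mart_doubleS _ _ mb) ler_normB.
by rewrite (mart_double _ _ mb) ler_normD.
Qed.

(** Of the weight [t ^+ 4] per generation, the growth of the averages of [b]
    consumes [t ^+ 2] in the squares. *)
Lemma mul_energy b f kappa Gam : L2 b -> L2 f -> 0 <= kappa ->
  carleson t kappa (coefw t 0 b) -> 0 < Gam ->
  (forall N, Av f 0 0 ^+ 2 + \sum_(n < N) w ^+ n * energy (Av f) n <= Gam) ->
  exists G, forall N,
    \sum_(n < N) (t ^+ 2) ^+ n * energy (Av (fun x => b x * f x)) n <= G.
Proof.
move=> hb hf k0 car G0 fG.
have fG' N : \sum_(n < N) w ^+ n * energy (Av f) n <= Gam.
  by apply: le_trans (fG N); rewrite lerDr sqr_ge0.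
pose K := Cvar t * kappa; have K0 : 0 <= K by rewrite mulr_ge0// Cvar_ge0.
have hK n k : (0 <= n)%N -> (k < 2 ^ n)%N -> Var b n k <= K.
  by move=> mn kn; exact: (Var_le t_gt1 hb k0 car mn kn).
have [D D0 hD] : exists2 D, 0 <= D & forall n k, (k < 2 ^ n)%N -> `|Av b n k| <= D * t ^+ n.
  apply: (@Av_growth b (Num.sqrt K)); [exact/Av_mart/L2_L1|exact: sqrtr_ge0|].
  move=> n k kn; rewrite -[leLHS]sqrtr_sqr -ler_sqr ?nnegrE ?sqrtr_ge0//.
  by rewrite !sqr_sqrtr ?sqr_ge0// ?(hdif_sqr_le hb hK)// real_normK ?num_real//.
pose A n := lavg n (fun k => (Av b n k * hdif (Av f) n k) ^+ 2).
pose C n := lavg n (fun k => hdif (Cov b f) n k ^+ 2).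
have e3 n : energy (Av (fun x => b x * f x)) n <= 3 * (A n + cross b (Av f) n + C n).
  rewrite /A /C /cross -!lavgD -lavgZ; apply: le_lavg => k _; rewrite hdif_mul//.
  set x := Av b n k * hdif (Av f) n k; set y := Av f n k * hdif (Av b) n k.
  set z := hdif (Cov b f) n k; clearbody x y z.
  rewrite -subr_ge0; set d := (X in 0 <= X).
  rewrite (_ : d = (x - y) ^+ 2 + (x - z) ^+ 2 + (y - z) ^+ 2); last by rewrite /d; ring.
  by rewrite !addr_ge0 ?sqr_ge0.
have tw n : (t ^+ 2) ^+ n <= w ^+ n.
  rewrite -!exprM; apply: ler_weXn2l; first exact: ltW.
  by rewrite leq_mul2r orbT.
have tn0 n : 0 <= (t ^+ 2) ^+ n by rewrite !exprn_ge0// ltW.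
have wn0 n : 0 <= w ^+ n by rewrite exprn_ge0// ltW.
have hA n : (t ^+ 2) ^+ n * A n <= D ^+ 2 * (w ^+ n * energy (Av f) n).
  rewrite (_ : w ^+ n = (t ^+ 2) ^+ n * (t ^+ n) ^+ 2); last first.
    by rewrite -!exprM -exprD [(n * 2)%N]mulnC -mulnDl.
  rewrite [leRHS](_ : _ = (t ^+ 2) ^+ n * ((D * t ^+ n) ^+ 2 * energy (Av f) n)); last first.
    by rewrite exprMn; ring.
  rewrite ler_wpM2l// -lavgZ; apply: le_lavg => k kn.
  rewrite exprMn ler_wpM2r ?sqr_ge0// -[leLHS]real_normK ?num_real//.
  by rewrite ler_sqr ?nnegrE ?mulr_ge0 ?exprn_ge0 ?(ltW t0)// hD.
have hC n : (t ^+ 2) ^+ n * C n <= K * (w ^+ n * mvar f n).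
  apply: (@le_trans _ _ (w ^+ n * (K * mvar f n))); last by rewrite mulrCA.
  apply: ler_pM => //; first by apply: lavg_ge0 => k _; exact: sqr_ge0.
  apply: le_trans (lavg_hdif_Cov_le hb hK hf (leq0n _)) _.
  by rewrite ler_wpM2l// mvar_le.
have hX n : (t ^+ 2) ^+ n * cross b (Av f) n <= w ^+ n * cross b (Av f) n.
  by rewrite ler_wpM2r// cross_ge0.
exists (3 * (D ^+ 2 * Gam + Cemb t * kappa * Gam + K * (Cmvar w * Gam))) => N.
pose rhs n := 3 * (D ^+ 2 * (w ^+ n * energy (Av f) n)
  + w ^+ n * cross b (Av f) n + K * (w ^+ n * mvar f n)).
apply: (@le_trans _ _ (\sum_(n < N) rhs n)).
  apply: ler_sum => n _; apply: le_trans (ler_wpM2l (tn0 n) (e3 n)) _.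
  rewrite /rhs mulrCA ler_wpM2l// [leLHS]mulrDr [X in X + _ <= _]mulrDr.
  by apply: lerD; [apply: lerD; [exact: hA|exact: hX]|exact: hC].
rewrite /rhs -mulr_sumr !big_split /= -!mulr_sumr ler_wpM2l//.
apply: lerD; first apply: lerD.
- by apply: ler_wpM2l; [exact: sqr_ge0|exact: fG'].
- apply: le_trans (sum_cross_le t_gt1 N k0 car (Av_mart (L2_L1 hf)) G0 fG).
  by apply: ler_sum => n _; rewrite leq0n mul1r.
- rewrite ler_wpM2l//; exact: sum_mvar_le.
Qed.
End Boundedness.

Section CommutatorFunction.
Variables (R : realType) (s : R).
Hypothesis s_gt0 : 0 < s.
Implicit Types (b f g u : R -> R) (n k N m : nat).
Notation mu := (@leb01 R).
Notation L1 f := (mu.-integrable setT (EFin \o f)).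
Notation L2 f := (f \in Lfun mu 2%:E).
Notation t := (scale s).
Notation w := (t ^+ 4).

Let t1 : 1 < t. Proof. exact: scale_gt1. Qed.
Let t0 : 0 < t. Proof. exact: lt_trans t1. Qed.
Let w1 : 1 < w. Proof. by rewrite expr_gt1// ltW. Qed.

Lemma Ctail_ge0 : 0 <= Ctail t.
Proof.
have C1 := Cvar_ge0 t1; have C2 := Cemb_ge0 t1; have C3 := Cmvar_ge0 w1.
have w0 : 0 <= w by rewrite exprn_ge0// ltW.
by do ![assumption | exact: ler0n | apply: addr_ge0 | apply: mulr_ge0].
Qed.

Lemma Ccom_ge0 : 0 <= Ccom t.
Proof.
have C1 := Cvar_ge0 t1; have w0 : 0 <= w by rewrite exprn_ge0// ltW.
by do ![exact: Ctail_ge0 | assumption | exact: ler0n | apply: addr_ge0 | apply: mulr_ge0].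
Qed.

Lemma haar_shiftP f : haar_shiftable f -> is_haar_shift f (haar_shift f).
Proof. by move=> [g hg]; exact: (xgetPex (fun=> 0) (ex_intro _ g hg)). Qed.

Section Fixed.
Variables (b f : R -> R) (kappa Gam : R).
Hypothesis b1 : L1 b.
Hypothesis k0 : 0 <= kappa.
Hypothesis car : carleson t kappa (coefw t 0 b).
Hypothesis f2 : L2 f.
Hypothesis G0 : 0 < Gam.
Hypothesis fG : forall N, Av f 0 0 ^+ 2 + \sum_(n < N) w ^+ n * energy (Av f) n <= Gam.

Let b2 : L2 b. Proof. exact: carleson_L2 car. Qed.

Let fG' N : \sum_(n < N) w ^+ n * energy (Av f) n <= Gam.
Proof. by apply: le_trans (fG N); rewrite lerDr sqr_ge0. Qed.

Lemma shiftable_arg : haar_shiftable f.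
Proof. exact: shift_exists w1 f2 fG'. Qed.

Lemma shiftable_mul : haar_shiftable (b \* f).
Proof.
have [G hG] := mul_energy t1 b2 f2 k0 car G0 fG.
have t21 : 1 < t ^+ 2 by rewrite expr_gt1// ltW.
have [bf2 _] := energy_L2 (L2M b2 f2) (sum_energy_le_weighted t21 hG).
exact: (shift_exists t21 bf2 hG).
Qed.

Let g := haar_shift f.
Let h := haar_shift (b \* f).

Let shift_facts : [/\ L2 g, L1 h,
  forall n k, (k < 2 ^ n)%N -> Av g n k = shiftA (Av f) n k &
  forall n k, (k < 2 ^ n)%N -> Av h n k = shiftA (Av (fun x => b x * f x)) n k].
Proof.
have [_ g1 gE] := shift_averages (haar_shiftP shiftable_arg).
have [_ h1 hE] := shift_averages (haar_shiftP shiftable_mul).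
split => //.
have eg n : energy (Av g) n = energy (shiftA (Av f)) n.
  by apply: eq_lavg => k kn; rewrite /hdif !gE ?doubleS_lt_expn ?double_lt_expn.
apply: (proj1 (@energy_L2 R g (2 * w * Gam) g1 _)).
apply: (sum_energy_le_weighted w1) => M.
by under eq_bigr do rewrite eg; exact: shiftA_energy_le.
Qed.

Let uE : commutator b f = fun x => b x * g x - h x.
Proof. by []. Qed.

Lemma commutator_L1 : L1 (commutator b f).
Proof. by have [g2 h1 _ _] := shift_facts; rewrite uE; apply: L1B => //; exact: L2M. Qed.

Lemma commutator_bounds : Av (commutator b f) 0 0 ^+ 2 <= Ccom t * kappa * Gam /\
  forall N, \sum_(n < N) w ^+ n * energy (Av (commutator b f)) n <= Ccom t * kappa * Gam.
Proof.
have [g2 h1 gE hE] := shift_facts; split=> [|N].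
  apply: le_trans (commutator_mean t1 b2 g2 h1 gE hE uE fG k0 car) _.
  by rewrite ler_wpM2r ?(ltW G0)// ler_wpM2r// /Ccom lerDr Ctail_ge0.
exact: (commutator_energy t1 b2 f2 g2 h1 gE hE uE G0 fG N k0 car).
Qed.

Lemma commutator_fine m e N : 0 <= e -> carleson t e (coefw t m b) ->
  \sum_(n < N) (m <= n)%:R * (w ^+ n.+1 * energy (Av (commutator b f)) n.+1) <=
  Ctail t * e * Gam.
Proof.
have [g2 h1 gE hE] := shift_facts.
exact: (commutator_tail t1 b2 f2 g2 h1 gE hE uE G0 fG N).
Qed.

Lemma commutator_Hs : Hs s (commutator b f) /\
  (Hs_sqnorm s (commutator b f) <= (3 * Ccom t * kappa * Gam)%:E)%E.
Proof.
have [h1 h2] := commutator_bounds.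
have [h3 h4] := Hs_intro s_gt0 commutator_L1 h2; split => //.
by apply: le_trans h4 _; rewrite lee_fin; lra.
Qed.
End Fixed.

Lemma Hs_norm_bounds f M : Hs s f -> (Hs_norm s f <= M%:E)%E ->
  (forall N, Av f 0 0 ^+ 2 + \sum_(n < N) w ^+ n * energy (Av f) n <= M ^+ 2).
Proof.
move=> hf hM N; have [_ [G GE HG]] := Hs_bounds hf.
apply: le_trans (HG N) _; rewrite -lee_fin -GE -(sqr_sqrte (Hs_sqnorm_ge0 s f)).
rewrite EFin_expe lee_sqr ?sqrte_ge0//.
exact: le_trans (sqrte_ge0 _) hM.
Qed.

Lemma Hs_pos_bound f : Hs s f -> exists2 G, 0 < G &
  forall N, Av f 0 0 ^+ 2 + \sum_(n < N) w ^+ n * energy (Av f) n <= G.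
Proof.
move=> /Hs_bounds[_ [G _ HG]]; exists (`|G| + 1); first by rewrite ltr_wpDl.
by move=> N; apply: le_trans (HG N) _; apply: le_trans (ler_norm G) _; rewrite lerDl.
Qed.

Lemma commutator_defined_BMO b : BMOs s b -> commutator_defined s b.
Proof.
move=> /(BMO_carleson s_gt0)[beta [beta0 _ b1 car]] f hf.
have [f2 _] := Hs_bounds hf; have [G G0 fG] := Hs_pos_bound hf.
split; first exact: shiftable_arg f2 fG.
exact: (shiftable_mul b1 (sqr_ge0 beta) car f2 G0 fG).
Qed.

Lemma commutator_Hs_stable b f : BMOs s b -> Hs s f -> Hs s (commutator b f).
Proof.
move=> /(BMO_carleson s_gt0)[beta [beta0 _ b1 car]] hf.
have [f2 _] := Hs_bounds hf; have [G G0 fG] := Hs_pos_bound hf.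
by have [] := commutator_Hs b1 (sqr_ge0 beta) car f2 G0 fG.
Qed.

Lemma commutator_opnorm b : BMOs s b ->
  (Hs_opnorm s (commutator b) <= (Num.sqrt (3 * Ccom t) + 1)%:E * BMOs_norm s b)%E.
Proof.
move=> hb; have [beta [beta0 bE b1 car]] := BMO_carleson s_gt0 hb.
apply: ge_ereal_sup => _ [f [hf f1] <-].
have fG := Hs_norm_bounds hf f1; rewrite expr1n in fG.
have [f2 _] := Hs_bounds hf.
have [_ h] := commutator_Hs b1 (sqr_ge0 beta) car f2 ltr01 fG.
rewrite bE -EFinM; apply: (@le_trans _ _ (sqrte ((3 * Ccom t) * beta ^+ 2)%:E)).
  by rewrite lee_sqrt ?lee_fin ?mulr_ge0 ?Ccom_ge0 ?sqr_ge0//; move: h; rewrite mulr1.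
rewrite /= lee_fin sqrtrM ?mulr_ge0 ?Ccom_ge0// sqrtr_sqr ger0_norm//.
by rewrite ler_wpM2r// lerDl.
Qed.
End CommutatorFunction.

(** * Compactness *)

Section UltraLimit.
Variable R : realType.

(** Limits along an ultrafilter refining convergence at infinity exist for all
    bounded sequences at once, which avoids a diagonal extraction. *)
Lemma ultra_limit (U : set_system nat) (a : nat -> R) (B : R) : UltraFilter U ->
  (forall n, `|a n| <= B) -> exists l : R, a n @[n --> U] --> l.
Proof.
move=> UU aB; have PU : ProperFilter U by exact: ultra_proper.
have cB : fmap a U `[- B, B]%classic.
  suff E : a @^-1` `[- B, B]%classic = setT by rewrite /fmap /= E; exact: filterT.
  by apply/seteqP; split=> // n _ /=; rewrite in_itv /= -ler_norml; exact: aB.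
have [l [_ hl]] := @segment_compact R (- B) B (fmap a U) _ cB.
exists l; apply/cvgrPdist_lt => e e0.
have [//|hn] := in_ultra_setVsetC [set n | `|l - a n| < e] UU.
have nb : nbhs l (ball l e) by exact: nbhsx_ballx.
have [x [/= h1 h2]] := hl [set x | ~ `|l - x| < e] _ hn nb.
by exfalso; exact: h1.
Qed.

Lemma cvg_sumr (T I : Type) (F : set_system T) {FF : Filter F} (r : seq I)
    (a : I -> T -> R) (l : I -> R) : (forall i, a i x @[x --> F] --> l i) ->
  (\sum_(i <- r) a i x) @[x --> F] --> \sum_(i <- r) l i.
Proof.
move=> al; elim: r => [|i r IH].
  by rewrite big_nil; under eq_fun do rewrite big_nil; exact: cvg_cst.
rewrite big_cons; under eq_fun do rewrite big_cons.
by apply: cvgD => //; exact: al.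
Qed.
End UltraLimit.

Section Compactness.
Variables (R : realType) (s : R).
Hypothesis s_gt0 : 0 < s.
Implicit Types (b f g u : R -> R) (n k N m : nat).
Notation mu := (@leb01 R).
Notation L1 f := (mu.-integrable setT (EFin \o f)).
Notation L2 f := (f \in Lfun mu 2%:E).
Notation t := (scale s).
Notation w := (t ^+ 4).

Let t1 : 1 < t. Proof. exact: scale_gt1. Qed.
Let t0 : 0 < t. Proof. exact: lt_trans t1. Qed.
Let w1 : 1 < w. Proof. by rewrite expr_gt1// ltW. Qed.
Let wX0 n : 0 <= w ^+ n. Proof. by rewrite exprn_ge0// exprn_ge0// ltW. Qed.

Lemma norm_Av_L2 f M n k : L2 f -> sqn f <= M -> `|Av f n k| <= 2 ^+ n * (1 + M).
Proof.
move=> f2 fM; have f1 := L2_L1 f2.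
apply: le_trans (norm_Av_le _ _ f1) _; rewrite ler_wpM2l ?exprn_ge0//.
have i1 := @L1_cst R 1; have i2 := L2_sqr f2.
apply: le_trans (_ : \int[mu]_x (1 + f x ^+ 2) <= _).
  apply: le_Rintegral => //; first exact: integrable_norm f1.
    exact: L1D.
  move=> x _; rewrite -[f x ^+ 2]real_normK ?num_real//.
  by have := sqr_ge0 (`|f x| - 2^-1); nra.
rewrite RintegralD// Rintegral_cst//= leb01T /= mulr1 lerD2l//.
Qed.

Lemma energy_sub_le X Y Z n :
  (forall k, (k < 2 ^ n)%N -> hdif Z n k = hdif X n k - hdif Y n k) ->
  energy Z n <= 2 * energy X n + 2 * energy Y n :> R.
Proof.
move=> hZ; rewrite -!lavgZ -lavgD; apply: le_lavg => k kn; rewrite hZ//.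
by have := sqr_ge0 (hdif X n k + hdif Y n k); lra.
Qed.

Lemma sum_split m N (a : nat -> R) : (forall n, 0 <= a n) ->
  \sum_(n < N) a n <= \sum_(n < m) a n + \sum_(n < N) (m <= n)%:R * a n.
Proof.
move=> a0; elim: N => [|N IH].
  by rewrite !big_ord0 addr0 sumr_ge0.
have [mN|Nm] := leqP m N.
  by rewrite !big_ord_recr /= mN mul1r addrA lerD2r.
apply: (@le_trans _ _ (\sum_(n < m) a n)); first exact: ler_sum_ord.
by rewrite lerDl sumr_ge0// => n _; rewrite mulr_ge0.
Qed.

(** All averages converge along an ultrafilter. The limit array inherits the
    bounds, so it comes from a function [g]; the coarse generations of the
    difference to [g] are finite sums that tend to zero, the fine ones are small by
    hypothesis, so [g] is a cluster point of the sequence in norm. *)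
Lemma equitail_compact (v : nat -> R -> R) c :
  (forall n, L1 (v n)) -> (forall n, Av (v n) 0 0 ^+ 2 <= c) ->
  (forall n N, \sum_(i < N) w ^+ i * energy (Av (v n)) i <= c) ->
  (forall e, 0 < e -> exists m, forall n N,
     \sum_(i < N) (m <= i)%:R * (w ^+ i * energy (Av (v n)) i) <= e) ->
  exists (phi : nat -> nat) (g : R -> R),
      [/\ {homo phi : m n / (m < n)%N}, Hs s g &
          Hs_norm s (v (phi n) \- g) @[n --> \oo] --> 0%E].
Proof.
move=> v1 v00 vc vt.
have [U [UU Uoo]] := ultraFilterLemma (_ : ProperFilter (nbhs \oo)).
have PU : ProperFilter U by exact: ultra_proper.
have c0 : 0 <= c by apply: le_trans (v00 0%N); exact: sqr_ge0.
have vb n i k : `|Av (v n) i k| <= 2 ^+ i * (1 + (c + c)).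
  have [v2 hv] := energy_L2 (v1 n) (sum_energy_le_weighted w1 (vc n)).
  apply: norm_Av_L2 => //; apply: le_trans hv _; exact: lerD.
have /choice[X0 hX0] : forall p : nat * nat, exists l : R, Av (v n) p.1 p.2 @[n --> U] --> l.
  by move=> [i k]; apply: ultra_limit (fun n => vb n i k).
pose X i k := X0 (i, k).
have hX i k : Av (v n) i k @[n --> U] --> X i k := hX0 (i, k).
have hD i k : hdif (Av (v n)) i k @[n --> U] --> hdif X i k.
  by apply: cvgM; [apply: cvgB; exact: hX|exact: cvg_cst].
have mX : mart X.
  move=> i k; apply: (@cvg_unique _ _ (Av (v n) i k @[n --> U])).
  - exact: norm_hausdorff.
  - exact: hX.
  rewrite (_ : (fun n => Av (v n) i k) =
    fun n => (Av (v n) i.+1 k.*2 + Av (v n) i.+1 k.*2.+1) / 2); last first.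
    by apply/funext => n; exact: Av_mart.
  by apply: cvgM; [apply: cvgD; exact: hX|exact: cvg_cst].
have hE i : energy (Av (v n)) i @[n --> U] --> energy X i.
  apply: cvgM; first exact: cvg_cst.
  apply: cvg_sumr => k.
  by under eq_fun do rewrite expr2; rewrite expr2; apply: cvgM; exact: hD.
have hS N (a : nat -> R) : \sum_(i < N) a i * energy (Av (v n)) i @[n --> U] -->
    \sum_(i < N) a i * energy X i.
  by apply: cvg_sumr => i; apply: cvgM; [exact: cvg_cst|exact: hE].
have Xc N : \sum_(i < N) w ^+ i * energy X i <= c.
  apply: (ler_cvg_to (hS N (fun i => w ^+ i)) (cvg_cst c)).
  by apply: nearW => n; exact: vc.
have [g [g1 gX]] := synthesis w1 mX Xc.
have eg i : energy (Av g) i = energy X i.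
  by apply: eq_lavg => k ki; rewrite /hdif !gX ?doubleS_lt_expn ?double_lt_expn.
have [gH _] : Hs s g /\ (Hs_sqnorm s g <= (Av g 0 0 ^+ 2 + 2 * c)%:E)%E.
  by apply: Hs_intro => // N; under eq_bigr do rewrite eg; exact: Xc.
have close e : 0 < e -> \forall n \near U, (Hs_sqnorm s (v n \- g)%R <= e%:E)%E.
  (* the head contributes [d], and the two tails [4 * d], doubled by [Hs_intro] *)
  move=> e0; pose d := e / 9; have d0 : 0 < d by rewrite divr_gt0.
  have [m hm] := vt d d0.
  have Xt N : \sum_(i < N) (m <= i)%:R * (w ^+ i * energy X i) <= d.
    under eq_bigr do rewrite mulrA.
    apply: (ler_cvg_to (hS N (fun i => (m <= i)%:R * w ^+ i)) (cvg_cst d)).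
    by apply: nearW => n; under eq_bigr do rewrite -mulrA; exact: hm.
  pose head n := (Av (v n) 0 0 - X 0 0) ^+ 2 +
    2 * \sum_(i < m) w ^+ i * lavg i (fun k => (hdif (Av (v n)) i k - hdif X i k) ^+ 2).
  have hhead : head n @[n --> U] --> (0 : R).
    have sq (a : nat -> R) l : a n @[n --> U] --> l -> (a n - l) ^+ 2 @[n --> U] --> (0 : R).
      move=> al; have d1 : a n - l @[n --> U] --> (0 : R).
        by rewrite -(subrr l); apply: cvgB => //; exact: cvg_cst.
      have h := cvgM d1 d1; rewrite mulr0 in h.
      by under eq_fun do rewrite expr2; exact: h.
    have z : 0 = 0 + 2 * \sum_(i < m) w ^+ i * lavg i (fun=> 0) :> R.
      by rewrite big1 ?mulr0 ?addr0// => i _; rewrite lavg_cst mulr0.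
    rewrite /head [X in _ --> X]z; apply: cvgD; first exact: sq.
    apply: cvgM; first exact: cvg_cst.
    apply: cvg_sumr => i.
    by do 2![apply: cvgM; first exact: cvg_cst]; apply: cvg_sumr => k; exact: sq.
  have /cvgrPdist_le/(_ d d0) := hhead.
  apply: filterS => n; rewrite sub0r normrN => hn.
  have h1 : L1 (fun x => v n x - g x) by exact: L1B.
  have dE i k : (k < 2 ^ i)%N -> hdif (Av (fun x => v n x - g x)) i k =
      hdif (Av (v n)) i k - hdif X i k.
    by move=> ki; rewrite AvB_hdif// /hdif !gX ?doubleS_lt_expn ?double_lt_expn.
  have hd N : \sum_(i < N) w ^+ i * energy (Av (fun x => v n x - g x)) i <=
      \sum_(i < m) w ^+ i * lavg i (fun k => (hdif (Av (v n)) i k - hdif X i k) ^+ 2) + 4 * d.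
    have W0 i : 0 <= w ^+ i * energy (Av (fun x => v n x - g x)) i.
      by apply: mulr_ge0 => //; exact: energy_ge0.
    apply: le_trans (sum_split m N W0) _.
    apply: lerD.
      apply: ler_sum => i _; rewrite ler_wpM2l//; apply: le_lavg => k ki.
      by rewrite dE.
    apply: (@le_trans _ _ (2 * \sum_(i < N) (m <= i)%:R * (w ^+ i * energy (Av (v n)) i)
      + 2 * \sum_(i < N) (m <= i)%:R * (w ^+ i * energy X i))); last first.
      by have := hm n N; have := Xt N; lra.
    rewrite !mulr_sumr -big_split; apply: ler_sum => i _ /=.
    have := ler_wpM2l (wX0 i) (energy_sub_le (dE i)).
    by case: (m <= i)%N; rewrite ?mul1r ?mul0r; lra.
  have [_ h2] := Hs_intro s_gt0 h1 hd; apply: le_trans h2 _; rewrite lee_fin.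
  have := le_trans (ler_norm _) hn; rewrite /head.
  rewrite (AvB _ _ (v1 n) g1) (gX 0%N 0%N)// /d; lra.
(* a set of the ultrafilter meets every neighbourhood of infinity, which gives
   indices that increase *)
have pick (j n0 : nat) : exists n, (n0 <= n)%N /\
    (Hs_sqnorm s (v n \- g)%R <= ((j.+1%:R^-1) ^+ 2)%:E)%E.
  have j0 : 0 < (j.+1%:R^-1 : R) ^+ 2 by rewrite exprn_gt0// invr_gt0.
  have hn0 : U [set n | (n0 <= n)%N] by apply: Uoo; exists n0.
  by have [n [h1 h2]] := filter_ex (filterI hn0 (close _ j0)); exists n.
have /choice[P hP] : forall p : nat * nat, exists n, (p.2 <= n)%N /\
    (Hs_sqnorm s (v n \- g)%R <= ((p.1.+1%:R^-1) ^+ 2)%:E)%E by move=> [j n0]; exact: pick.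
pose fix phi n := if n is n'.+1 then P (n, (phi n').+1) else P (0%N, 0%N).
have phiS n : (phi n < phi n.+1)%N by have [] := hP (n.+1, (phi n).+1).
have phie n : (Hs_norm s (v (phi n) \- g)%R <= (n.+1%:R^-1)%:E)%E.
  rewrite -lee_sqr ?sqrte_ge0 ?lee_fin//.
  rewrite sqr_sqrte ?Hs_sqnorm_ge0// -EFin_expe.
  by case: n => [|n]; [have [] := hP (0%N, 0%N)|have [] := hP (n.+1, (phi n).+1)].
exists phi, g; split => //.
  by apply: ssrnat.homo_ltn; [exact: ltn_trans|exact: phiS].
apply: (@squeeze_cvge _ _ _ _ (cst 0%E) _ (fun n => (n.+1%:R^-1)%:E)).
- by apply: nearW => n; rewrite sqrte_ge0 phie.
- exact: cvg_cst.
- by apply: cvg_EFin; [exact: nearW|exact: cvg_harmonic].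
Qed.

Lemma commutator_compact b : CMOs s b -> Hs_compact s (commutator b).
Proof.
move=> hb; have [hbmo _] := hb.
split=> [f|M u hu]; first exact: commutator_Hs_stable.
have [beta [beta0 _ b1 car]] := BMO_carleson s_gt0 hbmo.
pose Gam := M ^+ 2 + 1; have G0 : 0 < Gam by rewrite ltr_wpDl ?sqr_ge0.
have u2 n : L2 (u n) by have [/Hs_bounds[]] := hu n.
have uG n N : Av (u n) 0 0 ^+ 2 + \sum_(i < N) w ^+ i * energy (Av (u n)) i <= Gam.
  have [h1 h2] := hu n; apply: le_trans (Hs_norm_bounds h1 h2 N) _.
  by rewrite /Gam lerDl.
have bounds n := commutator_bounds s_gt0 b1 (sqr_ge0 beta) car (u2 n) G0 (uG n).
apply: (@equitail_compact (fun n => commutator b (u n)) (Ccom t * beta ^+ 2 * Gam)).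
- by move=> n; exact: (commutator_L1 s_gt0 b1 (sqr_ge0 beta) car (u2 n) G0 (uG n)).
- by move=> n; have [] := bounds n.
- by move=> n; have [] := bounds n.
move=> e e0.
have CT := Ctail_ge0 s_gt0.
have CT1 : 0 < Ctail t + 1 by rewrite ltr_wpDl.
pose d := e / ((Ctail t + 1) * Gam).
have d0 : 0 < d by rewrite divr_gt0// mulr_gt0// ltr_wpDl.
have [m hm] := CMO_carleson s_gt0 hb d0.
exists m.+1 => n N.
have h := @commutator_fine _ _ s_gt0 b (u n) _ Gam b1 (sqr_ge0 beta) car (u2 n) G0
  (uG n) m d N (ltW d0) hm.
apply: (@le_trans _ _ (Ctail t * d * Gam)); last first.
  rewrite (_ : Ctail t * d * Gam = e * (Ctail t / (Ctail t + 1))); last first.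
    by rewrite /d; field; rewrite !gt_eqF.
  by rewrite ler_piMr ?(ltW e0)// ler_pdivrMr// mul1r lerDl.
apply: le_trans h.
case: N => [|N]; first by rewrite !big_ord0.
rewrite big_ord_recl mul0r add0r; under eq_bigr do rewrite lift0 ltnS.
apply: (ler_sum_ord (u := fun n => (m <= n)%:R *
  (w ^+ n.+1 * energy (Av (commutator b (u _))) n.+1))) => // i.
by do ![exact: ler0n | exact: wX0 | exact: energy_ge0 | apply: mulr_ge0].
Qed.
End Compactness.

Theorem theorem1p3 (R : realType) (s : R) (s_gt0 : 0 < s) (s_lt1 : s < 1) :
  (exists2 C : R, 0 < C &
     forall b : R -> R, BMOs s b ->
       [/\ commutator_defined s b,
           Hs_bounded s (commutator b) &
           (Hs_opnorm s (commutator b) <= C%:E * BMOs_norm s b)%E]) /\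
  (forall b : R -> R, CMOs s b -> Hs_compact s (commutator b)).
Proof.
split; last by move=> b; exact: commutator_compact.
exists (Num.sqrt (3 * Ccom (scale s)) + 1); first by rewrite ltr_wpDl// sqrtr_ge0.
move=> b hb; have hC := commutator_opnorm s_gt0 hb.
split => //; first exact: commutator_defined_BMO.
split; first by move=> f; exact: commutator_Hs_stable.
apply: le_lt_trans hC _; have [beta [_ -> _ _]] := BMO_carleson s_gt0 hb.
by rewrite -EFinM ltry.
Qed.
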